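(* Let $(A,+,\times,0_A,1_A)$ be a semiring, $B$ a set, and $\Omega$ a poly-time computable strong $A$-pre-morphism with weights in $B$ that is corestriction independent. Let $H$ be an $\mathbf{e}$-free edge-labelled graph, $X$ a finite set, and $\mathcal{R}\subseteq X\times X_H$ (with $H$, $\mathcal{R}$, $\Omega$ fixed). Then there is an algorithm which, given an instance $G$ of $H$-($\mathcal{R}$-MORPHISM) on $n\geq 1$ vertices (an $\mathbf{e}$-free edge-labelled graph with $X_G=X$), a weight matrix $W\in B^{V_G\times V_H}$, and an optimal contraction sequence of $G$, outputs $\Omega_W(\{f : f \text{ is an } \mathcal{R}\text{-morphism from } G \text{ to } H\})$ in time $O\big((2^{|V_H|}-1)^{\mathrm{ctww}(G)}\cdot |V_G|^2\big)$.
   Context: An edge-labelled graph is $G=(V_G,l_G,X_G)$ with $V_G,X_G$ finite sets and $l_G:V_G^2\to X_G$. A special symbol $\mathbf{e}$ (occurring nowhere else) is used; $G$ is $\mathbf{e}$-free if $\mathbf{e}\notin X_G$. For $S\subseteq V_G$, $G[S]=(S,l_G|_{S^2},X_G)$. For $\mathbf{e}$-free $G,H$ and $\mathcal{R}\subseteq X_G\times X_H$, a map $f:V_G\to V_H$ is an $\mathcal{R}$-morphism if $(l_G(u,v),l_H(f(u),f(v)))\in\mathcal{R}$ for all $(u,v)\in V_G^2$. Contraction: for a partition $\mathcal{S}$ of $V_H$ into nonempty parts, the contraction $H_{\mathcal{S}}$ has vertex set $\mathcal{S}$, label set $X_H\cup\{\mathbf{e}\}$, and for $S_1,S_2\in\mathcal{S}$,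 $l_{H_{\mathcal{S}}}(S_1,S_2)=x$ if $l_H(u,v)=x$ for all $(u,v)\in S_1\times S_2$, and $=\mathbf{e}$ otherwise. A contraction sequence of an $\mathbf{e}$-free $H$ with $n$ vertices is $(H_n,\dots,H_1)$ with $H_n=H$ and $H_k$ the contraction of $H$ relative to a partition $\mathcal{P}_k$ with $k$ parts, where $\mathcal{P}_n$ is the partition into singletons and each $\mathcal{P}_k$ is obtained from $\mathcal{P}_{k+1}$ by merging two parts. The $\mathbf{e}$-connected components of an edge-labelled graph are the connected components of the undirected graph on its vertices with an edge $\{u,v\}$ whenever $\mathbf{e}\in\{l(u,v),l(v,u)\}$. The component-width of a contraction sequence is the maximum number of vertices of an $\mathbf{e}$-connected component of $H_{n-1},\dots,H_1$; the component twin-width $\mathrm{ctww}(H)$ is the minimum component-width over all contraction sequences; a sequence attaining it is optimal. Semiring: $(A,+,0_A)$ commutative monoid, $(A,\times,1_A)$ monoid, $\times$ distributes over $+$, $0_A$ absorbing for $\times$. For disjoint sets $S_1,S_2$ and $f_i:S_i\to T_i$, the join $f_1\bowtie f_2:S_1\uplus S_2\to T_1\cup T_2$ restricts to $f_i$ on $S_i$; for sets of functions $\mathcal{F}_1\bowtie\mathcal{F}_2=\{f_1\bowtie f_2:(f_1,f_2)\in\mathcal{F}_1\times\mathcal{F}_2\}$. An $A$-pre-morphism with weights in $B$ is a map $\Omega$ assigning to every pair of edge-labelled graphs $G,H$, every $S\subseteq V_G$, $T\subseteq V_H$, every set $\mathcal{F}$ of functions $S\to T$ and every $W\in B^{V_G\times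 V_H}$ a value $\Omega_W(\mathcal{F})\in A$ such that: (i) for disjoint sets $\mathcal{F}_1,\mathcal{F}_2$ of functions $S\to T$, $\Omega_W(\mathcal{F}_1\uplus\mathcal{F}_2)=\Omega_W(\mathcal{F}_1)+\Omega_W(\mathcal{F}_2)$; (ii) for disjoint $S_1,S_2\subseteq V_G$, disjoint $T_1,T_2\subseteq V_H$ and sets $\mathcal{F}_i$ of functions $S_i\to T_i$, $\Omega_W(\mathcal{F}_1\bowtie\mathcal{F}_2)=\Omega_W(\mathcal{F}_1)\times\Omega_W(\mathcal{F}_2)$; (iii) $\Omega_W(\emptyset)=0_A$. It is strong if (ii) holds without assuming $T_1,T_2$ disjoint. It is poly-time computable if $+,\times$ take constant time and $\Omega_W(\{f\})$ for the constant function $f:S\to\{a\}$ is computable in polynomial time. It is corestriction independent if for all $S\subseteq V_G$, $T'\subseteq T\subseteq V_H$, $f:S\to T$ with $f(S)\subseteq T'$, and $W$, $\Omega_W(\{f\})=\Omega_W(\{f'\})$ where $f':S\to T'$ is $f$ with codomain $T'$. *)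

(* Defs.v *)
From HB Require Import structures.
From mathcomp Require Import all_boot all_algebra.

Set Implicit Arguments.
Unset Strict Implicit.
Unset Printing Implicit Defensive.

(** * Edge-labelled graphs *)

(* The label set is the type X.  The special symbol e is the [None] of
   [option X]: a graph with labels in X is e-free by construction, and a graph
   that may use e has label set [option X]. *)
Record elgraph (X : finType) := ELGraph {
  vert : finType;
  lab : vert -> vert -> X
}.

Definition is_morphism (X Y : finType) (R : {set X * Y})
    (G : elgraph X) (H : elgraph Y) (f : vert G -> vert H) : bool :=
  [forall u, forall v, (lab u v, lab (f u) (f v)) \in R].

(* The parts of a partition are nonempty, so the [x] picked is unique. *)
Definition contraction (X : finType) (H : elgraph X)
    (P : {set {set vert H}}) : elgraph (option X) :=
  @ELGraph (option X) {S : {set vert H} | S \in P}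
    (fun S1 S2 => [pick x | [forall u in val S1, forall v in val S2,
                               lab u v == x]]).
Arguments contraction {X} H P.

Definition e_adj (X : finType) (K : elgraph (option X)) : rel (vert K) :=
  fun u v => (lab u v == None) || (lab v u == None).

Definition e_component (X : finType) (K : elgraph (option X)) (u : vert K) :
    {set vert K} :=
  [set v | connect (@e_adj X K) u v].

Definition max_component (X : finType) (K : elgraph (option X)) : nat :=
  \max_(u : vert K) #|e_component u|.

Definition merge_step (V : finType) : rel {set {set V}} := fun P Q =>
  [exists S1 in P, exists S2 in P,
    (S1 != S2) && (Q == (S1 :|: S2) |: (P :\ S1 :\ S2))].

Definition singletons (V : finType) : {set {set V}} := [set [set v] | v : V].

(* The sequence of partitions (P_n, ..., P_1), n being the number of vertices;
   the graph H_k is [contraction H P_k]. *)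
Definition partition_seq (X : finType) (H : elgraph X) : Type :=
  #|vert H|.-tuple {set {set vert H}}.

Definition is_contraction_seq (X : finType) (H : elgraph X)
    (P : partition_seq H) : bool :=
  (head set0 P == singletons (vert H)) && sorted (@merge_step (vert H)) P.

(* [behead] drops P_n: only H_{n-1}, ..., H_1 count. *)
Definition component_width (X : finType) (H : elgraph X)
    (P : partition_seq H) : nat :=
  \max_(Q <- behead P) max_component (contraction H Q).

(* A component-width never exceeds #|vert H|, so the neutral element of the
   minimum is harmless. *)
Definition ctww (X : finType) (H : elgraph X) : nat :=
  \big[minn/#|vert H|]_(P : #|vert H|.-tuple {set {set vert H}}
                          | is_contraction_seq P) component_width P.

Definition optimal_contraction_seq (X : finType) (H : elgraph X)
    (P : partition_seq H) : Prop :=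
  is_contraction_seq P /\ component_width P = ctww H.

(** * Pre-morphisms *)

(* Functions between subsets; the codomain T is part of the type. *)
Definition fn (V U : finType) (S : {set V}) (T : {set U}) : finType :=
  {ffun {x : V | x \in S} -> {y : U | y \in T}}.

Definition const_fn (V U : finType) (S : {set V}) (a : U) : fn S [set a] :=
  [ffun _ => exist _ a (set11 a)].

Definition is_join (V U : finType) (S1 S2 : {set V}) (T1 T2 : {set U})
    (f1 : fn S1 T1) (f2 : fn S2 T2) (h : fn (S1 :|: S2) (T1 :|: T2)) : bool :=
  [forall x, forall x1, (val x1 == val x) ==> (val (h x) == val (f1 x1))] &&
  [forall x, forall x2, (val x2 == val x) ==> (val (h x) == val (f2 x2))].

Definition join_set (V U : finType) (S1 S2 : {set V}) (T1 T2 : {set U})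
    (F1 : {set fn S1 T1}) (F2 : {set fn S2 T2}) :
    {set fn (S1 :|: S2) (T1 :|: T2)} :=
  [set h | [exists f1 in F1, exists f2 in F2, is_join f1 f2 h]].

Definition weighting (A B : Type) : Type :=
  forall (X Y : finType) (G : elgraph X) (H : elgraph Y)
    (W : {ffun vert G * vert H -> B})
    (S : {set vert G}) (T : {set vert H}), {set fn S T} -> A.

Record pre_morphism (A : pzSemiRingType) (B : Type) (Omega : weighting A B) :
    Prop := PreMorphism {
  pre_morphism_union :
    forall (X Y : finType) (G : elgraph X) (H : elgraph Y)
      (W : {ffun vert G * vert H -> B}) (S : {set vert G}) (T : {set vert H})
      (F1 F2 : {set fn S T}),
    [disjoint F1 & F2] ->
    Omega X Y G H W S T (F1 :|: F2) =
      (Omega X Y G H W S T F1 + Omega X Y G H W S T F2)%R;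
  pre_morphism_join :
    forall (X Y : finType) (G : elgraph X) (H : elgraph Y)
      (W : {ffun vert G * vert H -> B})
      (S1 S2 : {set vert G}) (T1 T2 : {set vert H})
      (F1 : {set fn S1 T1}) (F2 : {set fn S2 T2}),
    [disjoint S1 & S2] -> [disjoint T1 & T2] ->
    Omega X Y G H W (S1 :|: S2) (T1 :|: T2) (join_set F1 F2) =
      (Omega X Y G H W S1 T1 F1 * Omega X Y G H W S2 T2 F2)%R;
  pre_morphism_empty :
    forall (X Y : finType) (G : elgraph X) (H : elgraph Y)
      (W : {ffun vert G * vert H -> B}) (S : {set vert G}) (T : {set vert H}),
    Omega X Y G H W S T set0 = 0%R
}.

Definition strong_pre_morphism (A : pzSemiRingType) (B : Type)
    (Omega : weighting A B) : Prop :=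
  pre_morphism Omega /\
  forall (X Y : finType) (G : elgraph X) (H : elgraph Y)
    (W : {ffun vert G * vert H -> B})
    (S1 S2 : {set vert G}) (T1 T2 : {set vert H})
    (F1 : {set fn S1 T1}) (F2 : {set fn S2 T2}),
  [disjoint S1 & S2] ->
  Omega X Y G H W (S1 :|: S2) (T1 :|: T2) (join_set F1 F2) =
    (Omega X Y G H W S1 T1 F1 * Omega X Y G H W S2 T2 F2)%R.

Definition corestriction_independent (A B : Type) (Omega : weighting A B) :
    Prop :=
  forall (X Y : finType) (G : elgraph X) (H : elgraph Y)
    (W : {ffun vert G * vert H -> B})
    (S : {set vert G}) (T T' : {set vert H}) (f : fn S T) (f' : fn S T'),
  T' \subset T -> (forall x, val (f x) = val (f' x)) ->
  Omega X Y G H W S T [set f] = Omega X Y G H W S T' [set f'].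

(* R-morphisms from G to H, as functions from the full set V_G to V_H. *)
Definition morphisms (X Y : finType) (R : {set X * Y})
    (G : elgraph X) (H : elgraph Y) :
    {set fn [set: vert G] [set: vert H]} :=
  [set f : fn [set: vert G] [set: vert H] |
    is_morphism R (fun u => val (f (exist _ u (in_setT u))))].

(* [tau G H W S a] is the time taken to evaluate Omega_W({S -> {a} constant}). *)
Definition evaluation_time (B : Type) : Type :=
  forall (X Y : finType) (G : elgraph X) (H : elgraph Y)
    (W : {ffun vert G * vert H -> B}) (S : {set vert G}) (a : vert H), nat.

(* Polynomial in the size of the data attached to S -> {a}: the induced graph
   G[S], the graph H and the restriction of W to S x V_H.  The constant-time
   cost of + and * is built into the machine below. *)
Definition poly_time (B : Type) (tau : evaluation_time B) : Prop :=
  exists c d : nat,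
  forall (X Y : finType) (G : elgraph X) (H : elgraph Y)
    (W : {ffun vert G * vert H -> B}) (S : {set vert G}) (a : vert H),
  tau X Y G H W S a <= c * (1 + #|S| + #|vert H| + #|X| + #|Y|) ^ d.

(** * Uniform-cost random access machine

    There is a read-only input tape of natural numbers, a memory of natural
    numbers and a memory of semiring elements, all randomly accessible.  Every
    elementary operation costs 1; numbers can only be added and subtracted. *)

Inductive nexp :=
  | NConst of nat
  | NInput of nexp
  | NCell of nexp
  | NAdd of nexp & nexp
  | NSub of nexp & nexp.

Inductive aexp :=
  | AZero
  | AOne
  | ACell of nexp
  | AAdd of aexp & aexp
  | AMul of aexp & aexp.

Inductive cmd :=
  | Skip
  | NStore of nexp & nexp
  | AStore of nexp & aexp
  | Query of nexp & nexp & nexp & nexp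
  | Seq of cmd & cmd
  | If of nexp & cmd & cmd
  | While of nexp & cmd.

Record state (A : Type) := State { nmem : nat -> nat; amem : nat -> A }.

Definition update (T : Type) (m : nat -> T) (i : nat) (x : T) : nat -> T :=
  fun j => if j == i then x else m j.

Fixpoint neval (inp mem : nat -> nat) (e : nexp) : nat :=
  match e with
  | NConst c => c
  | NInput e1 => inp (neval inp mem e1)
  | NCell e1 => mem (neval inp mem e1)
  | NAdd e1 e2 => neval inp mem e1 + neval inp mem e2
  | NSub e1 e2 => neval inp mem e1 - neval inp mem e2
  end.

Fixpoint ncost (e : nexp) : nat :=
  match e with
  | NConst _ => 1
  | NInput e1 | NCell e1 => (ncost e1).+1
  | NAdd e1 e2 | NSub e1 e2 => (ncost e1 + ncost e2).+1
  end.

Fixpoint aeval (A : pzSemiRingType) (inp : nat -> nat) (s : state A)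
    (e : aexp) : A :=
  match e with
  | AZero => 0%R
  | AOne => 1%R
  | ACell e1 => amem s (neval inp (nmem s) e1)
  | AAdd e1 e2 => (aeval inp s e1 + aeval inp s e2)%R
  | AMul e1 e2 => (aeval inp s e1 * aeval inp s e2)%R
  end.

Fixpoint acost (e : aexp) : nat :=
  match e with
  | AZero | AOne => 1
  | ACell e1 => (ncost e1).+1
  | AAdd e1 e2 | AMul e1 e2 => (acost e1 + acost e2).+1
  end.

(* [exec inp query p s s' t]: program p, started in s, halts in s' after t time
   units.  [Query addr base len tgt] stores at semiring address addr the answer
   of the evaluation oracle on the list of the len numbers stored from address
   base on and on the number tgt; the oracle returns a value and the time
   needed to compute it, and [None] blocks the machine. *)
Inductive exec (A : pzSemiRingType) (inp : nat -> nat)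
    (query : seq nat -> nat -> option (A * nat)) :
    cmd -> state A -> state A -> nat -> Prop :=
  | ExecSkip s : exec inp query Skip s s 0
  | ExecNStore addr e s :
      exec inp query (NStore addr e) s
        (State (update (nmem s) (neval inp (nmem s) addr)
                       (neval inp (nmem s) e))
               (amem s))
        (1 + ncost addr + ncost e)
  | ExecAStore addr e s :
      exec inp query (AStore addr e) s
        (State (nmem s)
               (update (amem s) (neval inp (nmem s) addr) (aeval inp s e)))
        (1 + ncost addr + acost e)
  | ExecQuery addr base len tgt s x t :
      query [seq nmem s (neval inp (nmem s) base + i)
                | i <- iota 0 (neval inp (nmem s) len)]
            (neval inp (nmem s) tgt) = Some (x, t) ->
      exec inp query (Query addr base len tgt) s
        (State (nmem s) (update (amem s) (neval inp (nmem s) addr) x))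
        (1 + ncost addr + ncost base + ncost len + ncost tgt
           + neval inp (nmem s) len + t)
  | ExecSeq p q s1 s2 s3 t1 t2 :
      exec inp query p s1 s2 t1 -> exec inp query q s2 s3 t2 ->
      exec inp query (Seq p q) s1 s3 (t1 + t2)
  | ExecIf e p q s s' t :
      exec inp query (if neval inp (nmem s) e != 0 then p else q) s s' t ->
      exec inp query (If e p q) s s' (1 + ncost e + t)
  | ExecWhileDone e p s :
      neval inp (nmem s) e = 0 ->
      exec inp query (While e p) s s (1 + ncost e)
  | ExecWhileStep e p s1 s2 s3 t1 t2 :
      neval inp (nmem s1) e != 0 ->
      exec inp query p s1 s2 t1 -> exec inp query (While e p) s2 s3 t2 ->
      exec inp query (While e p) s1 s3 (1 + ncost e + t1 + t2).

Definition init_state (A : pzSemiRingType) : state A :=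
  State (fun _ => 0) (fun _ => 0%R).

(* Vertices and labels are numbered by [enum_rank].  The tape holds the number n
   of vertices, then the n * n label matrix of G row by row, then, for each of
   P_n, ..., P_1, a row of n numbers giving for each vertex the least vertex
   of its part. *)
Definition part_number (V : finType) (Q : {set {set V}}) (v : V) : nat :=
  find [in pblock Q v] (enum V).

Definition input_tape (X : finType) (G : elgraph X) (P : partition_seq G) :
    seq nat :=
  #|vert G| ::
  [seq nat_of_ord (enum_rank (lab u v)) | u <- enum (vert G),
                                          v <- enum (vert G)] ++
  [seq part_number Q v | Q <- tval P, v <- enum (vert G)].

(* W enters a computation only through values of Omega_W on singletons of
   constant functions S -> {a}. *)
Definition evaluation_oracle (A B : Type) (Omega : weighting A B)
    (tau : evaluation_time B) (X Y : finType) (G : elgraph X) (H : elgraph Y)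
    (W : {ffun vert G * vert H -> B}) (s : seq nat) (k : nat) :
    option (A * nat) :=
  let S := [set v : vert G | nat_of_ord (enum_rank v) \in s] in
  omap (fun a => (Omega X Y G H W S [set a] [set const_fn S a],
                  tau X Y G H W S a))
       [pick a : vert H | nat_of_ord (enum_rank a) == k].

(* The program halts on the given input within time T, with output (the
   semiring element at address 0) equal to x. *)
Definition computes_within (A : pzSemiRingType) (tape : seq nat)
    (query : seq nat -> nat -> option (A * nat)) (p : cmd) (x : A) (T : nat) :
    Prop :=
  exists (s : state A) (t : nat),
    [/\ exec (nth 0 tape) query p (init_state A) s t, amem s 0 = x & t <= T].

(* Main.v *)
Require Import Defs.
From mathcomp Require Import all_boot all_algebra.
From mathcomp Require Import zify.

Set Implicit Arguments.
Unset Strict Implicit.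
Unset Printing Implicit Defensive.
Import GRing.Theory.

(** Since Omega is strong and corestriction independent, Omega_W(F) is the sum
    over f in F of the products of the values q(v, f v) of Omega_W on the
    functions {v} -> {f v}, and these values commute for distinct v.  So only
    constant-time oracle calls on single vertices are needed, and the task is to
    compute the sum, over all morphisms f, of the products of the q(v, f v).

    For each e-connected component of the current contraction, a table stores,
    for each profile (a nonempty subset of V_H for each part of the component),
    the sum over the partial morphisms whose image on each part is the
    prescribed subset.  A table is only required to be correct for the profiles
    compatible with the homogeneous labels of the component.  This is what
    allows the step that merges two parts s and s2 to test only the pairs
    involving s or s2, hence to spend O(n) per profile: all other pairs keep
    their labels and can be tested later.  A step enumerates the at most
    (2^|V_H| - 1)^(ctww + 1) profiles of the components that it joins, and there
    are n - 1 steps. *)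

(** Two features of the machine shape the program. It cannot multiply numbers, so a profile is
    addressed by its code in base [N = 2^|V_H|], and the contribution [d i * N ^ i] of each digit is
    stored and updated from precomputed powers; the only factors are constants of the program. Its
    memory is unbounded, zero at the start and free until touched, so every joined component
    receives a fresh block of [N ^ n] cells, however few of them are written. Semiring cells 0 and
    1, below all blocks, hold the output and a running product.

    The exponent ctww + 1 arises because profiles are enumerated before the merge, when the part
    that is about to disappear is still present. The extra factor [2^|V_H| - 1] is a constant, as H
    is fixed.

    A cell of an incompatible profile may hold a meaningless value. This is harmless: whatever is
    computed from it is either skipped by a later check or again belongs to an incompatible profile.
    The last check, at the output, concerns the label of the only remaining part with itself. *)

(** * A program logic for the random access machine *)

(* Cell [i] of the array [a] is stored at the address [32 * i + code a], so the
   arrays are unbounded and disjoint; a scalar variable is cell [0] of an array. *)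
Inductive arr :=
  | vN | vI | vK | vW | vPtr | vS | vS2 | vBase | vBlk | vRun | vCarry | vBad
  | vTgt | aAl | aCo | aGe | aMk | aT | aV | aPw | aAcc | aRow | aL | aCT | aWP.

Definition code (a : arr) : nat :=
  match a with
  | vN => 0 | vI => 1 | vK => 2 | vW => 3 | vPtr => 4 | vS => 5 | vS2 => 6
  | vBase => 7 | vBlk => 8 | vRun => 9 | vCarry => 10 | vBad => 11 | vTgt => 12
  | aAl => 13 | aCo => 14 | aGe => 15 | aMk => 16 | aT => 17 | aV => 18
  | aPw => 19 | aAcc => 20 | aRow => 21 | aL => 22 | aCT => 23 | aWP => 24
  end.

Lemma code_lt a : code a < 32. Proof. by case: a. Qed.

(** Comparing codes lets a test between two concrete arrays reduce by computation. *)
Definition eqarr a b := code a == code b.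

(** The machine has no product, so a constant factor is unrolled into additions; the cost depends on
    [c] but not on the input. *)
Fixpoint nmulC (c : nat) (e : nexp) : nexp :=
  if c is c'.+1 then NAdd e (nmulC c' e) else NConst 0.

Definition addr a e := NAdd (nmulC 32 e) (NConst (code a)).
Definition rd a e := NCell (addr a e).
Definition wr a e x := NStore (addr a e) x.
Definition var a := rd a (NConst 0).
Definition setv a x := wr a (NConst 0) x.
(** Subtraction is truncated, so this is the absolute difference: nonzero exactly when the values
    differ. *)
Definition ndist e1 e2 := NAdd (NSub e1 e2) (NSub e2 e1).
Definition seqs (cs : seq cmd) : cmd := foldr Seq Skip cs.
Definition For i b body :=
  Seq (setv i (NConst 0))
      (While (NSub b (var i)) (Seq body (setv i (NAdd (var i) (NConst 1))))).

Fixpoint flat (c : cmd) : bool :=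
  match c with
  | Query _ _ _ _ | While _ _ => false
  | Seq p q | If _ p q => flat p && flat q
  | _ => true
  end.

(* An upper bound for the time of [c] when every loop body is run once and
   every oracle call has a list of length one and takes time at most [C]. *)
Fixpoint scost (C : nat) (c : cmd) : nat :=
  match c with
  | Skip => 0
  | NStore a e => 1 + ncost a + ncost e
  | AStore a e => 1 + ncost a + acost e
  | Query a b l t => 1 + ncost a + ncost b + ncost l + ncost t + 1 + C
  | Seq p q => scost C p + scost C q
  | If e p q => 1 + ncost e + scost C p + scost C q
  | While e p => 1 + ncost e + scost C p
  end.

Arguments nmulC : simpl never.
Arguments wr : simpl never.
Arguments rd : simpl never.
Arguments var : simpl never.
Arguments setv : simpl never.
Arguments For : simpl never.
Arguments ndist : simpl never.

Section Machine.

Variables (A : pzSemiRingType) (inp : nat -> nat).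
Variables (query : seq nat -> nat -> option (A * nat)) (C : nat).

Implicit Types (s : state A) (a b : arr) (Q : state A -> Prop).

Definition get s a i := nmem s (32 * i + code a).
Definition setn s a i x :=
  State (update (nmem s) (32 * i + code a) x) (amem s).
Definition seta s k x := State (nmem s) (update (amem s) k x).
Definition ev s e := neval inp (nmem s) e.

(** Meaningful for [flat] commands only: [Query] and [While] fall into the default case and act as
    no-ops. *)
Fixpoint run (c : cmd) s : state A :=
  match c with
  | NStore a e => State (update (nmem s) (ev s a) (ev s e)) (amem s)
  | AStore a e => State (nmem s) (update (amem s) (ev s a) (aeval inp s e))
  | Seq p q => run q (run p s)
  | If e p q => if ev s e != 0 then run p s else run q s
  | _ => s
  end.

Lemma get_setn s a i x b j :
  get (setn s a i x) b j = if eqarr b a && (j == i) then x else get s b j.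
Proof.
rewrite /get /setn /= /update /eqarr.
have := code_lt a; have := code_lt b.
by case: (code b =P code a); case: (j =P i); case: eqP => //=; lia.
Qed.

Lemma get_seta s k x b j : get (seta s k x) b j = get s b j.
Proof. by []. Qed.

Lemma amem_setn s a i x : amem (setn s a i x) = amem s.
Proof. by []. Qed.

Lemma amem_seta s k x j :
  amem (seta s k x) j = if j == k then x else amem s j.
Proof. by []. Qed.

Definition stE := (get_setn, get_seta, amem_setn, amem_seta).

Lemma ev_const s c : ev s (NConst c) = c. Proof. by []. Qed.
Lemma ev_add s e1 e2 : ev s (NAdd e1 e2) = ev s e1 + ev s e2.
Proof. by []. Qed.
Lemma ev_sub s e1 e2 : ev s (NSub e1 e2) = ev s e1 - ev s e2.
Proof. by []. Qed.
Lemma ev_inp s e : ev s (NInput e) = inp (ev s e). Proof. by []. Qed.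
Lemma ev_nmulC s c e : ev s (nmulC c e) = c * ev s e.
Proof. by elim: c => //= c IH; rewrite /nmulC -/nmulC ev_add IH mulSn. Qed.
Lemma ev_rd s a e : ev s (rd a e) = get s a (ev s e).
Proof.
rewrite /rd /get -[LHS]/(nmem s (ev s (addr a e))).
by rewrite /addr ev_add ev_nmulC.
Qed.
Lemma ev_var s a : ev s (var a) = get s a 0.
Proof. by rewrite /var ev_rd. Qed.
Lemma ev_dist s e1 e2 :
  ev s (ndist e1 e2) = (ev s e1 - ev s e2) + (ev s e2 - ev s e1).
Proof. by []. Qed.

Definition evE :=
  (ev_const, ev_var, ev_rd, ev_dist, ev_add, ev_sub, ev_inp, ev_nmulC).

Lemma run_wr s a e x : run (wr a e x) s = setn s a (ev s e) (ev s x).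
Proof. by rewrite /wr /setn /= /addr ev_add ev_nmulC. Qed.
Lemma run_setv s a x : run (setv a x) s = setn s a 0 (ev s x).
Proof. by rewrite /setv run_wr. Qed.
Lemma run_seq p q s : run (Seq p q) s = run q (run p s). Proof. by []. Qed.
Lemma run_if e p q s :
  run (If e p q) s = if ev s e != 0 then run p s else run q s.
Proof. by []. Qed.
Lemma run_astore e x s :
  run (AStore e x) s = seta s (ev s e) (aeval inp s x).
Proof. by []. Qed.
Lemma run_skip s : run Skip s = s. Proof. by []. Qed.

Definition runE :=
  (run_wr, run_setv, run_seq, run_if, run_astore, run_skip).

(** The time bound factors into [scost C c], fixed by the program text, and [m], which counts
    iterations. Sequencing keeps [m] and a loop multiplies it, so no constant is tracked by hand. *)
Definition wp (m : nat) (c : cmd) Q s :=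
  exists s' t, [/\ exec inp query c s s' t, t <= scost C c * m & Q s'].

Lemma wp_mono m m' c Q Q' s :
  m <= m' -> (forall s', Q s' -> Q' s') -> wp m c Q s -> wp m' c Q' s.
Proof.
move=> mm QQ [s' [t [ex tm qs]]]; exists s', t; split=> //; last exact: QQ.
by apply: leq_trans tm _; rewrite leq_mul2l mm orbT.
Qed.

Lemma exec_flat c s : flat c ->
  exists2 t, exec inp query c s (run c s) t & t <= scost C c.
Proof.
elim: c s => //=.
- by move=> s _; exists 0 => //; constructor.
- by move=> a e s _; eexists; [apply: ExecNStore|].
- by move=> a e s _; eexists; [apply: ExecAStore|].
- move=> p IHp q IHq s /andP[/IHp fp /IHq fq].
  have [t1 e1 l1] := fp s; have [t2 e2 l2] := fq (run p s).
  by exists (t1 + t2); [apply: ExecSeq e1 e2 | apply: leq_add].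
- move=> e p IHp q IHq s /andP[/IHp fp /IHq fq].
  have [t1 e1 l1] := fp s; have [t2 e2 l2] := fq s.
  exists (1 + ncost e + (if ev s e != 0 then t1 else t2)).
    by constructor; rewrite -/(ev s e); case: ifP.
  by case: ifP => _; lia.
Qed.

Lemma wp_flat m c Q s : flat c -> 0 < m -> Q (run c s) -> wp m c Q s.
Proof.
move=> fc m0 qs; have [t ex le] := exec_flat s fc.
by exists (run c s), t; split=> //; apply: leq_trans le _; rewrite leq_pmulr.
Qed.

Lemma wp_seq m p q Q s :
  wp m p (fun s' => wp m q Q s') s -> wp m (Seq p q) Q s.
Proof.
move=> [s1 [t1 [e1 l1 [s2 [t2 [e2 l2 q2]]]]]].
exists s2, (t1 + t2); split=> //; first exact: ExecSeq e1 e2.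
by rewrite /= mulnDl leq_add.
Qed.

Lemma wp_while R m e body (I : nat -> state A -> Prop) s :
  0 < m -> I 0 s ->
  (forall r s, r < R -> I r s -> ev s e != 0 /\ wp m body (I r.+1) s) ->
  (forall s, I R s -> ev s e = 0) ->
  wp (m * R.+1) (While e body) (I R) s.
Proof.
move=> m0 I0 step stop.
(* Tests and bodies are counted apart: with [k] iterations left there are [k.+1] tests and [k]
   bodies, whence the factor [R.+1]. *)
suff gen k r s1 : r + k = R -> I r s1 ->
    exists s' t, [/\ exec inp query (While e body) s1 s' t,
      t <= (1 + ncost e) * k.+1 + scost C body * m * k & I R s'].
  have [s' [t [ex tl q]]] := gen R 0 s (add0n R) I0.
  exists s', t; split=> //; apply: leq_trans tl _.
  rewrite -[scost C (While e body)]/(1 + ncost e + scost C body)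
    [leqRHS]mulnDl; apply: leq_add; first by rewrite leq_mul2l leq_pmull ?orbT.
  by rewrite -mulnA !leq_mul // leqW.
elim: k r s1 => [|k IH] r s1 rk Ir.
  rewrite addn0 in rk; rewrite -rk in stop *.
  exists s1, (1 + ncost e); split=> //; last by lia.
  by apply: ExecWhileDone; apply: stop.
have [|nz [s2 [t1 [e1 l1 I1]]]] := step r s1 _ Ir; first by lia.
have [|s3 [t2 [e2 l2 I2]]] := IH r.+1 s2 _ I1; first by lia.
exists s3, (1 + ncost e + t1 + t2); split=> //; last by rewrite !mulnS in l2 *; lia.
exact: ExecWhileStep nz e1 e2.
Qed.

(** The invariant at [k.+1] is required after the counter has been advanced, so a client reasons
    about its body alone; the body must leave the counter intact. *)
Lemma wp_for n m i (b : nexp) body (I : nat -> state A -> Prop) s :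
  0 < m -> I 0 (setn s i 0 0) ->
  (forall k s, k <= n -> I k s -> ev s b = n) ->
  (forall k s, k < n -> get s i 0 = k -> I k s ->
     wp m body (fun s' => get s' i 0 = k /\ I k.+1 (setn s' i 0 k.+1)) s) ->
  wp (m * n.+1) (For i b body) (I n) s.
Proof.
move=> m0 I0 bn step; rewrite /For.
apply: wp_seq; apply: wp_flat; rewrite ?muln_gt0 ?m0 // runE ev_const.
apply: (@wp_mono (m * n.+1) _ _ (fun s => get s i 0 = n /\ I n s)) => //.
  by move=> s' [].
apply: (@wp_while n m _ _ (fun k s => get s i 0 = k /\ I k s)) => //.
- by rewrite get_setn /eqarr !eqxx.
- move=> r s1 rn [gr Ir]; split.
    by rewrite !evE (bn r) ?gr //; [rewrite -lt0n subn_gt0 | apply: ltnW].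
  apply: wp_seq; have := step r s1 rn gr Ir.
  apply: wp_mono => // s2 [g2 I2]; apply: wp_flat => //.
  rewrite runE !evE g2 addn1; split=> //.
  by rewrite get_setn /eqarr !eqxx.
- by move=> s1 [gn In]; rewrite !evE (bn n) // gn subnn.
Qed.

Lemma wp_for_flat n i (b : nexp) body (I : nat -> state A -> Prop) s :
  flat body -> I 0 (setn s i 0 0) ->
  (forall k s, k <= n -> I k s -> ev s b = n) ->
  (forall k s, k < n -> get s i 0 = k -> I k s ->
     get (run body s) i 0 = k /\ I k.+1 (setn (run body s) i 0 k.+1)) ->
  wp n.+1 (For i b body) (I n) s.
Proof.
move=> fb I0 bn step; rewrite -[n.+1]mul1n; apply: wp_for => // k s1 kn g Ik.
by apply: wp_flat => //; apply: step.
Qed.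

Lemma flat_seqs (T : Type) (F : T -> cmd) (l : seq T) :
  (forall x, flat (F x)) -> flat (seqs (map F l)).
Proof. by move=> fF; elim: l => //= x l ->; rewrite fF. Qed.

Lemma run_stores a (e : nat -> nexp) m s :
  (forall i j x s, ev (setn s a j x) (e i) = ev s (e i)) ->
  let s' := run (seqs [seq wr a (NConst i) (e i) | i <- iota 0 m]) s in
  [/\ forall i, i < m -> get s' a i = ev s (e i),
      forall b i, ~~ eqarr b a -> get s' b i = get s b i
    & amem s' = amem s].
Proof.
move=> he s'.
(* The occurrences of [0] are there for the induction to generalise to an arbitrary first index;
   cells of [a] below that index must then be preserved too. *)
have : [/\ forall i, 0 <= i < 0 + m -> get s' a i = ev s (e i),
      forall b i, ~~ (eqarr b a && (0 <= i)) -> get s' b i = get s b i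
    & amem s' = amem s].
  rewrite /s'; elim: m 0 s {s'} => [|m IH] k s /=.
    by split=> // i; rewrite addn0; case: leqP => // /leq_trans h /h; rewrite ltnn.
  have [h1 h2 h3] := IH k.+1 (run (wr a (NConst k) (e k)) s).
  split=> [i|b i|].
  - rewrite leq_eqVlt => /andP[/orP[/eqP<- _|ki im]].
      rewrite h2 ?ltnn ?andbF // runE !evE get_setn /eqarr !eqxx //.
    by rewrite h1 ?ki ?addSnnS // run_wr he.
  - move=> nb; rewrite h2; last by apply: contra nb => /andP[-> /ltnW].
    rewrite run_wr get_setn; case: eqP nb => [->|_]; last by rewrite andbF.
    by rewrite evE leqnn andbT => /negbTE->.
  by rewrite h3 run_wr.
by move=> [h1 h2 h3]; split=> // b i nb; apply: h2; rewrite andbT.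
Qed.

End Machine.

Arguments get : simpl never.
Arguments setn : simpl never.
Arguments seta : simpl never.
Arguments ev : simpl never.
Arguments run : simpl never.

(** * Labels between parts *)

Section Homogeneous.

Variables (n : nat) (lb : 'I_n -> 'I_n -> nat).
Hypothesis lb_gt0 : forall v w, 0 < lb v w.

Implicit Types (rho : 'I_n -> 'I_n) (i j v w : 'I_n).

(** [rho] sends a vertex to the representative of its part. When [i] and [j] represent their own
    parts, comparing with [lb i j] detects non-homogeneity without quantifying over a common
    label. *)
Definition hetero rho i j :=
  [exists v, exists w, [&& rho v == i, rho w == j & lb v w != lb i j]].

(* The label between the parts of [i] and [j], with [0] playing the role of e. *)
Definition hlab rho i j := if hetero rho i j then 0 else lb i j.

Definition eadj rho : rel 'I_n := fun i j =>
  [&& rho i == i, rho j == j & hetero rho i j || hetero rho j i].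

Definition merge_rep rho s s2 : 'I_n -> 'I_n :=
  fun v => if rho v == s2 then s else rho v.

Lemma hlabP rho v w : hlab rho (rho v) (rho w) != 0 ->
  lb v w = hlab rho (rho v) (rho w).
Proof.
rewrite /hlab; case: ifP => // h _; apply/eqP; apply: contraFT h => ne.
by apply/existsP; exists v; apply/existsP; exists w; rewrite !eqxx.
Qed.

Lemma hlab_eq0 rho i j : (hlab rho i j == 0) = hetero rho i j.
Proof. by rewrite /hlab; case: ifP => // _; rewrite eqn0Ngt lb_gt0. Qed.

Lemma hlab_char rho i j x : rho i = i -> rho j = j ->
  (forall v w, rho v = i -> rho w = j -> lb v w = x) -> hlab rho i j = x.
Proof.
move=> ri rj h; rewrite /hlab; case: ifP => [|_]; last exact: h.
case/existsP=> v /existsP[w /and3P[/eqP rv /eqP rw]].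
by rewrite (h v w) // (h i j) // eqxx.
Qed.

Lemma hlab_eq0P rho i j v w v' w' : rho v = i -> rho w = j -> rho v' = i ->
  rho w' = j -> lb v w != lb v' w' -> hlab rho i j = 0.
Proof.
move=> rv rw rv' rw' ne; apply/eqP; apply: contraT => nz.
move: (nz) ne; rewrite -{1}rv -{1}rw => /hlabP ->.
by rewrite rv rw; move: (nz); rewrite -{1}rv' -{1}rw' => /hlabP ->; rewrite rv' rw' eqxx.
Qed.

Definition same_or0 x y := if x == y then x else 0.

Section Merge.

Variables (rho : 'I_n -> 'I_n) (s s2 : 'I_n).
Hypotheses (rs : rho s = s) (rs2 : rho s2 = s2) (ss2 : s != s2).

Let rho' := merge_rep rho s s2.

Lemma merge_rep_fix i : (rho' i == i) = (rho i == i) && (i != s2).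
Proof.
rewrite /rho' /merge_rep; case: (rho i =P s2) => [e|ne].
  rewrite e; case: (i =P s2) => [->|/eqP ne]; first by rewrite (negbTE ss2) andbF.
  rewrite andbT [RHS]eq_sym (negbTE ne); apply/eqP=> si.
  by move: ss2; rewrite -e -si rs eqxx.
by case: (i =P s2) => [ei|]; rewrite ?andbT // ei rs2 in ne *.
Qed.

Definition row_merge (L : 'I_n -> 'I_n -> nat) i j :=
  if i == s then same_or0 (L s j) (L s2 j) else L i j.
Definition col_merge (L : 'I_n -> 'I_n -> nat) i j :=
  if j == s then same_or0 (L i s) (L i s2) else L i j.

Let fibre v : (rho' v == s) = (rho v == s) || (rho v == s2).
Proof. by rewrite /rho' /merge_rep; case: (rho v =P s2) => _; rewrite ?eqxx ?orbT ?orbF. Qed.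

Let fibre_ne v i : i != s -> (rho' v == i) -> rho v = i.
Proof.
rewrite /rho' /merge_rep; case: (rho v =P s2) => [_|_]; last by move=> _ /eqP.
by move=> /negbTE ne /eqP e; rewrite e eqxx in ne.
Qed.

(** Merging rows and then columns yields a nonzero label only if all old labels between the two new
    parts agree and are nonzero; then that label is shared by all pairs of vertices. Otherwise some
    old pair of parts is already heterogeneous, or two old pairs carry different labels. *)
Lemma hlab_merge i j : rho' i = i -> rho' j = j ->
  hlab rho' i j = col_merge (row_merge (hlab rho)) i j.
Proof.
move=> ri' rj'; have ri : rho i = i by apply/eqP; move/eqP: ri'; rewrite merge_rep_fix => /andP[].
have rj : rho j = j by apply/eqP; move/eqP: rj'; rewrite merge_rep_fix => /andP[].
pose Z := col_merge (row_merge (hlab rho)) i j.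
rewrite -/Z.
have [Z0|nz] := eqVneq Z 0; last first.
  apply: hlab_char => // v w rv rw.
  have row x : row_merge (hlab rho) i (rho x) != 0 ->
      lb v x = row_merge (hlab rho) i (rho x).
    rewrite /row_merge; have [ei|ne] := eqVneq i s; last first.
      by have := fibre_ne ne (introT eqP rv) => <- /hlabP.
    rewrite /same_or0; case: (hlab rho s (rho x) =P _) => // e.
    have := fibre v; rewrite rv ei eqxx => /esym /orP[] /eqP rvs.
      by rewrite -rvs => /hlabP.
    by rewrite e -rvs => /hlabP.
  move: nz; rewrite /Z /col_merge; have [ej|ne] := eqVneq j s; last first.
    by have <- := fibre_ne ne (introT eqP rw); apply: row.
  rewrite /same_or0; case: (row_merge _ i s =P _) => // e.
  have := fibre w; rewrite rw ej eqxx => /esym /orP[] /eqP rws.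
    by rewrite -rws; apply: row.
  by rewrite e -rws; apply: row.
rewrite Z0.
(* First source of the label e: an old heterogeneous pair inside the new one. *)
have sub x y : rho x = x -> rho y = y -> rho' x = i -> rho' y = j ->
    hlab rho x y = 0 -> hlab rho' i j = 0.
  move=> rx ry rx' ry' /eqP; rewrite hlab_eq0.
  case/existsP=> v /existsP[w /and3P[/eqP rv /eqP rw ne]].
  apply: (@hlab_eq0P _ _ _ v w x y) => //.
    by rewrite -rx' /rho' /merge_rep rv rx.
  by rewrite -ry' /rho' /merge_rep rw ry.
(* Second source: two old pairs inside the new one whose labels differ. *)
have dif x y x' y' : rho x = x -> rho y = y -> rho' x = i -> rho' y = j ->
    rho x' = x' -> rho y' = y' -> rho' x' = i -> rho' y' = j ->
    hlab rho x y <> hlab rho x' y' -> hlab rho' i j = 0.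
  move=> h1 h2 h3 h4 h5 h6 h7 h8 ne.
  have [h|h] := eqVneq (hlab rho x y) 0; first exact: (sub x y).
  have [h'|h'] := eqVneq (hlab rho x' y') 0; first exact: (sub x' y').
  apply: (@hlab_eq0P _ _ _ x y x' y') => //; apply/eqP => e; apply: ne.
  have := @hlabP rho x y; have := @hlabP rho x' y'.
  by rewrite h1 h2 h5 h6 => <- // <-.
have fs : rho' s = s by apply/eqP; rewrite fibre rs eqxx.
have fs2 : rho' s2 = s by apply/eqP; rewrite fibre rs2 eqxx orbT.
move: Z0; rewrite /Z /col_merge /row_merge /same_or0.
have [ei|ni] := eqVneq i s; have [ej|nj] := eqVneq j s.
- have [si sj] : rho' s = i /\ rho' s = j by rewrite ei ej.
  have [si2 sj2] : rho' s2 = i /\ rho' s2 = j by rewrite ei ej.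
  case: (hlab rho s s =P hlab rho s2 s) => e1; last by move=> _; apply: (dif s s s2 s).
  case: (hlab rho s s2 =P hlab rho s2 s2) => e2; last by move=> _; apply: (dif s s2 s2 s2).
  case: (hlab rho s s =P hlab rho s s2) => e3; last by move=> _; apply: (dif s s s s2).
  by move=> h; apply: (sub s s).
- have [si si2] : rho' s = i /\ rho' s2 = i by rewrite ei.
  case: (hlab rho s j =P hlab rho s2 j) => e1; last by move=> _; apply: (dif s j s2 j).
  by move=> h; apply: (sub s j).
- have [sj sj2] : rho' s = j /\ rho' s2 = j by rewrite ej.
  case: (hlab rho i s =P hlab rho i s2) => e1; last by move=> _; apply: (dif i s i s2).
  by move=> h; apply: (sub i s).
- by move=> h; apply: (sub i j).
Qed.

Lemma hetero_merge x y : rho x = x -> rho y = y ->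
  hetero rho x y -> hetero rho' (rho' x) (rho' y).
Proof.
move=> rx ry; rewrite -!hlab_eq0 => /eqP h.
move/eqP: (h); rewrite hlab_eq0 => /existsP[v /existsP[w /and3P[/eqP rv /eqP rw ne]]].
apply/eqP; apply: (@hlab_eq0P _ _ _ v w x y) => //.
  by rewrite /rho' /merge_rep rv rx.
by rewrite /rho' /merge_rep rw ry.
Qed.

Lemma merge_rep_idem x : rho x = x -> rho' (rho' x) = rho' x.
Proof.
move=> rx; apply/eqP; rewrite merge_rep_fix /rho' /merge_rep.
case: (rho x =P s2) => [_|/eqP ne]; first by rewrite rs eqxx ss2.
by rewrite rx in ne *; rewrite rx eqxx.
Qed.

Lemma eadj_merge x y : eadj rho x y -> eadj rho' (rho' x) (rho' y).
Proof.
move=> /and3P[/eqP rx /eqP ry h]; rewrite /eadj !merge_rep_idem // !eqxx /=.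
by case/orP: h => h; apply/orP; [left|right]; apply: hetero_merge.
Qed.

(** An e-edge survives a merge, possibly as a loop, so paths are mapped to paths. *)
Lemma connect_merge x y :
  connect (eadj rho) x y -> connect (eadj rho') (rho' x) (rho' y).
Proof.
case/connectP=> p; elim: p x => [|z p IH] x /=; first by move=> _ ->.
move=> /andP[xz pz] yl; apply: connect_trans (IH z pz yl).
by apply: connect1; apply: eadj_merge.
Qed.

End Merge.

Lemma eadj_sym rho : symmetric (eadj rho).
Proof. by move=> x y; rewrite /eadj andbCA orbC. Qed.

End Homogeneous.

(** * Sums over the partial morphisms with a given profile *)

Section CommutingProducts.

Variables (A : pzSemiRingType) (V U : finType) (q : V -> U -> A).
Hypothesis q_comm :
  forall v w a b, v != w -> (q v a * q w b = q w b * q v a)%R.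

Definition wt (D : pred V) (f : V -> U) : A := (\prod_(v | D v) q v (f v))%R.

Lemma eq_wt (D D' : pred V) f f' :
  D =1 D' -> (forall v, D v -> f v = f' v) -> wt D f = wt D' f'.
Proof. by move=> eD ef; apply: eq_big => // v /ef ->. Qed.

(** The semiring need not be commutative and the product runs in the order of [V]: each factor of
    [D2] is moved to the right of the whole [D1] product, past factors at other vertices. *)
Lemma wtU (D D1 D2 : pred V) f :
  (forall v, D v = D1 v || D2 v) -> (forall v, ~~ (D1 v && D2 v)) ->
  wt D f = (wt D1 f * wt D2 f)%R.
Proof.
move=> eD dis; rewrite /wt; elim: (index_enum V) => [|v r IH].
  by rewrite !big_nil mulr1.
rewrite !big_cons eD; have := dis v; case d1: (D1 v) => /=.
  by move=> /negbTE ->; rewrite IH mulrA.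
move=> _; case: (D2 v) => //; rewrite IH !mulrA; congr (_ * _)%R.
apply: commr_prod => w d1w; apply: q_comm; apply/eqP=> vw.
by rewrite -vw d1 in d1w.
Qed.

End CommutingProducts.

Section Profiles.

Variables (A : pzSemiRingType) (U : finType) (n M : nat) (a0 : U).
Variables (lb : 'I_n -> 'I_n -> nat) (cp : nat -> U -> U -> bool).
Variables (q : 'I_n -> U -> A).
Variables (dec : 'I_M.+1 -> {set U}) (enc : {set U} -> 'I_M.+1).
Hypothesis q_comm :
  forall v w a b, v != w -> (q v a * q w b = q w b * q v a)%R.
Hypotheses (decK : cancel dec enc) (encK : cancel enc dec).
Hypothesis dec0 : dec ord0 = set0.

Notation V := 'I_n.
Notation prof := {ffun V -> 'I_M.+1}.
Implicit Types (rho : V -> V) (d : prof) (f : {ffun V -> U}) (i j v w : V).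

Definition im rho f i : {set U} := [set f v | v in [pred v | rho v == i]].

Definition compat l (S T : {set U}) :=
  [forall a in S, forall b in T, cp l a b].

(* Partial functions on the union of the parts [i] with [d i != 0] are
   represented by total ones with value [a0] elsewhere. *)
Definition realizes rho d f :=
  [&& [forall v, (d (rho v) == ord0) ==> (f v == a0)],
      [forall v, forall w, (d (rho v) != ord0) ==> (d (rho w) != ord0) ==>
                           cp (lb v w) (f v) (f w)]
    & [forall i, (d i != ord0) ==> (im rho f i == dec (d i))]].

Definition psum rho d : A :=
  (\sum_(f | realizes rho d f) wt q [pred v | d (rho v) != ord0] f)%R.

Definition consistent rho d :=
  [forall i, forall j, (d i != ord0) ==> (d j != ord0) ==>
     (hlab lb rho i j != 0) ==> compat (hlab lb rho i j) (dec (d i)) (dec (d j))].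

Lemma realizesP rho d f :
  reflect [/\ forall v, d (rho v) = ord0 -> f v = a0,
    forall v w, d (rho v) != ord0 -> d (rho w) != ord0 -> cp (lb v w) (f v) (f w)
    & forall i, d i != ord0 -> im rho f i = dec (d i)]
  (realizes rho d f).
Proof.
apply: (iffP and3P) => [[/forallP h1 /forallP h2 /forallP h3]|[h1 h2 h3]].
  split=> [v dv|v w dv dw|i di].
  - by have := h1 v; rewrite dv eqxx => /eqP.
  - by have /forallP/(_ w) := h2 v; rewrite dv dw.
  - by have := h3 i; rewrite di => /eqP.
split; apply/forallP => v; first by apply/implyP => /eqP /h1 ->.
  by apply/forallP => w; apply/implyP => dv; apply/implyP; apply: h2.
by apply/implyP => /h3 ->.
Qed.

Lemma imP rho f i a : reflect (exists2 v, rho v = i & a = f v) (a \in im rho f i).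
Proof.
apply: (iffP imsetP) => [[v]|[v rv ->]]; first by rewrite inE => /eqP; exists v.
by exists v; rewrite // inE rv.
Qed.

Lemma eq_im rho f f' i : (forall v, rho v = i -> f v = f' v) ->
  im rho f i = im rho f' i.
Proof.
move=> e; apply/setP=> a; apply/imP/imP=> [[v rv ->]|[v rv ->]]; exists v => //.
  exact: e.
by rewrite e.
Qed.

Lemma compatP l (S T : {set U}) :
  reflect (forall a b, a \in S -> b \in T -> cp l a b) (compat l S T).
Proof.
apply: (iffP forallP) => [h a b aS bT|h a].
  by have /implyP/(_ aS) /forallP/(_ b)/implyP := h a; apply.
by apply/implyP=> aS; apply/forallP=> b; apply/implyP => bT; apply: h.
Qed.

Lemma psum0 rho d : (forall i, d i = ord0) -> psum rho d = 1%R.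
Proof.
move=> d0; rewrite /psum (big_pred1 [ffun=> a0]).
  by rewrite /wt big_pred0 // => v; rewrite /= d0.
move=> f; apply/realizesP/eqP => [[h _ _]|->].
  by apply/ffunP=> v; rewrite ffunE h.
by split=> [v|v w|i]; rewrite ?d0 ?ffunE.
Qed.

(** Two values that witness the incompatibility would be images of vertices [v] and [w] of the two
    parts, and the label of [(v, w)] is the homogeneous one; so no function realizes the profile. *)
Lemma psum_inconsistent rho d i j : d i != ord0 -> d j != ord0 ->
  hlab lb rho i j != 0 -> ~~ compat (hlab lb rho i j) (dec (d i)) (dec (d j)) ->
  psum rho d = 0%R.
Proof.
move=> di dj lij bad; rewrite /psum big_pred0 // => f.
apply: contraNF bad => /realizesP[_ h2 h3]; apply/compatP => a b.
rewrite -!h3 // => /imP[v rv ->] /imP[w rw ->].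
have lvw := @hlabP _ lb rho v w; rewrite rv rw in lvw.
by rewrite -lvw //; apply: h2; rewrite ?rv ?rw.
Qed.

(** Across the two supports all labels are homogeneous, so the constraints on cross pairs depend on
    the prescribed images only, and consistency grants them. The realizations of [d] are therefore
    all pairs of realizations of [d1] and [d2]. *)
Lemma psum_join rho d d1 d2 :
  (forall i, d i = if d1 i == ord0 then d2 i else d1 i) ->
  (forall i, d1 i = ord0 \/ d2 i = ord0) ->
  (forall i j, d1 i != ord0 -> d2 j != ord0 ->
     (hlab lb rho i j != 0) && (hlab lb rho j i != 0)) ->
  consistent rho d ->
  psum rho d = (psum rho d1 * psum rho d2)%R.
Proof.
move=> dE dis cross cons.
have dN i : (d i != ord0) = (d1 i != ord0) || (d2 i != ord0).
  by rewrite dE; case: (eqVneq (d1 i) ord0).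
have dN1 i : d1 i != ord0 -> d2 i = ord0 by case: (dis i) => // ->; rewrite eqxx.
have dN2 i : d2 i != ord0 -> d1 i = ord0 by case: (dis i) => // ->; rewrite eqxx.
(* [h] splits a realization into its two restrictions, padded with [a0], and [h'] glues them
   again. *)
pose res (e : prof) f := [ffun v => if e (rho v) == ord0 then a0 else f v].
pose h f := (res d1 f, res d2 f).
pose h' (p : {ffun V -> U} * {ffun V -> U}) :=
  [ffun v => if d1 (rho v) != ord0 then p.1 v else p.2 v].
rewrite /psum big_distrlr /= pair_big /=.
rewrite (reindex_onto h h') /=; last first.
  move=> [f1 f2] /= /andP[/realizesP[k1 _ _] /realizesP[k2 _ _]].
  congr (_, _); apply/ffunP=> v; rewrite !ffunE.
    by case: (eqVneq (d1 (rho v)) ord0) => [/k1->|].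
  case: (eqVneq (d2 (rho v)) ord0) => [/k2->//|/dN2 ->].
  by rewrite eqxx.
have okl l i j : d i != ord0 -> d j != ord0 -> hlab lb rho i j = l -> l != 0 ->
    compat l (dec (d i)) (dec (d j)).
  by move=> di dj <- lij; move/forallP/(_ i)/forallP/(_ j): cons; rewrite di dj lij.
apply: eq_big => f.
  apply/realizesP/andP => [[k1 k2 k3]|[/andP[/realizesP[l1 l2 l3] /realizesP[m1 m2 m3]]] hh].
    split; last first.
      apply/eqP/ffunP=> v; rewrite !ffunE.
      have [e1|n1] := eqVneq (d1 (rho v)) ord0; rewrite ?(negbTE n1) //=.
      by case: ifP => // /eqP e2; rewrite k1 // dE e1 eqxx.
    apply/andP; split; apply/realizesP; split=> [v dv|v w dv dw|i di].
    - by rewrite ffunE dv eqxx.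
    - by rewrite !ffunE (negbTE dv) (negbTE dw); apply: k2; rewrite dN ?dv ?dw.
    - rewrite -(_ : d i = d1 i); last by rewrite dE (negbTE di).
      rewrite -k3 ?dN ?di //; apply: eq_im => v rv.
      by rewrite ffunE rv (negbTE di).
    - by rewrite ffunE dv eqxx.
    - by rewrite !ffunE (negbTE dv) (negbTE dw); apply: k2; rewrite dN ?dv ?dw orbT.
    - rewrite -(_ : d i = d2 i); last by rewrite dE dN2 ?eqxx.
      rewrite -k3 ?dN ?di ?orbT //; apply: eq_im => v rv.
      by rewrite ffunE rv (negbTE di).
  have fE v : f v = if d1 (rho v) != ord0 then f v else
                    if d2 (rho v) == ord0 then a0 else f v.
    by move/eqP/ffunP/(_ v): hh; rewrite !ffunE => {1}<-; case: eqVneq.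
  have im3 i : d i != ord0 -> im rho f i = dec (d i).
    move=> di; move: (di); rewrite dN dE; case: (eqVneq (d1 i) ord0) => [e1|n1] /=.
      move=> n2; rewrite -m3 //; apply: eq_im => v rv.
      by rewrite ffunE rv (negbTE n2).
    move=> _; rewrite -l3 //; apply: eq_im => v rv.
    by rewrite ffunE rv (negbTE n1).
  have mem v : d (rho v) != ord0 -> f v \in dec (d (rho v)).
    by move=> dv; rewrite -im3 //; apply/imP; exists v.
  split=> // [v|v w].
    rewrite dE fE; case: (eqVneq (d1 (rho v)) ord0) => /= [_ ->|n1 e1].
      by rewrite eqxx.
    by rewrite e1 eqxx in n1.
  move=> dv dw; have lvw := @hlabP _ lb rho v w.
  have [e1|n1] := eqVneq (d1 (rho v)) ord0; have [e1'|n1'] := eqVneq (d1 (rho w)) ord0.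
  - have n2 : d2 (rho v) != ord0 by rewrite dN e1 eqxx in dv.
    have n2' : d2 (rho w) != ord0 by rewrite dN e1' eqxx in dw.
    by have := m2 _ _ n2 n2'; rewrite !ffunE (negbTE n2) (negbTE n2').
  - have n2 : d2 (rho v) != ord0 by rewrite dN e1 eqxx in dv.
    have /andP[_ nz] := cross _ _ n1' n2; rewrite lvw //.
    by have /compatP := okl _ _ _ dv dw erefl nz; apply; apply: mem.
  - have n2' : d2 (rho w) != ord0 by rewrite dN e1' eqxx in dw.
    have /andP[nz _] := cross _ _ n1 n2'; rewrite lvw //.
    by have /compatP := okl _ _ _ dv dw erefl nz; apply; apply: mem.
  - by have := l2 _ _ n1 n1'; rewrite !ffunE (negbTE n1) (negbTE n1').
move=> _; rewrite (wtU q_comm (D1 := [pred v | d1 (rho v) != ord0])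
                             (D2 := [pred v | d2 (rho v) != ord0])) /=.
- congr (_ * _)%R; apply: eq_wt => // v /= nv; by rewrite ffunE (negbTE nv).
- by move=> v; rewrite dN.
- by move=> v; apply/negP => /andP[/dN1 ->]; rewrite eqxx.
Qed.

Section Merge.

Variables (rho : V -> V) (s s2 : V).
Hypotheses (rs : rho s = s) (rs2 : rho s2 = s2) (ss2 : s != s2).

Let rho' := merge_rep rho s s2.

Definition merge_prof (d : prof) : prof :=
  [ffun i => if i == s then enc (dec (d s) :|: dec (d s2))
             else if i == s2 then ord0 else d i].

Lemma im_merge f : im rho' f s = im rho f s :|: im rho f s2.
Proof.
apply/setP=> a; rewrite inE; apply/imP/orP.
  move=> [v]; rewrite /rho' /merge_rep; case: (rho v =P s2) => [e _|_ e] ->.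
    by right; apply/imP; exists v.
  by left; apply/imP; exists v.
case=> /imP[v rv ->]; exists v => //; rewrite /rho' /merge_rep rv.
  by rewrite (negbTE ss2).
by rewrite eqxx.
Qed.

Lemma im_merge_other f i : i != s -> i != s2 -> im rho' f i = im rho f i.
Proof.
move=> /negbTE is1 /negbTE is2; apply/setP=> a.
apply/imP/imP => [[v rv ->]|[v rv ->]]; exists v => //; move: rv; rewrite /rho' /merge_rep.
  by case: ifP => // _ e; rewrite -e eqxx in is1.
by move=> e; rewrite e is2.
Qed.

Lemma dec_eq0 (t : 'I_M.+1) : (dec t == set0) = (t == ord0).
Proof. by rewrite -dec0 (can_eq decK). Qed.

Lemma enc_eq0 (T : {set U}) : (enc T == ord0) = (T == set0).
Proof. by rewrite -dec_eq0 encK. Qed.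

(** The realizations of [d'] are classified by their images on the two old parts, which are only
    known to have the prescribed union. *)
Lemma psum_merge d' : d' s != ord0 -> d' s2 = ord0 ->
  psum rho' d' =
  (\sum_(d | [&& merge_prof d == d', d s != ord0 & d s2 != ord0]) psum rho d)%R.
Proof.
move=> d's d's2.
(* The profile of [f] before the merge. Its entries at [s] and [s2] are nonzero because each part
   contains its representative. *)
pose p f : prof := [ffun i => if i == s then enc (im rho f s) else
                      if i == s2 then enc (im rho f s2) else d' i].
have ine i f : rho i = i -> im rho f i != set0.
  by move=> ri; apply/set0Pn; exists (f i); apply/imP; exists i.
rewrite /psum (partition_big p (fun d => [&& merge_prof d == d', d s != ord0 & d s2 != ord0])) /=; last first.
  move=> f /realizesP[k1 k2 k3]; rewrite !ffunE eqxx [s2 == s]eq_sym (negbTE ss2) eqxx.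
  rewrite !enc_eq0 !ine // !andbT; apply/eqP/ffunP=> i; rewrite !ffunE eqxx.
  rewrite [s2 == s]eq_sym (negbTE ss2) eqxx !encK -im_merge k3 // decK.
  by case: eqP => [->//|_]; case: eqP => [->//|_].
apply: eq_bigr => d /and3P[/eqP dd ds ds2].
have dio i : i != s -> i != s2 -> d i = d' i.
  by move=> /negbTE h1 /negbTE h2; rewrite -dd ffunE h1 h2.
have dec's : dec (d' s) = dec (d s) :|: dec (d s2).
  by rewrite -dd ffunE eqxx encK.
have dN v : (d' (rho' v) != ord0) = (d (rho v) != ord0).
  rewrite /rho' /merge_rep; case: (rho v =P s2) => [->|/eqP n2]; first by rewrite d's ds2.
  have [->|n1] := eqVneq (rho v) s; first by rewrite d's ds.
  by rewrite -dio.
have dN0 v : (d' (rho' v) == ord0) = (d (rho v) == ord0) by rewrite -[RHS]negbK -dN negbK.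
apply: eq_big => f; last by move=> _; apply: eq_wt => // v /=; rewrite dN.
apply/andP/realizesP => [[/realizesP[k1 k2 k3] /eqP pf]|[k1 k2 k3]].
  split=> [v /eqP|v w|i di].
  - by rewrite -dN0 => /eqP; apply: k1.
  - by rewrite -!dN; apply: k2.
  have [->|n1] := eqVneq i s; first by rewrite -pf ffunE eqxx encK.
  have [->|n2] := eqVneq i s2; first by rewrite -pf ffunE [s2 == s]eq_sym (negbTE ss2) eqxx encK.
  by rewrite dio // -k3 ?im_merge_other // -dio.
split; last first.
  apply/eqP/ffunP=> i; rewrite ffunE.
  have [->|n1] := eqVneq i s; first by rewrite k3 // decK.
  have [->|n2] := eqVneq i s2; first by rewrite k3 // decK.
  by rewrite dio.
apply/realizesP; split=> [v /eqP|v w|i di].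
- by rewrite dN0 => /eqP; apply: k1.
- by rewrite !dN; apply: k2.
have [->|n1] := eqVneq i s; first by rewrite im_merge !k3 // dec's.
have [e|n2] := eqVneq i s2; first by rewrite e d's2 eqxx in di.
by rewrite im_merge_other // -dio // k3 // dio.
Qed.

End Merge.

End Profiles.

(** * Enumeration and numbering of profiles *)

Section Odometer.

Variables (M : nat) (mb : pred nat).
Hypothesis M_gt0 : 0 < M.

Definition cnt i := count mb (iota 0 i).

(* The [r]-th assignment of digits [1..M] to the positions in [mb], the lowest
   position being the least significant one. *)
Definition dig r i := if mb i then (r %/ M ^ cnt i %% M).+1 else 0.

Lemma cntS i : cnt i.+1 = cnt i + mb i.
Proof. by rewrite /cnt -{1}[i.+1]addn1 iotaD count_cat /= addn0. Qed.

Lemma dig0 i : dig 0 i = mb i.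
Proof. by rewrite /dig div0n mod0n; case: ifP. Qed.

Lemma dig_eq0 r i : (dig r i == 0) = ~~ mb i.
Proof. by rewrite /dig; case: ifP. Qed.

Lemma dig_le r i : dig r i <= M.
Proof. by rewrite /dig; case: ifP => // _; rewrite ltn_mod. Qed.

Lemma expM_gt0 i : 0 < M ^ i. Proof. by rewrite expn_gt0 M_gt0. Qed.

(** The digit at [i] moves exactly when all lower digits overflow, that is when [M ^ cnt i] divides
    [r.+1]; divisibility thus plays the role of the carry. *)
Lemma dig_next r i : dig r.+1 i =
  if (M ^ cnt i %| r.+1) && mb i then
    if dig r i < M then (dig r i).+1 else 1
  else dig r i.
Proof.
rewrite /dig; case: ifP => // mi; last by rewrite andbF.
rewrite andbT; set c := M ^ cnt i; have c0 : 0 < c by apply: expM_gt0.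
have := divn_eq r c; have := ltn_pmod r c0; set x := r %/ c; set y := r %% c.
move=> yc rE; have rS : r.+1 = x * c + y.+1 by rewrite {1}rE addnS.
case: ifP => [|/negbT] cr.
  have y1 : y.+1 = c.
    move: cr; rewrite rS dvdn_addr ?dvdn_mull // => /dvdn_leq -/(_ isT).
    by move=> le; apply/eqP; rewrite eqn_leq yc.
  have -> : r.+1 %/ c = x.+1 by rewrite rS y1 -mulSnr mulnK.
  have := ltn_pmod x M_gt0; have xE := divn_eq x M.
  have -> : x.+1 %% M = (x %% M).+1 %% M by rewrite {1}xE -addnS modnMDl.
  set u := x %% M => uM.
  by case: ltnP => h; [rewrite modn_small | rewrite (_ : u.+1 = M) ?modnn //; lia].
have y1 : y.+1 < c.
  rewrite ltn_neqAle yc andbT; apply: contra cr => /eqP e.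
  by rewrite rS e dvdn_addr ?dvdn_mull.
by rewrite rS divnMDl // divn_small // addn0.
Qed.

(** A position outside [mb] passes the carry on; one inside passes it only from its maximal digit
    [M]. *)
Lemma carry_next r i : (M ^ cnt i.+1 %| r.+1) =
  (M ^ cnt i %| r.+1) && (mb i ==> (dig r i == M)).
Proof.
rewrite cntS /dig; case: ifP => mi /=; last by rewrite addn0 andbT.
rewrite addn1 expnS; set c := M ^ cnt i; have c0 : 0 < c by apply: expM_gt0.
apply/idP/andP => [h|[/dvdnP[y ry]]].
  have cr : c %| r.+1 by apply: dvdn_trans h; apply: dvdn_mull.
  split=> //; case/dvdnP: h => y; rewrite mulnA => ry.
  have yM0 : 0 < y * M by case: (y * M) ry.
  have -> : r %/ c = (y * M).-1.
    have -> : r = (y * M).-1 * c + c.-1.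
      by case: (y * M) ry yM0 => // z; rewrite mulSn /=; lia.
    by rewrite divnMDl // divn_small ?addn0 // prednK.
  case: y yM0 {ry} => // y _.
  have -> : (y.+1 * M).-1 = y * M + M.-1 by rewrite mulSn; lia.
  by rewrite modnMDl modn_small ?prednK.
have y0 : 0 < y by case: y ry.
have -> : r %/ c = y.-1.
  have -> : r = y.-1 * c + c.-1 by case: y ry y0 => // z; rewrite mulSn /=; lia.
  by rewrite divnMDl // divn_small ?addn0 // prednK.
move/eqP=> h; rewrite ry dvdn_mul //; apply/dvdnP; exists (y.-1 %/ M).+1.
by have := divn_eq y.-1 M; lia.
Qed.

(** By induction on [k], the first [k] digits determine the residue modulo [M ^ cnt k]. *)
Lemma dig_inj n r r' : r < M ^ cnt n -> r' < M ^ cnt n ->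
  (forall i, i < n -> dig r i = dig r' i) -> r = r'.
Proof.
move=> rn rn' e; rewrite -(modn_small rn) -(modn_small rn').
have: n <= n by []; elim: {1 3 4}n => [|k IH] kn.
  by rewrite /cnt /= expn0 !modn1.
have := IH (ltnW kn); have := e k kn; rewrite /dig cntS.
case: ifP => _ /=; last by rewrite addn0.
move=> [] e1 e2; rewrite addn1 expnSr.
set c := M ^ cnt k in e1 e2 *.
have modE x : x %% (c * M) = x %/ c %% M * c + x %% c.
  have h : x = x %/ c %/ M * (c * M) + (x %/ c %% M * c + x %% c).
    rewrite {1}(divn_eq x c) {1}(divn_eq (x %/ c) M) mulnDl -addnA.
    by congr (_ + _); rewrite -mulnA [M * c]mulnC.
  rewrite {1}h modnMDl modn_small //.
  have c0 : 0 < c by apply: expM_gt0.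
  apply: leq_trans (_ : (x %/ c %% M).+1 * c <= _).
    by rewrite mulSnr ltn_add2l ltn_pmod.
  by rewrite mulnC leq_mul2l ltn_pmod ?orbT.
by rewrite !modE e1 e2.
Qed.

Lemma big_dig (A : nmodType) n (F : {ffun 'I_n -> 'I_M.+1} -> A) :
  (\sum_(r < M ^ cnt n) F [ffun i : 'I_n => inord (dig r i)] =
   \sum_(d : {ffun 'I_n -> 'I_M.+1} | [forall i, (d i != ord0) == mb i]) F d)%R.
Proof.
pose h (r : 'I_(M ^ cnt n)) : {ffun 'I_n -> 'I_M.+1} := [ffun i : 'I_n => inord (dig r i)].
have hE r i : h r i = dig r i :> nat by rewrite ffunE inordK // ltnS dig_le.
have hinj : injective h.
  move=> r r' e; apply: val_inj; apply: (@dig_inj n); rewrite ?ltn_ord // => i ik.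
  by have := hE r (Ordinal ik); rewrite e hE /=.
pose D := [set d : {ffun 'I_n -> 'I_M.+1} | [forall i, (d i != ord0) == mb i]].
have hD : h @: setT = D.
  (* As [h] is injective, it suffices to count: a position in [mb] has [M] nonzero digits, any other
     has the digit 0 only. *)
  apply/eqP; rewrite eqEcard; apply/andP; split.
    apply/subsetP => _ /imsetP[r _ ->]; rewrite inE; apply/forallP => i.
    by rewrite -val_eqE /= hE dig_eq0 negbK.
  rewrite card_imset // cardsT card_ord.
  pose Fm (i : 'I_n) := [pred t : 'I_M.+1 | (t != ord0) == mb i].
  have -> : #|D| = #|(family Fm : pred _)|.
    by apply: eq_card => d; rewrite inE.
  rewrite card_family /image_mem -[enum _]/(enum 'I_n).
  have -> : M ^ cnt n = \prod_(i < n) M ^ mb i.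
    elim: (n) => [|m IH]; first by rewrite big_ord0.
    by rewrite big_ord_recr /= -IH -expnD cntS.
  rewrite foldrE big_map big_enum /=; apply: leq_prod => i _.
  have -> : #|Fm i| = #|if mb i then [set~ (@ord0 M)] else [set (@ord0 M)]|.
    by apply: eq_card => t; rewrite inE; case: (mb i); rewrite !inE ?eqb_id ?eqbF_neg ?negbK.
  by case: (mb i); rewrite ?cardsC1 ?card_ord ?cards1 ?expn1.
rewrite -[RHS](_ : (\sum_(d in D) F d)%R = _); last by apply: eq_bigl => d; rewrite inE.
rewrite -hD big_imset /=; last by move=> ? ? _ _; apply: hinj.
by apply: eq_bigl => r; rewrite inE.
Qed.

End Odometer.

(** * Positional codes of profiles *)

Section Codes.

Variable (N : nat).

Definition pcode n (d : 'I_n -> nat) := \sum_(i < n) d i * N ^ i.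

Lemma pcode_recl n (d : 'I_n.+1 -> nat) :
  pcode d = d ord0 + N * pcode (fun i => d (lift ord0 i)).
Proof.
rewrite /pcode big_ord_recl expn0 muln1 big_distrr; congr (_ + _).
by apply: eq_bigr => i _; rewrite expnS mulnCA.
Qed.

Lemma pcode_lt n (d : 'I_n -> nat) :
  (forall i, d i < N) -> pcode d < N ^ n.
Proof.
elim: n d => [|n IH] d dN; first by rewrite /pcode big_ord0.
rewrite pcode_recl expnS; have := IH (fun i => d (lift ord0 i)) (fun i => dN _).
move=> /(leq_mul (leqnn N)); apply: leq_trans.
by rewrite mulnS -addSn leq_add2r.
Qed.

Lemma pcode_inj n (d d' : 'I_n -> nat) :
  (forall i, d i < N) -> (forall i, d' i < N) -> pcode d = pcode d' -> d =1 d'.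
Proof.
elim: n d d' => [|n IH] d d' dN dN' e i; first by case: i.
move: e; rewrite !pcode_recl => e.
have N0 : 0 < N by apply: leq_ltn_trans (dN ord0).
have := congr1 (modn^~ N) e; rewrite !(addnC (_ ord0)) !(mulnC N) !modnMDl !modn_small //.
have := congr1 (divn^~ N) e.
rewrite !(addnC (_ ord0)) !(mulnC N) !divnMDl // !divn_small // !addn0.
move=> /IH e1 e0; case: (unliftP ord0 i) => [j|] -> //.
by apply: (e1 (fun i => dN _) (fun i => dN' _)).
Qed.

End Codes.

(** * Merging two parts *)

Section Components.

Variables (n : nat) (lb : 'I_n -> 'I_n -> nat).
Hypothesis lb_gt0 : forall v w, 0 < lb v w.
Implicit Types (i j c : 'I_n).

Notation hl := (hlab lb).

(* [co] sends the representative of a part to a representative that identifies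
   its e-connected component. *)
Record comp_ok (rho co : 'I_n -> 'I_n) : Prop := CompOk {
  co_fix : forall i, rho i = i -> rho (co i) = co i /\ co (co i) = co i;
  co_adj : forall i j, rho i = i -> rho j = j -> hl rho i j = 0 -> co i = co j;
  co_conn : forall i j, rho i = i -> rho j = j -> co i = co j ->
    connect (eadj lb rho) i j
}.

Lemma comp_ok_id : comp_ok id id.
Proof.
split=> // [i j _ _|i j _ _ ->]; last exact: connect0.
move/eqP; rewrite hlab_eq0 // => /existsP[v /existsP[w /and3P[/eqP-> /eqP->]]].
by rewrite eqxx.
Qed.

Section Stage.

Variables (rho co : 'I_n -> 'I_n) (s s2 : 'I_n).
Hypotheses (rs : rho s = s) (rs2 : rho s2 = s2) (ss2 : s != s2).
Hypothesis cok : comp_ok rho co.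

Let rho' := merge_rep rho s s2.

(** The parts equal or e-adjacent to the merged part after the step. When the labels towards [s] and
    [s2] agree, testing the one of [s] for e is enough. *)
Definition joins i :=
  [|| i == s, i == s2, hl rho s i != hl rho s2 i, hl rho s i == 0,
      hl rho i s != hl rho i s2 | hl rho i s == 0].

Definition marked c := [exists i, [&& rho i == i, co i == c & joins i]].

Definition merging i := (rho i == i) && marked (co i).

(** [s] is a safe name for the joined component: if [s] already names a component, that component
    contains [s] and so is marked. *)
Definition merge_co i := if marked (co i) then s else co i.

Lemma markedI i : rho i = i -> joins i -> marked (co i).
Proof. by move=> ri ji; apply/existsP; exists i; rewrite ri !eqxx. Qed.

Lemma marked_s : marked (co s).
Proof. by apply: markedI; rewrite // /joins eqxx. Qed.

Lemma marked_s2 : marked (co s2).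
Proof. by apply: markedI; rewrite // /joins eqxx orbT. Qed.

Lemma merge_co_s : merge_co s = s. Proof. by rewrite /merge_co marked_s. Qed.

Lemma merge_rep_alive i : rho' i = i -> rho i = i /\ i != s2.
Proof. by move/eqP; rewrite merge_rep_fix // => /andP[/eqP]. Qed.

Lemma merge_rep_s : rho' s = s.
Proof. by rewrite /rho' /merge_rep rs (negbTE ss2). Qed.

Lemma hlab_other i j : rho' i = i -> rho' j = j -> i != s -> j != s ->
  hl rho' i j = hl rho i j.
Proof.
move=> ri rj /negbTE is1 /negbTE js1; rewrite hlab_merge //.
by rewrite /col_merge /row_merge is1 js1.
Qed.

Lemma merge_co_unmarked i : merge_co i != s -> ~~ marked (co i).
Proof. by rewrite /merge_co; case: ifP; rewrite ?eqxx. Qed.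

Lemma merge_co_eq_s i : rho i = i -> (merge_co i == s) = marked (co i).
Proof.
rewrite /merge_co; case: ifP => [|nm ri]; first by rewrite eqxx.
apply/eqP => ei; move: nm; rewrite ei.
have [_ cc] := co_fix cok ri; rewrite ei in cc.
by have := marked_s; rewrite cc => ->.
Qed.

Lemma joins_connect i : rho i = i -> joins i -> connect (eadj lb rho') s (rho' i).
Proof.
move=> ri ji; have [->|n2] := eqVneq i s2.
  by rewrite /rho' /merge_rep rs2 eqxx.
have ri' : rho' i = i by rewrite /rho' /merge_rep ri (negbTE n2).
rewrite ri'; have [->|n1] := eqVneq i s; first exact: connect0.
apply: connect1; rewrite /eadj merge_rep_s ri' !eqxx /= -!hlab_eq0 //.
have rs' := merge_rep_s.
rewrite !hlab_merge // /col_merge /row_merge /same_or0 eqxx (negbTE n1).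
move: ji; rewrite /joins (negbTE n1) (negbTE n2) /=.
by case: (hl rho s i =P _) => //= _; case: (hl rho i s =P _) => //= _; rewrite ?orbT.
Qed.

Lemma merging_connect i : rho' i = i -> merging i -> connect (eadj lb rho') s i.
Proof.
move=> ri' /andP[/eqP ri /existsP[k /and3P[/eqP rk /eqP ck jk]]].
apply: connect_trans (joins_connect rk jk) _; rewrite -[X in connect _ _ X]ri'.
by apply: connect_merge => //; apply: (co_conn cok).
Qed.

(** [co_adj] serves correctness (distinct components see only homogeneous labels) and [co_conn]
    serves the time bound (a class of [co] is no larger than an e-connected component). For the
    latter, each marked old component contains a part that becomes e-adjacent to [s] or is merged
    into it. *)
Lemma comp_ok_merge : comp_ok rho' merge_co.
Proof.
have symc : connect_sym (eadj lb rho') by apply: sym_connect_sym; apply: eadj_sym.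
split=> [i /merge_rep_alive[ri n2]|i j ri' rj' h|i j ri' rj'].
- have [r1 c1] := co_fix cok ri; rewrite {1 2 4 5}/merge_co.
  case: ifP => [_|nm]; first by rewrite merge_co_s merge_rep_s.
  split; last by rewrite /merge_co c1 nm.
  apply/eqP; rewrite merge_rep_fix // r1 eqxx /=; apply/eqP=> e.
  by have := marked_s2; rewrite -e c1 nm.
- have [ri ni] := merge_rep_alive ri'; have [rj nj] := merge_rep_alive rj'.
  have [ei|n1] := eqVneq i s; have [ej|n1'] := eqVneq j s.
  + by rewrite ei ej.
  + rewrite ei merge_co_s; apply/esym/eqP; rewrite merge_co_eq_s //; apply: markedI => //.
    move: h; rewrite hlab_merge // /col_merge /row_merge ei eqxx (negbTE n1').
    rewrite /same_or0 /joins; case: (hl rho s j =P _) => [_ ->|_ _]; by rewrite ?eqxx ?orbT.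
  + rewrite ej merge_co_s; apply/eqP; rewrite merge_co_eq_s //; apply: markedI => //.
    move: h; rewrite hlab_merge // /col_merge /row_merge ej eqxx (negbTE n1).
    rewrite /same_or0 /joins; case: (hl rho i s =P _) => [_ ->|_ _]; by rewrite ?eqxx ?orbT.
  rewrite /merge_co (co_adj cok (i := i) (j := j)) //.
  by rewrite -hlab_other.
have [ri ni] := merge_rep_alive ri'; have [rj nj] := merge_rep_alive rj'.
have [mi|mi] := boolP (marked (co i)).
  move=> e; have mj : marked (co j) by rewrite -merge_co_eq_s // -e /merge_co mi.
  have ci : connect (eadj lb rho') s i.
    by apply: merging_connect; rewrite // /merging ri eqxx.
  apply: (@connect_trans _ _ s); first by rewrite symc.
  by apply: merging_connect; rewrite // /merging rj eqxx.
rewrite /merge_co (negbTE mi); case: ifP => [mj e|mj e].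
  have := merge_co_eq_s ri; rewrite /merge_co (negbTE mi) => h.
  by rewrite e eqxx in h.
by rewrite -ri' -rj'; apply: connect_merge => //; apply: (co_conn cok).
Qed.

(** The extra unit is [s2], the only part of the joined components that is not a part of the next
    contraction. *)
Lemma card_merging :
  #|[set i | merging i]| <= #|[set j | connect (eadj lb rho') s j]|.+1.
Proof.
rewrite (cardsD1 s2) -add1n; apply: leq_add; first exact: leq_b1.
apply: subset_leq_card; apply/subsetP=> i; rewrite !inE => /andP[n2 mi].
apply: merging_connect => //; apply/eqP.
by rewrite merge_rep_fix // n2 andbT; case/andP: mi.
Qed.

End Stage.

End Components.

(** * The sums of partial morphisms across one merge *)

Section StageSums.

Variables (A : pzSemiRingType) (U : finType) (n M : nat) (a0 : U).
Variables (lb : 'I_n -> 'I_n -> nat) (cp : nat -> U -> U -> bool).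
Variables (q : 'I_n -> U -> A).
Variables (dec : 'I_M.+1 -> {set U}) (enc : {set U} -> 'I_M.+1).
Hypothesis q_comm :
  forall v w a b, v != w -> (q v a * q w b = q w b * q v a)%R.
Hypotheses (decK : cancel dec enc) (encK : cancel enc dec).
Hypothesis dec0 : dec ord0 = set0.
Hypothesis lb_gt0 : forall v w, 0 < lb v w.

Notation V := 'I_n.
Notation prof := {ffun V -> 'I_M.+1}.
Notation hl := (hlab lb).
Notation psum := (psum a0 lb cp q dec).
Notation consistent := (consistent lb cp dec).
Notation compat := (compat cp).
Notation realizes := (realizes a0 lb cp dec).
Notation merge_prof := (merge_prof dec enc).

Variables (rho co : V -> V) (s s2 : V).
Hypotheses (rs : rho s = s) (rs2 : rho s2 = s2) (ss2 : s != s2).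
Hypothesis cok : comp_ok lb rho co.

Let rho' := merge_rep rho s s2.
Let mb := merging lb rho co s s2.

Definition fits l (t t' : 'I_M.+1) := (l == 0) || compat l (dec t) (dec t').

Lemma consistentP r (d : prof) :
  reflect (forall i j, d i != ord0 -> d j != ord0 -> fits (hl r i j) (d i) (d j))
          (consistent r d).
Proof.
apply: (iffP forallP) => [h i j di dj|h i].
  have /forallP/(_ j) := h i; rewrite di dj /= /fits.
  by case: eqP => //= _.
apply/forallP=> j; apply/implyP => di; apply/implyP => dj; apply/implyP => nz.
by have := h i j di dj; rewrite /fits (negbTE nz).
Qed.

Definition admissible (d : prof) := [forall i, mb i ==>
  [&& fits (hl rho s i) (d s) (d i), fits (hl rho s2 i) (d s2) (d i),
      fits (hl rho i s) (d i) (d s) & fits (hl rho i s2) (d i) (d s2)]].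

(** The restriction to the components with name below [k]: the product over the components is built
    up along these prefixes. *)
Definition cut (k : nat) (d : prof) : prof :=
  [ffun i => if (co i < k)%N then d i else ord0].
Definition part (c : V) (d : prof) : prof :=
  [ffun i => if co i == c then d i else ord0].

Section Leaf.

Variable d : prof.
Hypothesis dsupp : forall i, (d i != ord0) = mb i.

Let alive_d i : d i != ord0 -> rho i = i.
Proof. by rewrite dsupp => /andP[/eqP]. Qed.

Lemma prof_s_neq0 : d s != ord0.
Proof. by rewrite dsupp /mb /merging rs eqxx marked_s. Qed.

Lemma prof_s2_neq0 : d s2 != ord0.
Proof. by rewrite dsupp /mb /merging rs2 eqxx marked_s2. Qed.

Lemma not_admissible : ~~ admissible d -> psum rho d = 0%R.
Proof.
have gen i j : d i != ord0 -> d j != ord0 -> ~~ fits (hl rho i j) (d i) (d j) ->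
    psum rho d = 0%R.
  by move=> di dj; rewrite /fits negb_or => /andP[nz]; apply: psum_inconsistent.
rewrite negb_forall => /existsP[i]; rewrite negb_imply -dsupp => /andP[di].
by rewrite !negb_and => /or4P[]; apply: gen; rewrite ?prof_s_neq0 ?prof_s2_neq0.
Qed.

(** Pairs that avoid [s] and [s2] keep their labels and are covered by the consistency of the merged
    profile; the test covers the others. Hence no full consistency test is performed on [d]. *)
Lemma admissible_consistent :
  admissible d -> consistent rho' (merge_prof s s2 d) -> consistent rho d.
Proof.
move=> /forallP adm /consistentP c'; apply/consistentP => i j di dj.
have [ai aj] := (alive_d di, alive_d dj).
have := adm i; rewrite -dsupp di => /and4P[h1 h2 h3 h4].
have := adm j; rewrite -dsupp dj => /and4P[k1 k2 k3 k4].
have [->//|ni] := eqVneq i s; have [->//|nj] := eqVneq j s.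
have [->//|ni2] := eqVneq i s2; have [->//|nj2] := eqVneq j s2.
have := c' i j; rewrite !ffunE (negbTE ni) (negbTE nj) (negbTE ni2) (negbTE nj2).
move/(_ di dj); rewrite hlab_other // /rho' /merge_rep.
  by rewrite ai (negbTE ni2).
by rewrite aj (negbTE nj2).
Qed.

Lemma consistent_sub (d' : prof) : (forall i, d' i != ord0 -> d' i = d i) ->
  consistent rho d -> consistent rho d'.
Proof.
move=> e /consistentP c; apply/consistentP => i j di dj.
have [ei ej] := (e i di, e j dj).
by rewrite ei ej; apply: c; [rewrite -ei | rewrite -ej].
Qed.

Lemma consistent_part c : consistent rho d -> consistent rho (part c d).
Proof. by apply: consistent_sub => i; rewrite ffunE; case: ifP; rewrite ?eqxx. Qed.

Lemma psum_cut0 : psum rho (cut 0 d) = 1%R.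
Proof. by apply: psum0 => i; rewrite ffunE. Qed.

Lemma cutn : cut n d = d.
Proof. by apply/ffunP=> i; rewrite ffunE ltn_ord. Qed.

Lemma cutS_unmarked (k : V) : ~~ marked lb rho co s s2 k -> cut k.+1 d = cut k d.
Proof.
move=> nm; apply/ffunP=> i; rewrite !ffunE ltnS leq_eqVlt.
have [e|//] := eqVneq (co i : nat) k.
have -> : d i = ord0; last by rewrite !if_same.
apply/eqP; apply: contraNT nm; rewrite dsupp => /andP[_].
by rewrite (val_inj e).
Qed.

(** Parts of different components have homogeneous labels in both directions, by [co_adj], so
    [psum_join] applies. *)
Lemma psum_cutS (k : V) : consistent rho d ->
  psum rho (cut k.+1 d) = (psum rho (cut k d) * psum rho (part k d))%R.
Proof.
move=> cons; apply: psum_join => //.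
- move=> i; rewrite !ffunE ltnS leq_eqVlt.
  have [e|ne] := eqVneq (co i : nat) k; first by rewrite (val_inj e) ltnn !eqxx.
  rewrite -[co i == k]val_eqE /= (negbTE ne); case: ifP => _; last by rewrite ?if_same.
  by case: (d i =P ord0).
- move=> i; rewrite !ffunE; case: (ltnP (co i) k) => h; last by left.
  by right; rewrite -[co i == k]val_eqE /= (ltn_eqF h).
- move=> i j; rewrite !ffunE.
  case: (ltnP (co i)) => [ci di|]; last by rewrite eqxx.
  case: (co j =P k) => [cj dj|]; last by rewrite eqxx.
  have nc : co i <> co j by move=> e; rewrite e cj ltnn in ci.
  have [ai aj] := (alive_d di, alive_d dj).
  apply/andP; split; apply/eqP => e; apply: nc; first exact: (co_adj cok).
  by apply/esym; apply: (co_adj cok).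
by apply: consistent_sub cons => i; rewrite ffunE; case: ifP; rewrite ?eqxx.
Qed.

Lemma part_supp c i : marked lb rho co s s2 c ->
  (part c d i != ord0) = (rho i == i) && (co i == c).
Proof.
move=> mc; rewrite ffunE; case: (co i =P c) => [e|_]; last by rewrite eqxx andbF.
by rewrite dsupp /mb /merging e mc.
Qed.

End Leaf.

(** The sum ranges over all profiles of the joined components, with a test on the target, because
    the program runs through exactly these and adds each value to the cell of its own target. *)
Lemma psum_new (d' : prof) : (forall i, (d' i != ord0) =
    (rho' i == i) && (merge_co lb rho co s s2 i == s)) ->
  psum rho' d' = (\sum_(d : prof | [forall i, (d i != ord0) == mb i])
                     if merge_prof s s2 d == d' then psum rho d else 0)%R.
Proof.
move=> supp; rewrite (psum_merge _ _ _ _ decK) //; last 2 first.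
- by rewrite supp /rho' merge_rep_s // merge_co_s // !eqxx.
- apply/eqP; rewrite -[_ == _]negbK supp /rho' merge_rep_fix // eqxx !andbF //.
rewrite -big_mkcondr /=; apply: eq_bigl => d; rewrite [in RHS]andbC.
case: eqP => //= e; apply/andP/forallP => [[h h2] i|h]; last first.
  have dsupp i : (d i != ord0) = mb i by exact: (eqP (h i)).
  by rewrite prof_s_neq0 // prof_s2_neq0.
have [->|n1] := eqVneq i s; first by rewrite h /mb /merging rs eqxx marked_s.
have [->|n2] := eqVneq i s2; first by rewrite h2 /mb /merging rs2 eqxx marked_s2.
have -> : d i = d' i by rewrite -e ffunE (negbTE n1) (negbTE n2).
rewrite supp /rho' merge_rep_fix // n2 andbT /mb /merging.
by case: (rho i =P i) => // ri; rewrite merge_co_eq_s.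
Qed.

Lemma psum_old (d' : prof) : d' s = ord0 -> d' s2 = ord0 ->
  psum rho' d' = psum rho d'.
Proof.
move=> e1 e2.
have dE v : d' (rho' v) = d' (rho v).
  by rewrite /rho' /merge_rep; case: eqP => [->|//]; rewrite e1 e2.
apply: eq_big => f; last by move=> _; apply: eq_wt => // v /=; rewrite dE.
have imE i : d' i != ord0 -> im rho' f i = im rho f i.
  by move=> di; apply: im_merge_other; apply: contraNneq di => ->; rewrite ?e1 ?e2.
apply/realizesP/realizesP => -[h1 h2 h3].
  split=> [v|v w|i di]; rewrite -?dE -?imE //; [exact: h1 | exact: h2 | exact: h3].
split=> [v|v w|i di]; rewrite ?dE ?imE //; [exact: h1 | exact: h2 | exact: h3].
Qed.

Lemma consistent_old (d' : prof) c : c != s -> merge_co lb rho co s s2 c = c ->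
  (forall i, (d' i != ord0) =
    (rho' i == i) && (merge_co lb rho co s s2 i == c)) ->
  consistent rho' d' ->
  [/\ consistent rho d', d' s = ord0, d' s2 = ord0 &
      forall i, (d' i != ord0) = (rho i == i) && (co i == c)].
Proof.
move=> cs mc supp /consistentP cons.
have e1 : d' s = ord0.
  apply/eqP; rewrite -[_ == _]negbK supp merge_co_s // [s == c]eq_sym (negbTE cs).
  by rewrite andbF.
have e2 : d' s2 = ord0.
  by apply/eqP; rewrite -[_ == _]negbK supp /rho' merge_rep_fix // eqxx !andbF.
have nes i : d' i != ord0 -> i != s by apply: contraNneq => ->; rewrite e1.
split=> // [|i].
  apply/consistentP => i j di dj.
  move: (di) (dj); rewrite !supp => /andP[/eqP ri _] /andP[/eqP rj _].
  by rewrite -(@hlab_other _ _ lb_gt0 _ s s2) // ?nes //; apply: cons.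
rewrite supp /rho' merge_rep_fix // /merge_co; case: (rho i =P i) => //= ri.
case: ifP => [m|nm]; last first.
  case: (i =P s2) => [e|//]; move: nm; rewrite e marked_s2 //.
rewrite [s == c]eq_sym (negbTE cs) andbF; apply/esym/eqP => e.
have [_ cc] := co_fix cok ri; move: mc cs; rewrite e in cc m.
by rewrite /merge_co cc m => ->; rewrite eqxx.
Qed.

End StageSums.

(** * The program *)

Section Program.

(* [M] is the number of nonempty subsets of the target, which are numbered
   [1..M] ([0] is the empty set), and [LM] the number of labels; [bad] and [un]
   are incompatibility and union in that numbering; [sg] pairs each vertex of
   the target with the number of its singleton. *)
Variables (M LM : nat) (bad : nat -> nat -> nat -> bool) (un : nat -> nat -> nat).
Variable (sg : seq (nat * nat)).

Let N := M.+1.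

Definition vi := var vI.
Definition for_i body := For vI (var vN) body.
Definition lidx i j := NAdd (rd aRow i) j.
Definition rdL i j := rd aL (lidx i j).
Definition ctab l t t' := rd aCT (NAdd (nmulC N (NAdd (nmulC N l) t)) t').
Definition one := NConst 1.
Definition zero := NConst 0.

Definition c_tables := seqs [seq wr aCT (NConst i)
    (NConst (bad (i %/ N %/ N) (i %/ N %% N) (i %% N))) | i <- iota 0 (LM.+1 * N * N)].
Definition c_pow := Seq (setv vW one)
  (for_i (Seq (wr aPw vi (var vW)) (setv vW (nmulC N (var vW))))).
Definition c_row := Seq (setv vW zero)
  (for_i (Seq (wr aRow vi (var vW)) (setv vW (NAdd (var vW) (var vN))))).
Definition c_lab := For vI (var vW)
  (wr aL vi (NAdd (NInput (NAdd one vi)) one)).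
(** The address [code vI] is cell 0 of [vI], so the list of length one read there is the current
    vertex itself. The answer goes to the cell of the profile with the single digit [{a}] at that
    vertex. *)
Definition c_queries := seqs [seq Query (NAdd (var vBlk) (nmulC x.2 (rd aPw vi)))
    (NConst (code vI)) one (NConst x.1) | x <- sg].
Definition c_single := for_i
  (Seq (wr aAl vi one) (Seq (wr aCo vi vi) (Seq (wr aGe vi (var vBlk)) c_queries))).
(** The tape pointer skips the size, the [n * n] labels and the row of singletons, hence starts at
    the partition after the first merge. All one-vertex tables share the block at [N ^ n], since
    their codes [t * N ^ i] are distinct; fresh blocks start right after it. *)
Definition c_init :=
  Seq (setv vN (NInput zero)) (Seq c_tables (Seq c_pow (Seq (setv vBlk (var vW))
  (Seq c_row (Seq c_lab (Seq (setv vPtr (NAdd one (NAdd (var vW) (var vN))))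
  (Seq c_single (setv vBase (NAdd (var vBlk) (var vBlk)))))))))).

(** The only representative that the next partition does not fix is [s2], and the tape gives its new
    representative [s]. *)
Definition c_find := for_i (If (rd aAl vi)
  (If (ndist (NInput (NAdd (var vPtr) vi)) vi)
    (Seq (setv vS2 vi) (setv vS (NInput (NAdd (var vPtr) vi)))) Skip) Skip).
Definition c_clear := for_i (wr aMk vi zero).
(** A disjunction is coded as a sum, and [NSub one x] tests [x] for zero. *)
Definition joinsE :=
  NAdd (NSub one (ndist vi (var vS)))
  (NAdd (NSub one (ndist vi (var vS2)))
  (NAdd (ndist (rdL (var vS) vi) (rdL (var vS2) vi))
  (NAdd (NSub one (rdL (var vS) vi))
  (NAdd (ndist (rdL vi (var vS)) (rdL vi (var vS2)))
        (NSub one (rdL vi (var vS))))))).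
Definition c_mark := for_i (If (rd aAl vi)
  (If joinsE (wr aMk (rd aCo vi) one) Skip) Skip).
(** Both summands are 0 or 1, so the test is their conjunction. The first profile has the digit 1
    everywhere on its support. *)
Definition c_start := for_i (If (NSub (NAdd (rd aAl vi) (rd aMk (rd aCo vi))) one)
  (Seq (wr aT vi one) (wr aV vi (rd aPw vi)))
  (Seq (wr aT vi zero) (wr aV vi zero))).
(** The digit [un t t'] of the merged part, already multiplied by [N ^ s], so that each profile
    finds its target address by one lookup. *)
Definition c_shift := seqs [seq wr aWP (NConst i)
    (nmulC (un (i %/ N) (i %% N)) (rd aPw (var vS))) | i <- iota 0 (N * N)].

Definition c_check := Seq (setv vBad zero) (for_i (If (rd aT vi)
  (setv vBad (NAdd (var vBad)
    (NAdd (ctab (rdL (var vS) vi) (rd aT (var vS)) (rd aT vi))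
    (NAdd (ctab (rdL (var vS2) vi) (rd aT (var vS2)) (rd aT vi))
    (NAdd (ctab (rdL vi (var vS)) (rd aT vi) (rd aT (var vS)))
          (ctab (rdL vi (var vS2)) (rd aT vi) (rd aT (var vS2)))))))) Skip)).
(** One pass computes the table addresses of all components at once: each vertex adds its digit
    value to the address of its component. *)
Definition c_acc := Seq (for_i (wr aAcc vi (rd aGe vi)))
  (for_i (wr aAcc (rd aCo vi) (NAdd (rd aAcc (rd aCo vi)) (rd aV vi)))).
Definition c_prod := Seq (AStore one AOne)
  (for_i (If (rd aMk vi) (AStore one (AMul (ACell one) (ACell (rd aAcc vi)))) Skip)).
Definition c_target := Seq (setv vTgt (var vBase))
  (Seq (for_i (setv vTgt (NAdd (var vTgt) (rd aV vi))))
   (setv vTgt (NAdd (NSub (NSub (var vTgt) (rd aV (var vS))) (rd aV (var vS2)))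
       (rd aWP (NAdd (nmulC N (rd aT (var vS))) (rd aT (var vS2))))))).
Definition c_add := If (var vBad) Skip
  (AStore (var vTgt) (AAdd (ACell (var vTgt)) (ACell one))).
(** One step of the odometer. A carry that leaves the last position means that all profiles have
    been seen, and clears [vRun]. *)
Definition c_next := Seq (setv vCarry one) (Seq (for_i
  (If (var vCarry) (If (rd aT vi) (If (NSub (NConst M) (rd aT vi))
     (Seq (wr aT vi (NAdd (rd aT vi) one))
     (Seq (wr aV vi (NAdd (rd aV vi) (rd aPw vi))) (setv vCarry zero)))
     (Seq (wr aT vi one) (wr aV vi (rd aPw vi)))) Skip) Skip))
  (setv vRun (NSub one (var vCarry)))).
Definition c_leaf := Seq c_check (Seq c_acc (Seq c_prod (Seq c_target
  (Seq c_add c_next)))).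
Definition c_leaves := Seq (setv vRun one) (While (var vRun) c_leaf).

(** Entries on which [s] and [s2] agree are already right. Columns are treated after rows, so the
    entry [(s, s)] depends on all four old ones. *)
Definition c_rows := for_i (If (ndist (rdL (var vS) vi) (rdL (var vS2) vi))
  (wr aL (lidx (var vS) vi) zero) Skip).
Definition c_cols := for_i (If (ndist (rdL vi (var vS)) (rdL vi (var vS2)))
  (wr aL (lidx vi (var vS)) zero) Skip).
Definition c_comps := for_i (If (rd aMk (rd aCo vi)) (wr aCo vi (var vS)) Skip).
Definition c_advance :=
  Seq (wr aAl (var vS2) zero) (Seq (wr aGe (var vS) (var vBase))
  (Seq (setv vBase (NAdd (var vBase) (var vBlk)))
       (setv vPtr (NAdd (var vPtr) (var vN))))).

Definition c_stage := Seq c_find (Seq c_clear (Seq c_mark (Seq c_start (Seq c_shift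
  (Seq c_leaves (Seq c_rows (Seq c_cols (Seq c_comps c_advance)))))))).

(** The remaining part has representative 0, so its profile [t] has code [t * N ^ 0]. The label of
    this part with itself is tested here, since no later stage can do it. *)
Definition c_output := seqs [seq If (ctab (rdL zero zero) (NConst t) (NConst t)) Skip
   (AStore zero (AAdd (ACell zero) (ACell (NAdd (rd aGe (rd aCo zero)) (NConst t)))))
  | t <- iota 1 M].

Definition c_main := Seq c_init
  (Seq (For vK (NSub (var vN) one) c_stage) c_output).

(** * Specifications of the loops of one stage *)

Section Specs.

Variables (A : pzSemiRingType) (inp : nat -> nat).
Variables (query : seq nat -> nat -> option (A * nat)) (C n : nat).

Notation V := 'I_n.
Notation run := (@run A inp).
Notation wp := (@wp A inp query C).
Notation evE := (@evE A inp).
Notation runE := (@runE A inp).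
Implicit Types (st : state A) (i j : V).

Definition frame (ms : seq arr) st0 st :=
  forall b k, ~~ has (eqarr b) ms -> get st b k = get st0 b k.

Lemma frame_setn ms st0 st a k x :
  has (eqarr a) ms -> frame ms st0 st -> frame ms st0 (setn st a k x).
Proof.
move=> am F b j nb; rewrite get_setn F //; case: eqP => [e|]; rewrite ?andbF //.
case eb: (eqarr b a) => //=; move/eqP: eb => eb; move: nb.
by rewrite (eq_has (a2 := eqarr a)) ?am // => c; rewrite /eqarr eb.
Qed.

Lemma frame_comp ms st0 st1 st2 :
  frame ms st0 st1 -> frame ms st1 st2 -> frame ms st0 st2.
Proof. by move=> F1 F2 b k nb; rewrite F2 // F1. Qed.

Lemma wp_for_i ms body (I : nat -> state A -> Prop) st0 : flat body ->
  get st0 vN 0 = n -> has (eqarr vI) ms -> ~~ has (eqarr vN) ms ->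
  (forall k st x, I k st -> I k (setn st vI 0 x)) ->
  I 0 st0 ->
  (forall i st, I i st -> frame ms st0 st -> get st vI 0 = i ->
     [/\ frame ms st0 (run body st), get (run body st) vI 0 = i & I i.+1 (run body st)]) ->
  wp n.+1 (for_i body) (fun st => frame ms st0 st /\ I n st) st0.
Proof.
move=> fb N0 mI mN Iset I0 step.
apply: (@wp_for_flat _ _ _ _ n _ _ _ (fun k st => frame ms st0 st /\ I k st)) => //.
- by split; [apply: frame_setn | apply: Iset].
- by move=> k st kn [F _]; rewrite ev_var F.
- move=> k st kn gk [F Ik].
  have [F' g' I'] := step (Ordinal kn) st Ik F gk.
  by split=> //; split; [apply: frame_setn | apply: Iset].
Qed.

Lemma wp_find st0 (rho : V -> V) (s s2 : V) :
  get st0 vN 0 = n -> s != s2 -> rho s2 = s2 ->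
  (forall i, get st0 aAl i = (rho i == i)) ->
  (forall i, inp (get st0 vPtr 0 + i) = merge_rep rho s s2 i) ->
  wp n.+1 c_find (fun st => frame [:: vI; vS; vS2] st0 st /\
    [/\ amem st = amem st0, get st vS 0 = s & get st vS2 0 = s2]) st0.
Proof.
move=> N0 ss2 rs2 al tp.
apply: (wp_mono (leqnn _)); last first.
  apply: (@wp_for_i [:: vI; vS; vS2] _ (fun k st => amem st = amem st0 /\
    (s2 < k -> get st vS 0 = s /\ get st vS2 0 = s2))) => //.
  move=> i st [am h] F gi.
  rewrite !runE !evE gi (F aAl) // al; case: (rho i =P i) => /= ri; last first.
    split=> //; split=> //; rewrite ltnS leq_eqVlt => /orP[/eqP e|/h //].
    by case: ri; rewrite -(val_inj e).
  rewrite (F vPtr) // tp /merge_rep ri.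
  have [e2|n2] := eqVneq i s2.
    have -> : (s - i + (i - s) != 0)%N.
      by move: ss2; rewrite -e2 -val_eqE /=; lia.
    rewrite !stE /= gi; split=> //; first by do 2! [apply: frame_setn => //].
    split=> // _; rewrite (F vPtr) // tp e2; split=> //.
    by rewrite /merge_rep rs2 eqxx.
  rewrite subnn /=; split=> //; split=> //.
  rewrite ltnS leq_eqVlt => /orP[/eqP e|/h //].
  by case/eqP: n2; apply: val_inj.
by move=> st [F [am h]]; split=> //; have [] := h (ltn_ord s2).
Qed.

Lemma sum_ltS (P : pred V) (F : V -> nat) (k : V) :
  \sum_(i < n | (i < k.+1) && P i) F i =
  \sum_(i < n | (i < k) && P i) F i + (if P k then F k else 0).
Proof.
rewrite (bigID (pred1 k)) /= addnC; congr (_ + _).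
  apply: eq_bigl => i; rewrite ltnS [i <= k]leq_eqVlt -(inj_eq val_inj) /=.
  by case: ltngtP; rewrite ?andbF ?andbT.
case: ifP => Pk; last by rewrite big1 // => i /andP[/andP[_ Pi] /eqP e]; rewrite e Pk in Pi.
by rewrite (big_pred1 k) // => i /=; case: eqP => [->|]; rewrite ?andbF // ltnSn Pk.
Qed.

Lemma wp_clear st0 : get st0 vN 0 = n ->
  wp n.+1 c_clear (fun st => frame [:: vI; aMk] st0 st /\
    (amem st = amem st0 /\ forall i, get st aMk i = 0)) st0.
Proof.
move=> N0; apply: (wp_mono (leqnn _)); last first.
  apply: (@wp_for_i [:: vI; aMk] _ (fun k st => amem st = amem st0 /\
    (forall i, i < k -> get st aMk i = 0))) => //.
    by move=> k st x [am h]; split=> // i /h; rewrite !stE.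
  move=> i st [am h] F gi; rewrite !runE !evE gi !stE.
  split=> //; first exact: frame_setn.
  split=> // j; rewrite !stE /= ltnS leq_eqVlt => /orP[->//|/h ->].
  by rewrite if_same.
by move=> st [F [am h]]; split=> //; split=> // i; apply: h.
Qed.

Variables (lb : V -> V -> nat).
Hypothesis lb_gt0 : forall v w, 0 < lb v w.
Notation hl := (hlab lb).

Definition labels_ok st (L : V -> V -> nat) := forall i j, get st aL (i * n + j) = L i j.

Definition alive_labels st (rho : V -> V) := forall i j, rho i = i -> rho j = j ->
  get st aL (i * n + j) = hl rho i j.

Definition rows_ok st := forall i, get st aRow i = i * n.

Lemma wp_mark st0 (rho co : V -> V) (s s2 : V) :
  get st0 vN 0 = n -> rows_ok st0 -> alive_labels st0 rho ->
  rho s = s -> rho s2 = s2 -> get st0 vS 0 = s -> get st0 vS2 0 = s2 ->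
  (forall i, get st0 aAl i = (rho i == i)) ->
  (forall i, get st0 aCo i = co i) ->
  (forall i, get st0 aMk i = 0) ->
  wp n.+1 c_mark (fun st => frame [:: vI; aMk] st0 st /\
    (amem st = amem st0 /\ forall i, get st aMk i = marked lb rho co s s2 i)) st0.
Proof.
move=> N0 row lab rs rs2 gS gS2 al gco mk0; apply: (wp_mono (leqnn _)); last first.
  apply: (@wp_for_i [:: vI; aMk] _ (fun k st => amem st = amem st0 /\
    (forall c : V, get st aMk c = [exists i : V,
       [&& (i < k)%N, rho i == i, co i == c & joins lb rho s s2 i]]))) => //.
  - by move=> k st x [am h]; split=> // i; rewrite -h !stE.
  - by split=> // i; rewrite mk0; apply/esym/eqP; rewrite eqb0; apply/existsP=> -[].
  move=> i st [am h] F gi.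
  have exS c : [exists j : V, [&& (j < i.+1)%N, rho j == j, co j == c & joins lb rho s s2 j]]
     = [&& rho i == i, co i == c & joins lb rho s s2 i] ||
       [exists j : V, [&& (j < i)%N, rho j == j, co j == c & joins lb rho s s2 j]].
    apply/existsP/orP => [[j /andP[]]|[]].
    - rewrite ltnS leq_eqVlt => /orP[/eqP/val_inj->|ji]; first by left.
      by right; apply/existsP; exists j; rewrite ji.
    - by exists i; rewrite ltnSn.
    - by case/existsP=> j /andP[ji r]; exists j; rewrite ltnW.
  have jE : rho i = i -> (ev inp st joinsE != 0) = joins lb rho s s2 i.
    move=> ri; rewrite !evE gi !(F vS) // !(F vS2) // !gS !gS2 !(F aRow) // !(F aL) //.
    rewrite !row !lab // /joins -!val_eqE /=.
    by apply/idP/idP; lia.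
  rewrite run_if ev_rd ev_var gi (F aAl) // al.
  case: (rho i =P i) => [ri|ri] /=; last first.
    split=> //; split=> // c; rewrite exS h.
    by move/eqP/negbTE: ri => ->.
  rewrite run_if jE //; case: ifP => ji; last by split=> //; split=> // c; rewrite exS ji h !andbF.
  rewrite run_wr !evE gi !stE; split=> //; first exact: frame_setn.
  split=> // c; rewrite !stE exS ji (F aCo) // gco ri eqxx andbT /= h.
  by rewrite [in RHS]eq_sym -(inj_eq val_inj) /=; case: eqP.
by move=> st [F [am h]]; split=> //; split=> // c; rewrite h /marked; congr (nat_of_bool _);
  apply: eq_existsb => i; rewrite ltn_ord.
Qed.

Lemma wp_start st0 (mb : V -> bool) :
  get st0 vN 0 = n -> (forall i, get st0 aPw i = N ^ i) ->
  (forall i, (get st0 aAl i + get st0 aMk (get st0 aCo i) - 1 != 0) = mb i) ->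
  wp n.+1 c_start (fun st => frame [:: vI; aT; aV] st0 st /\
    (amem st = amem st0 /\ forall i, get st aT i = mb i /\ get st aV i = mb i * N ^ i)) st0.
Proof.
move=> N0 pw hm; apply: (wp_mono (leqnn _)); last first.
  apply: (@wp_for_i [:: vI; aT; aV] _ (fun k st => amem st = amem st0 /\
    (forall i, i < k -> get st aT i = mb i /\ get st aV i = mb i * N ^ i))) => //.
    by move=> k st x [am h]; split=> // i /h; rewrite !stE.
  move=> i st [am h] F gi; rewrite !runE !evE gi (F aAl) // (F aCo) // (F aMk) // hm.
  case: ifP => mi; rewrite ?stE /= ?gi ?stE /=; split=> //;
    [by do 2! [apply: frame_setn => //]| |by do 2! [apply: frame_setn => //]|];
    split=> // j; rewrite ltnS leq_eqVlt !stE /= ?gi => /orP[/eqP/val_inj->|ji];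
    rewrite ?eqxx ?mi ?mul0n ?mul1n ?(F aPw) ?pw ?(ltn_eqF ji) //; exact: h.
by move=> st [F [am h]]; split=> //; split=> // i; apply: h.
Qed.

Lemma wp_shift m st0 : 0 < m ->
  wp m c_shift (fun st => frame [:: aWP] st0 st /\
    (amem st = amem st0 /\ forall t t', t < N -> t' < N ->
       get st aWP (N * t + t') = un t t' * get st0 aPw (get st0 vS 0))) st0.
Proof.
move=> m0; apply: wp_flat => //; first exact: flat_seqs.
have [|h1 h2 h3] := @run_stores A inp aWP
  (fun k : nat => nmulC (un (k %/ N) (k %% N)) (rd aPw (var vS))) (N * N) st0.
  by move=> i j x st; rewrite !evE !stE.
split; first by move=> b k /=; rewrite orbF; apply: h2.
split=> // t t' tN tN'; rewrite h1 /=; last by nia.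
by rewrite !evE [N * t]mulnC divnMDl // modnMDl divn_small // modn_small // addn0.
Qed.

Lemma wp_acc st0 (co : V -> V) (ge vv : V -> nat) :
  get st0 vN 0 = n -> (forall i, get st0 aCo i = co i) ->
  (forall i, get st0 aGe i = ge i) -> (forall i, get st0 aV i = vv i) ->
  wp n.+1 c_acc (fun st => frame [:: vI; aAcc] st0 st /\
    (amem st = amem st0 /\ forall c : V,
       get st aAcc c = ge c + \sum_(i < n | co i == c) vv i)) st0.
Proof.
move=> N0 gco gge gv; apply: wp_seq; apply: (wp_mono (leqnn _)); last first.
  apply: (@wp_for_i [:: vI; aAcc] _ (fun k st => amem st = amem st0 /\
    (forall i, i < k -> get st aAcc i = ge i))) => //.
    by move=> k st x [am h]; split=> // i /h; rewrite !stE.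
  move=> i st [am h] F gi; rewrite !runE !evE gi (F aGe) // gge !stE.
  split=> //; first exact: frame_setn.
  split=> // j; rewrite !stE /= ltnS leq_eqVlt => /orP[/eqP/val_inj->|ji].
    by rewrite eqxx.
  by rewrite (ltn_eqF ji) h.
move=> st1 [F1 [am1 h1]]; apply: (wp_mono (leqnn _)); last first.
  apply: (@wp_for_i [:: vI; aAcc] _ (fun k st => amem st = amem st0 /\
    (forall c : V, get st aAcc c = ge c + \sum_(i < n | (i < k)%N && (co i == c)) vv i))) => //.
  - by rewrite (F1 vN).
  - by move=> k st x [am h]; split=> // i; rewrite -h !stE.
  - split=> // c; rewrite h1 //= big_pred0 ?addn0 //.
  move=> i st [am h] F gi; rewrite !runE !evE gi (F aCo) // (F1 aCo) // gco (F aV) // (F1 aV) //.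
  rewrite gv h !stE; split=> //; first exact: frame_setn.
  split=> // c; rewrite !stE /= sum_ltS h.
  rewrite [co i == c]eq_sym -[c == co i]val_eqE /=; case: eqP => [/val_inj->|_].
    by rewrite addnA.
  by rewrite addn0.
move=> st [F [am h]]; split; first by move=> b k nb; rewrite F // F1.
split=> // c; rewrite h; congr (_ + _); apply: eq_bigl => i.
by rewrite ltn_ord.
Qed.

(** The value is claimed only under [cons], because the tables are unreliable for other profiles.
    Cell 1 accumulates the product, so the addresses read must differ from 1. *)
Lemma wp_prod (cons : Prop) st0 (Pf : nat -> A) (mk : V -> bool) (acc : V -> nat) :
  get st0 vN 0 = n -> (forall i, get st0 aMk i = mk i) ->
  (forall i, get st0 aAcc i = acc i) -> (forall i, mk i -> acc i != 1) ->
  (cons -> Pf 0 = 1%R) ->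
  (forall c : V, cons ->
     Pf c.+1 = if mk c then (Pf c * amem st0 (acc c))%R else Pf c) ->
  wp n.+1 c_prod (fun st => frame [:: vI] st0 st /\
    ((forall x, x != 1 -> amem st x = amem st0 x) /\
     (cons -> amem st 1 = Pf n))) st0.
Proof.
move=> N0 gm ga a1 P0 PS; apply: wp_seq; apply: wp_flat => //.
rewrite runE ev_const; set st1 := seta _ _ _.
apply: (wp_mono (leqnn _)); last first.
  apply: (@wp_for_i [:: vI] _ (fun k st =>
    (forall x, x != 1 -> amem st x = amem st0 x) /\ (cons -> amem st 1 = Pf k))) => //.
  - by split=> [x /negbTE nx|/P0 ->]; rewrite amem_seta ?nx.
  move=> i st [am h] F gi; rewrite !runE !evE gi (F aMk) // get_seta gm eqb0 negbK.
  case: (boolP (mk i)) => mi; last first.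
    by split=> //; split=> // c; rewrite PS // (negbTE mi); apply: h.
  split=> //; split=> [x nx|c]; first by rewrite amem_seta (negbTE nx) am.
  rewrite amem_seta eqxx PS // mi -h //; congr (_ * _)%R.
  rewrite -[LHS]/(amem st (ev inp st (rd aAcc vi))) !evE gi (F aAcc) //.
  by rewrite get_seta ga am // a1.
by move=> st [F [am h]]; split=> // b k nb; rewrite F // get_seta.
Qed.

Lemma wp_target st0 (vv : V -> nat) (s s2 : V) :
  get st0 vN 0 = n -> (forall i, get st0 aV i = vv i) ->
  get st0 vS 0 = s -> get st0 vS2 0 = s2 ->
  wp n.+1 c_target (fun st => frame [:: vI; vTgt] st0 st /\
    (amem st = amem st0 /\ get st vTgt 0 = get st0 vBase 0 + \sum_(i < n) vv i
       - vv s - vv s2 + get st0 aWP (N * get st0 aT s + get st0 aT s2))) st0.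
Proof.
move=> N0 gv gs gs2; apply: wp_seq; apply: wp_flat => //; rewrite runE evE.
set st1 := setn _ _ _ _; apply: wp_seq; apply: (wp_mono (leqnn _)); last first.
  apply: (@wp_for_i [:: vI; vTgt] _ (fun k st => amem st = amem st0 /\
    get st vTgt 0 = get st0 vBase 0 + \sum_(i < n | (i < k)%N && true) vv i)) => //.
  - by split=> //; rewrite stE /= big_pred0 ?addn0 // => i; rewrite andbT.
  move=> i st [am h] F gi; rewrite !runE !evE gi !stE; split=> //.
    exact: frame_setn.
  by split=> //; rewrite ?stE /= h sum_ltS (F aV) // stE /= gv addnA.
move=> st [F [am h]]; apply: wp_flat => //; rewrite runE !evE; split.
  by apply: frame_setn => //; apply: frame_comp F; apply: frame_setn.
split=> //; rewrite !stE /=.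
rewrite !(F vS) // !(F vS2) // !(F aT) // !(F aV) // !(F aWP) // !stE /=.
rewrite gs gs2 !gv h; congr (_ + _ - _ - _ + _).
by apply: eq_bigl => i; rewrite ltn_ord.
Qed.

Lemma wp_next st0 (mb : pred nat) r : 0 < M ->
  get st0 vN 0 = n -> (forall i, get st0 aPw i = N ^ i) ->
  (forall i, get st0 aT i = dig M mb r i) ->
  (forall i, get st0 aV i = dig M mb r i * N ^ i) ->
  wp n.+1 c_next (fun st => frame [:: vI; vCarry; aT; aV; vRun] st0 st /\
    [/\ amem st = amem st0, get st vRun 0 = ~~ (M ^ cnt mb n %| r.+1),
        (forall i, get st aT i = dig M mb r.+1 i)
      & (forall i, get st aV i = dig M mb r.+1 i * N ^ i)]) st0.
Proof.
move=> M0 N0 pw gt gv; apply: wp_seq; apply: wp_flat => //; rewrite runE evE.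
set st1 := setn _ _ _ _; apply: wp_seq; apply: (wp_mono (leqnn _)); last first.
  (* Positions below [k] already show the digits of [r.+1], the others those of [r]; the carry flag
     is the divisibility of [dig_next]. *)
  apply: (@wp_for_i [:: vI; vCarry; aT; aV; vRun] _ (fun k st => [/\ amem st = amem st0,
     get st vCarry 0 = (M ^ cnt mb k %| r.+1),
     (forall i, get st aT i = dig M mb (if i < k then r.+1 else r) i)
     & (forall i, get st aV i = dig M mb (if i < k then r.+1 else r) i * N ^ i)])) => //.
  - move=> k st x [am h1 h2 h3].
    by split=> // i; rewrite stE /= ?h2 ?h3.
  - by split; rewrite ?stE /= ?dvd1n // => i; rewrite stE /= ?gt ?gv.
  move=> i st [am h1 h2 h3] F gi.
  have other (j : V) : (j < i.+1)%N = (j == i) || (j < i)%N.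
    by rewrite ltnS leq_eqVlt val_eqE.
  have same : dig M mb r.+1 i = dig M mb r i ->
      (forall j, get st aT j = dig M mb (if j < i.+1 then r.+1 else r) j) /\
      (forall j, get st aV j = dig M mb (if j < i.+1 then r.+1 else r) j * N ^ j).
    move=> e; split=> j; rewrite ?h2 ?h3 other; case: eqP => [->|] //=; by rewrite ltnn e.
  have dn := dig_next mb M0 r i; have cn := carry_next mb M0 r i.
  rewrite !runE !evE h1 gi h2 ltnn.
  case cr: (M ^ cnt mb i %| r.+1); rewrite cr /= in dn cn h1 *; last first.
    by have [] := same dn; split=> //; split=> //; rewrite cn h1.
  have ez := dig_eq0 M mb r i.
  case mi: (mb i); rewrite mi /= in dn cn ez *; rewrite ez; last first.
    by have [] := same dn; split=> //; split=> //; rewrite cn h1.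
  rewrite /= -lt0n subn_gt0.
  have upd x (j : V) : (if (j : nat) == i then x else dig M mb (if j < i then r.+1 else r) j) =
      if j == i then x else dig M mb (if j < i.+1 then r.+1 else r) j.
    by rewrite val_eqE other; case: eqP.
  case: ifP => lt; rewrite lt in dn.
    rewrite !stE /= gi; split=> //; first by do 3! [apply: frame_setn => //].
    have nd : dig M mb r i == M = false by rewrite ltn_eqF.
    split=> // [|j|j]; first by rewrite cn nd.
      rewrite !stE /= ?gi ?h2 ?ltnn upd; case: eqP => [->|//].
      by rewrite ltnSn dn addn1.
    rewrite !stE /= ?gi (F aPw) // ?stE /= pw !h3 ?ltnn.
    rewrite val_eqE other; case: eqP => [->|//] /=.
    by rewrite dn mulSn addnC.
  have ed : dig M mb r i == M by rewrite eqn_leq dig_le // leqNgt lt.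
  rewrite !stE /= gi; split=> //; first by do 2! [apply: frame_setn => //].
  split=> // [|j|j]; first by rewrite ?stE /= ?h1 ?cn ?cr ?ed.
    by rewrite !stE /= h2 upd; case: eqP => [->|//]; rewrite ltnSn dn.
  rewrite !stE /= ?gi (F aPw) // ?stE /= pw h3.
  rewrite val_eqE other; case: eqP => [->|//] /=.
  by rewrite dn mul1n.
move=> st [F [am h1 h2 h3]]; apply: wp_flat => //; rewrite runE !evE; split.
  by apply: frame_setn => //; apply: frame_comp F; apply: frame_setn.
split=> // [|i|i].
- by rewrite stE /= h1; case: (_ %| _).
- by rewrite stE /= h2 ltn_ord.
- by rewrite stE /= h3 ltn_ord.
Qed.

Lemma index_inj (i j i' j' : V) :
  (i * n + j == i' * n + j') = (i == i') && (j == j').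
Proof.
apply/eqP/andP => [e|[/eqP -> /eqP ->] //].
have n0 : 0 < n by apply: leq_ltn_trans (ltn_ord i).
have := congr1 (divn^~ n) e; have := congr1 (modn^~ n) e.
rewrite !modnMDl !divnMDl // !modn_small // !divn_small // !addn0.
by move=> /val_inj -> /val_inj ->.
Qed.

Lemma wp_rows st0 (L : V -> V -> nat) (s s2 : V) :
  get st0 vN 0 = n -> rows_ok st0 -> labels_ok st0 L -> s != s2 ->
  get st0 vS 0 = s -> get st0 vS2 0 = s2 ->
  wp n.+1 c_rows (fun st => frame [:: vI; aL] st0 st /\
    (amem st = amem st0 /\ labels_ok st (row_merge s s2 L))) st0.
Proof.
move=> N0 row lab ss2 gs gs2; apply: (wp_mono (leqnn _)); last first.
  (* Iteration [j] reads and writes column [j] only, so the update in place never meets an entry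
     already changed. *)
  apply: (@wp_for_i [:: vI; aL] _ (fun k st => amem st = amem st0 /\
    labels_ok st (fun i j => if (j < k)%N then row_merge s s2 L i j else L i j))) => //.
    by move=> k st x [am h]; split=> // i j; rewrite -h !stE.
  move=> j st [am h] F gj.
  rewrite !runE !evE gj !(F vS) // !(F vS2) // !(F aRow) // !gs !gs2 !row !h ltnn.
  have other i : (i < j.+1)%N = (i == j) || (i < j)%N by rewrite ltnS leq_eqVlt val_eqE.
  case: ifP => e.
    rewrite !stE; split=> //; first exact: frame_setn.
    split=> // a b; rewrite !stE /= index_inj h other.
    have [->|nb] := eqVneq b j; last by rewrite andbF.
    rewrite andbT /row_merge /same_or0 ltnn /=; case: eqP => // ea.
    by case: (L s j =P L s2 j) e => // ->; rewrite subnn.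
  split=> //; split=> // a b; rewrite h other.
  have [->|//] := eqVneq b j; rewrite ltnn /row_merge /same_or0 /=.
  by case: (a =P s) => // ->; case: (L s j =P L s2 j) e; lia.
by move=> st [F [am h]]; split=> //; split=> // i j; rewrite h ltn_ord.
Qed.

Lemma wp_cols st0 (L : V -> V -> nat) (s s2 : V) :
  get st0 vN 0 = n -> rows_ok st0 -> labels_ok st0 L -> s != s2 ->
  get st0 vS 0 = s -> get st0 vS2 0 = s2 ->
  wp n.+1 c_cols (fun st => frame [:: vI; aL] st0 st /\
    (amem st = amem st0 /\ labels_ok st (col_merge s s2 L))) st0.
Proof.
move=> N0 row lab ss2 gs gs2; apply: (wp_mono (leqnn _)); last first.
  apply: (@wp_for_i [:: vI; aL] _ (fun k st => amem st = amem st0 /\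
    labels_ok st (fun i j => if (i < k)%N then col_merge s s2 L i j else L i j))) => //.
    by move=> k st x [am h]; split=> // i j; rewrite -h !stE.
  move=> j st [am h] F gj.
  rewrite !runE !evE gj !(F vS) // !(F vS2) // !(F aRow) // !gs !gs2 !row !h ltnn.
  have other i : (i < j.+1)%N = (i == j) || (i < j)%N by rewrite ltnS leq_eqVlt val_eqE.
  case: ifP => e.
    rewrite !stE; split=> //; first exact: frame_setn.
    split=> // a b; rewrite !stE /= index_inj h other.
    have [->|nb] := eqVneq a j; last by [].
    rewrite /col_merge /same_or0 ltnn /=; case: eqP => // ea.
    by case: (L j s =P L j s2) e => // ->; rewrite subnn.
  split=> //; split=> // a b; rewrite h other.
  have [->|//] := eqVneq a j; rewrite ltnn /col_merge /same_or0 /=.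
  by case: (b =P s) => // ->; case: (L j s =P L j s2) e; lia.
by move=> st [F [am h]]; split=> //; split=> // i j; rewrite h ltn_ord.
Qed.

Lemma wp_comps st0 (co : V -> V) (mk : V -> bool) (s : V) :
  get st0 vN 0 = n -> (forall i, get st0 aCo i = co i) ->
  (forall i, get st0 aMk i = mk i) -> get st0 vS 0 = s ->
  wp n.+1 c_comps (fun st => frame [:: vI; aCo] st0 st /\
    (amem st = amem st0 /\
     forall i, get st aCo i = if mk (co i) then s else co i)) st0.
Proof.
move=> N0 gco gmk gs; apply: (wp_mono (leqnn _)); last first.
  apply: (@wp_for_i [:: vI; aCo] _ (fun k st => amem st = amem st0 /\
    forall i, get st aCo i = if (i < k)%N && mk (co i) then s else co i)) => //.
    by move=> k st x [am h]; split=> // i; rewrite -h !stE.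
  move=> j st [am h] F gj.
  rewrite !runE !evE gj !h ltnn (F aMk) // gmk (F vS) // gs eqb0 negbK.
  have other i : (i < j.+1)%N = (i == j) || (i < j)%N by rewrite ltnS leq_eqVlt val_eqE.
  case: ifP => e.
    rewrite !stE; split=> //; first exact: frame_setn.
    split=> // a; rewrite !stE /= val_eqE h other.
    by have [->|] := eqVneq a j; rewrite ?e.
  split=> //; split=> // a; rewrite h other.
  by have [->|//] := eqVneq a j; rewrite e ltnn.
by move=> st [F [am h]]; split=> //; split=> // i; rewrite h ltn_ord.
Qed.

Variables (U : finType) (a0 : U) (cp : nat -> U -> U -> bool).
Variables (q : V -> U -> A).
Variables (dec : 'I_M.+1 -> {set U}) (enc : {set U} -> 'I_M.+1).
Hypothesis q_comm :
  forall v w a b, v != w -> (q v a * q w b = q w b * q v a)%R.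
Hypotheses (decK : cancel dec enc) (encK : cancel enc dec).
Hypothesis dec0 : dec ord0 = set0.
Hypothesis lb_le : forall v w, lb v w <= LM.
Hypothesis badE : forall l (t t' : 'I_M.+1), bad l t t' = ~~ fits cp dec l t t'.
Hypothesis unE : forall t t' : 'I_M.+1, un t t' = enc (dec t :|: dec t').
Hypothesis M_gt0 : 0 < M.

Notation prof := {ffun V -> 'I_M.+1}.
Notation psum := (psum a0 lb cp q dec).
Notation consistent := (consistent lb cp dec).
Notation fits := (fits cp dec).
Notation merge_prof := (merge_prof dec enc).

Definition pc (d : prof) := pcode N (fun i => d i).

Definition ct_ok st := forall l t t', l <= LM -> t < N -> t' < N ->
  get st aCT (N * (N * l + t) + t') = bad l t t'.

Lemma hl_le rho i j : hl rho i j <= LM.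
Proof. by rewrite /hlab; case: ifP. Qed.

Lemma wp_check st0 (rho co : V -> V) (s s2 : V) (d : prof) :
  get st0 vN 0 = n -> rows_ok st0 -> alive_labels st0 rho -> ct_ok st0 ->
  rho s = s -> rho s2 = s2 -> get st0 vS 0 = s -> get st0 vS2 0 = s2 ->
  (forall i, get st0 aT i = d i) ->
  (forall i, (d i != ord0) = merging lb rho co s s2 i) ->
  wp n.+1 c_check (fun st => frame [:: vI; vBad] st0 st /\
    (amem st = amem st0 /\
     (get st vBad 0 == 0) = admissible lb cp dec rho co s s2 d)) st0.
Proof.
move=> N0 row lab ct rs rs2 gs gs2 gt supp.
apply: wp_seq; apply: wp_flat => //; rewrite runE evE.
set st1 := setn _ _ _ _; apply: (wp_mono (leqnn _)); last first.
  apply: (@wp_for_i [:: vI; vBad] _ (fun k st => amem st = amem st0 /\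
    (get st vBad 0 == 0) = [forall i : V, (i < k)%N ==> merging lb rho co s s2 i ==>
      [&& fits (hl rho s i) (d s) (d i), fits (hl rho s2 i) (d s2) (d i),
      fits (hl rho i s) (d i) (d s) & fits (hl rho i s2) (d i) (d s2)]])) => //.
  - by split=> //; apply/esym/forallP.
  move=> i st [am h] F gi.
  have F0 : frame [:: vI; vBad] st0 st.
    by apply: frame_comp F; apply: frame_setn.
  have allS (Q : pred V) : [forall j : V, (j < i.+1)%N ==> Q j] =
      Q i && [forall j : V, (j < i)%N ==> Q j].
    apply/forallP/andP => [hQ|[Qi /forallP hQ] j].
      split; first by have := hQ i; rewrite ltnSn.
      by apply/forallP => j; apply/implyP => ji; have := hQ j; rewrite ltnW.
    rewrite ltnS leq_eqVlt; apply/implyP => /orP[/eqP/val_inj->//|ji].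
    by have := hQ j; rewrite ji.
  rewrite run_if ev_rd ev_var gi (F0 aT) // gt allS -supp -[d i == ord0]val_eqE /=.
  case: (d i =P 0 :> nat) => [_|di] /=; first by split.
  have ai : rho i = i.
    have := supp i; rewrite -[d i == ord0]val_eqE /=.
    by case: (d i =P 0 :> nat) => //= _ /esym /andP[/eqP].
  rewrite run_setv; split; first exact: frame_setn.
    by rewrite stE.
  split; rewrite ?stE //= !evE gi !(F0 vS) // !(F0 vS2) // gs gs2.
  rewrite !(F0 aRow) // !row !(F0 aL) // !lab // !(F0 aT) // !gt !(F0 aCT) //.
  rewrite !ct ?hl_le ?ltn_ord // !badE !addn_eq0 h !eqb0 !negbK andbC -!andbA.
  by [].
move=> st [F [am h]]; split; first by apply: frame_comp F; apply: frame_setn.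
split=> //; rewrite h; apply: eq_forallb => i; by rewrite ltn_ord.
Qed.

Definition static st := [/\ get st vN 0 = n, (forall i, get st aPw i = N ^ i),
  rows_ok st, get st vBlk 0 = N ^ n & ct_ok st].

Lemma static_frame ms st0 st :
  ~~ has (eqarr vN) ms -> ~~ has (eqarr aPw) ms -> ~~ has (eqarr aRow) ms ->
  ~~ has (eqarr vBlk) ms -> ~~ has (eqarr aCT) ms ->
  frame ms st0 st -> static st0 -> static st.
Proof.
move=> m1 m2 m3 m4 m5 F [h1 h2 h3 h4 h5]; split; rewrite ?F //.
- by move=> i; rewrite F.
- by move=> i; rewrite F.
- by move=> l t t' *; rewrite F // h5.
Qed.

(** * Enumeration of the profiles in one stage *)

Section Leaves.

Implicit Types (d : prof) (c : V).

Variables (rho co : V -> V) (ge : V -> nat) (base : nat) (s s2 : V).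
Hypotheses (rs : rho s = s) (rs2 : rho s2 = s2) (ss2 : s != s2).
Hypothesis cok : comp_ok lb rho co.
Hypothesis ge_lo : forall c, rho c = c -> co c = c ->
  N ^ n <= ge c /\ ge c + N ^ n <= base.

Let rho' := merge_rep rho s s2.
Let mk := marked lb rho co s s2.
Definition mbn k := [exists i : V, (i == k :> nat) && merging lb rho co s s2 i].
Definition dprof r : prof := [ffun i => inord (dig M mbn r (i : V))].

Lemma mbnE (i : V) : mbn i = merging lb rho co s s2 i.
Proof.
apply/existsP/idP => [[j /andP[/eqP/val_inj-> //]]|h].
by exists i; rewrite eqxx.
Qed.

Lemma cnt_mbn : cnt mbn n = #|[set i | merging lb rho co s s2 i]|.
Proof.
rewrite /cnt -sum1_count -val_enum_ord big_map big_enum_cond /= cardsE -sum1_card.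
by apply: eq_bigl => i; rewrite mbnE.
Qed.

Lemma dprofE r i : dprof r i = dig M mbn r i :> nat.
Proof. by rewrite ffunE inordK // ltnS dig_le. Qed.

Lemma dprof_supp r i : (dprof r i != ord0) = merging lb rho co s s2 i.
Proof. by rewrite -[_ == _]val_eqE /= dprofE dig_eq0 negbK mbnE. Qed.

Lemma pc_lt d : pc d < N ^ n.
Proof. by apply: pcode_lt => i; apply: ltn_ord. Qed.

Lemma pc_inj d d' : (pc d == pc d') = (d == d').
Proof.
apply/eqP/eqP => [e|-> //]; apply/ffunP => i; apply: val_inj.
by apply: (pcode_inj _ _ e) => j; apply: ltn_ord.
Qed.

Lemma pc_part c (d : prof) : pc (part co c d) = \sum_(i < n | co i == c) d i * N ^ i.
Proof.
rewrite /pc /pcode [RHS]big_mkcond; apply: eq_bigr => i _.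
by rewrite ffunE; case: ifP.
Qed.

(** Justifies the address arithmetic of [c_target]: two digits are removed from the code and the
    digit of the union is added at [s]. *)
Lemma pc_merge (d : prof) :
  \sum_(i < n) d i * N ^ i - d s * N ^ s - d s2 * N ^ s2
    + enc (dec (d s) :|: dec (d s2)) * N ^ s = pc (merge_prof s s2 d).
Proof.
rewrite /pc /pcode (bigD1 s) //= addKn (bigD1 s2) 1?eq_sym //= addKn.
rewrite [RHS](bigD1 s) //= [X in _ = _ + X](bigD1 s2) 1?eq_sym //=.
rewrite !ffunE eqxx [s2 == s]eq_sym (negbTE ss2) eqxx mul0n add0n addnC.
congr (_ + _); apply: eq_bigr => i /andP[/negbTE h1 /negbTE h2].
by rewrite ffunE h1 h2.
Qed.

Lemma base_gt1 : 1 < base.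
Proof.
have [r1 c1] := co_fix cok rs; have [h1 h2] := ge_lo r1 c1.
have n0 : 0 < n by apply: leq_ltn_trans (ltn_ord s).
have : 1 < N ^ n by rewrite -{1}(expn0 N) ltn_exp2l.
lia.
Qed.

Definition table_ok (st : state A) :=
  forall c d, rho c = c -> co c = c ->
    (forall i, (d i != ord0) = (rho i == i) && (co i == c)) ->
    consistent rho d -> amem st (ge c + pc d) = psum rho d.

Definition leaf_frame := [:: vI; vBad; aAcc; vTgt; vCarry; aT; aV; vRun].

Definition stage_data st := [/\ static st, get st vS 0 = s, get st vS2 0 = s2,
  get st vBase 0 = base & [/\ alive_labels st rho, (forall i, get st aCo i = co i),
  (forall i, get st aGe i = ge i), (forall i, get st aMk i = mk i) &
  (forall t t', t < N -> t' < N -> get st aWP (N * t + t') = un t t' * N ^ s)]].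

Lemma stage_data_frame st0 st :
  frame leaf_frame st0 st -> stage_data st0 -> stage_data st.
Proof.
move=> F [h1 h2 h3 h4 [h5 h6 h7 h8 h9]]; split; rewrite ?F //.
  exact: static_frame F h1.
split=> [i j ri rj|i|i|i|t t' tN tN']; rewrite F //; first exact: h5.
exact: h9.
Qed.

(** One profile adds its sum to the cell of its target. The claim is restricted to consistent
    targets: only then does passing the test make the profile consistent, hence the table entries
    reliable. *)
Lemma wp_leaf st0 r : stage_data st0 -> table_ok st0 ->
  (forall i, get st0 aT i = dig M mbn r i) ->
  (forall i, get st0 aV i = dig M mbn r i * N ^ i) ->
  wp n.+1 c_leaf (fun st => [/\ frame leaf_frame st0 st,
    get st vRun 0 = ~~ (M ^ cnt mbn n %| r.+1),
    (forall i, get st aT i = dig M mbn r.+1 i),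
    (forall i, get st aV i = dig M mbn r.+1 i * N ^ i) &
    [/\ forall x, x < base -> x != 1 -> amem st x = amem st0 x,
        forall x, base + N ^ n <= x -> amem st x = amem st0 x &
        forall d', consistent rho' d' -> amem st (base + pc d') =
          (amem st0 (base + pc d') +
           if merge_prof s s2 (dprof r) == d' then psum rho (dprof r) else 0)%R]]) st0.
Proof.
move=> sd0 tab gt gv; have [[N0 pw row blk ct] gs gs2 gb [lab gco gge gmk gwp]] := sd0.
set d := dprof r; have supp i := dprof_supp r i; rewrite -/d in supp.
have gt0 i : get st0 aT i = d i by rewrite gt dprofE.
have b1 := base_gt1.
apply: wp_seq; apply: (wp_mono (leqnn _)); last first.
  exact: (wp_check N0 row lab ct rs rs2 gs gs2 gt0 supp).
move=> st1 [F1 [am1 bad1]].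
apply: wp_seq; apply: (wp_mono (leqnn _)); last first.
  by apply: (@wp_acc st1 co ge (fun i => d i * N ^ i));
     [rewrite F1 | move=> i; rewrite F1 ..]; rewrite // gv dprofE.
move=> st2 [F2 [am2 acc2]].
have mkfix c : mk c -> rho c = c /\ co c = c.
  by case/existsP=> i /and3P[/eqP ri /eqP <- _]; apply: (co_fix cok).
have acc2' c : get st2 aAcc c = ge c + pc (part co c d) by rewrite acc2 pc_part.
have lo c : mk c -> 1 < ge c + pc (part co c d) < base.
  move=> /mkfix[r1 c1]; have [h1 h2] := ge_lo r1 c1.
  have := pc_lt (part co c d).
  have n0 : 0 < n by apply: leq_ltn_trans (ltn_ord s).
  have : 1 < N ^ n by rewrite -{1}(expn0 N) ltn_exp2l.
  lia.
apply: wp_seq; apply: (wp_mono (leqnn _)); last first.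
  apply: (@wp_prod (consistent rho d) st2 (fun k => psum rho (cut co k d)) mk _ _ _ acc2').
  - by rewrite F2 // F1.
  - by move=> i; rewrite F2 // F1.
  - by move=> i /lo /andP[]; case: (_ + _) => [|[]].
  - by move=> _; apply: psum_cut0.
  - move=> c cons; case: ifP => mc; last by rewrite (cutS_unmarked supp) ?(negbT mc).
    have [r1 c1] := mkfix c mc.
    rewrite (psum_cutS _ q_comm cok supp) // am2 am1 tab //; last exact: consistent_part.
    by move=> i; apply: (part_supp supp).
move=> st3 [F3 [am3 prod3]].
have F13 : frame leaf_frame st0 st3.
  move=> b k nb; rewrite F3; last by move: nb; case: (b).
  rewrite F2; last by move: nb; case: (b).
  by rewrite F1 //; move: nb; case: (b).
apply: wp_seq; apply: (wp_mono (leqnn _)); last first.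
  apply: (@wp_target st3 (fun i => d i * N ^ i) s s2).
  - by rewrite F13.
  - by move=> i; rewrite F3 // F2 // F1 // gv dprofE.
  - by rewrite F13.
  - by rewrite F13.
move=> st4 [F4 [am4 tgt4]].
have {}tgt4 : get st4 vTgt 0 = base + pc (merge_prof s s2 d).
  rewrite tgt4 (F3 aT) // (F2 aT) // (F1 aT) // (F3 aT) // (F2 aT) // (F1 aT) // !gt0.
  rewrite (F13 aWP) // gwp ?ltn_ord // unE (F13 vBase) // gb -pc_merge.
  have le1 : d s * N ^ s + d s2 * N ^ s2 <= \sum_(i < n) d i * N ^ i.
    by rewrite (bigD1 s) //= leq_add2l (bigD1 s2) 1?eq_sym //= leq_addr.
  by lia.
have F14 : frame leaf_frame st0 st4.
  move=> b k nb; rewrite F4; last by move: nb; case: (b).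
  exact: F13.
apply: wp_seq; apply: wp_flat => //; rewrite run_if ev_var run_skip run_astore.
set st5 := if _ then _ else _.
have g5 b k : get st5 b k = get st4 b k by rewrite /st5; case: ifP.
have F15 : frame leaf_frame st0 st5 by move=> b k nb; rewrite g5 F14.
have T5 i : get st5 aT i = dig M mbn r i.
  by rewrite g5 F4 // F3 // F2 // F1.
have V5 i : get st5 aV i = dig M mbn r i * N ^ i.
  by rewrite g5 F4 // F3 // F2 // F1.
apply: (wp_mono (leqnn _)); last first.
  apply: (@wp_next st5 mbn r M_gt0 _ _ T5 V5); first by rewrite F15.
  by move=> i; rewrite F15.
move=> st6 [F6 [am6 run6 T6 V6]]; split=> //.
  move=> b k nb; rewrite F6; last by move: nb; case: (b).
  exact: F15.
have bad4 : (get st4 vBad 0 == 0) = admissible lb cp dec rho co s s2 d.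
  by rewrite F4 // F3 // F2 // bad1.
have am5 x : x != 1 -> amem st5 x =
   if admissible lb cp dec rho co s s2 d && (x == base + pc (merge_prof s s2 d))
   then (amem st0 x + amem st3 1)%R else amem st0 x.
  move=> x1; rewrite /st5 bad4; case: ifP => adm.
    by rewrite (negbTE adm) am4 am3 // am2 am1.
  move/negbFE: adm => ->; rewrite amem_seta ev_var tgt4 andTb.
  case: eqP => [->|_]; last by rewrite am4 am3 // am2 am1.
  rewrite -[LHS]/((amem st4 (ev inp st4 (var vTgt)) + amem st4 1)%R).
  by rewrite ev_var tgt4 am4 am3 ?am2 ?am1 //; lia.
rewrite am6; split=> [x xb x1|x xb|d' cons'].
- rewrite am5 //; case: eqP => [e|]; rewrite ?andbF // e in xb *.
  by move: xb; lia.
- rewrite am5; last by have := expn_gt0 N n; lia.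
  case: eqP => [e|]; rewrite ?andbF //; move: xb; rewrite e leq_add2l leqNgt pc_lt //.
rewrite am5; last by lia.
rewrite eqn_add2l pc_inj [d' == _]eq_sym; case: (merge_prof s s2 d =P d') => [e|_].
  rewrite andbT; case: ifP => adm.
    by rewrite prod3 ?cutn //; apply: (admissible_consistent lb_gt0 rs rs2 ss2 supp adm (enc := enc)); rewrite e.
  (* A profile that fails the test is skipped, in agreement with its sum being zero. *)
  by rewrite (not_admissible _ _ rs rs2 supp) ?addr0 // adm.
by rewrite andbF addr0.
Qed.

Lemma wp_leaves st0 : stage_data st0 -> table_ok st0 ->
  (forall i, get st0 aT i = merging lb rho co s s2 i) ->
  (forall i, get st0 aV i = merging lb rho co s s2 i * N ^ i) ->
  (forall x, base <= x -> amem st0 x = 0%R) ->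
  wp (n.+1 * (M ^ cnt mbn n).+1) c_leaves (fun st => [/\ frame leaf_frame st0 st,
    forall x, x < base -> x != 1 -> amem st x = amem st0 x,
    forall x, base + N ^ n <= x -> amem st x = 0%R &
    forall d' : prof, consistent rho' d' ->
      (forall i, (d' i != ord0) =
        (rho' i == i) && (merge_co lb rho co s s2 i == s)) ->
      amem st (base + pc d') = psum rho' d']) st0.
Proof.
move=> sd0 tab gt gv hi; set R := M ^ cnt mbn n.
have R0 : 0 < R by apply: expM_gt0.
apply: wp_seq; apply: wp_flat; rewrite ?muln_gt0 // runE evE.
set st1 := setn _ _ _ _.
have F1 : frame leaf_frame st0 st1 by apply: frame_setn.
pose F r (d' : prof) :=
  (if merge_prof s s2 (dprof r) == d' then psum rho (dprof r) else 0)%R.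
apply: (wp_mono (leqnn _)); last first.
  apply: (@wp_while _ _ _ _ R n.+1 _ _ (fun r st => [/\ frame leaf_frame st0 st,
    get st vRun 0 = (r < R), (forall i, get st aT i = dig M mbn r i),
    (forall i, get st aV i = dig M mbn r i * N ^ i) &
    [/\ forall x, x < base -> x != 1 -> amem st x = amem st0 x,
        forall x, base + N ^ n <= x -> amem st x = 0%R &
        forall d' : prof, consistent rho' d' ->
          amem st (base + pc d') = (\sum_(0 <= r' < r) F r' d')%R]])) => //.
  - split=> //; first by rewrite stE /= R0.
    + by move=> i; rewrite stE /= gt dig0 mbnE.
    + by move=> i; rewrite stE /= gv dig0 mbnE.
    split=> // [x|d' _]; first by move=> h; apply: hi; lia.
    by rewrite big_geq // hi // leq_addr.
  - move=> r st rR [Fr runr Tr Vr [lo hi' acc]]; split; first by rewrite evE runr rR.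
    have sd := stage_data_frame Fr sd0.
    have tab' : table_ok st.
      move=> c d r1 c1 supp cons; rewrite lo; first exact: tab.
        by have := ge_lo r1 c1; have := pc_lt d; lia.
      have n0 : 0 < n by apply: leq_ltn_trans (ltn_ord s).
      have : 1 < N ^ n by rewrite -{1}(expn0 N) ltn_exp2l.
      by have := ge_lo r1 c1; lia.
    apply: (wp_mono (leqnn _)); last exact: (wp_leaf sd tab' Tr Vr).
    move=> st' [F' run' T' V' [lo' hi2 acc']]; split=> //.
    + exact: frame_comp Fr F'.
    + rewrite run' -/R; have [h|h] := ltnP r.+1 R; last first.
        by rewrite (_ : r.+1 = R) ?dvdnn //; apply/eqP; rewrite eqn_leq rR.
      suff -> : (R %| r.+1) = false by [].
      by apply/negP => /dvdn_leq -/(_ isT); rewrite leqNgt h.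
    split=> [x xb x1|x xb|d' cons]; first by rewrite lo' // lo.
      by rewrite hi2 // hi'.
    by rewrite acc' // acc // big_nat_recr.
  - by move=> st [_ runr _ _ _]; rewrite evE runr ltnn.
move=> st [Fr _ _ _ [lo hi' acc]]; split=> // d' cons supp.
rewrite acc // (psum_new _ _ _ decK encK dec0 rs rs2 ss2 cok supp) big_mkord.
rewrite /R /F.
have := @big_dig M mbn M_gt0 A n (fun d =>
  (if merge_prof s s2 d == d' then psum rho d else 0)%R) => ->.
apply: eq_bigl => d; apply: eq_forallb => i; by rewrite mbnE.
Qed.

End Leaves.

(** [k] merges have been done. The cells from [base] on are still zero, so that the next table can
    be accumulated there. *)
Record stage_inv (k : nat) (rho co : V -> V) (ge : V -> nat) (base : nat)
    (st : state A) : Prop := StageInv {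
  si_static : static st;
  si_ptr : get st vPtr 0 = 1 + n * n + n * k.+1;
  si_base : get st vBase 0 = base;
  si_al : forall i, get st aAl i = (rho i == i);
  si_lab : alive_labels st rho;
  si_co : forall i, get st aCo i = co i;
  si_ge : forall i, get st aGe i = ge i;
  si_cok : comp_ok lb rho co;
  si_lo : forall c, rho c = c -> co c = c -> N ^ n <= ge c /\ ge c + N ^ n <= base;
  si_am0 : amem st 0 = 0%R;
  si_hi : forall x, base <= x -> amem st x = 0%R;
  si_tab : table_ok rho co ge st
}.

Lemma wp_stage k rho co ge base st0 (s s2 : V) c :
  stage_inv k rho co ge base st0 -> rho s = s -> rho s2 = s2 -> s != s2 ->
  (forall i, inp (1 + n * n + n * k.+1 + i) = merge_rep rho s s2 i) ->
  #|[set j | connect (eadj lb (merge_rep rho s s2)) s j]| <= c ->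
  wp (n.+1 * (M ^ c.+1).+1) c_stage (fun st => get st vK 0 = get st0 vK 0 /\
    exists co' ge' base', stage_inv k.+1 (merge_rep rho s s2) co' ge' base' st) st0.
Proof.
move=> [sta ptr gb al lab gco gge cok lo am0 hi tab] rs rs2 ss2 tape card.
have [N0 pw row blk ct] := sta.
set m := _ * _; have le_m : n.+1 <= m by rewrite leq_pmulr.
have m0 : 0 < m by apply: leq_trans le_m.
set rho' := merge_rep rho s s2.
apply: wp_seq; apply: (wp_mono le_m); last first.
  by apply: (@wp_find st0 rho s s2) => // i; rewrite ptr tape.
move=> st1 [F1 [am1 gs gs2]].
apply: wp_seq; apply: (wp_mono le_m); last by apply: wp_clear; rewrite F1.
move=> st2 [F2 [am2 mk2]].
apply: wp_seq; apply: (wp_mono le_m); last first.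
  apply: (@wp_mark st2 rho co s s2) => //; try by rewrite F2 // F1.
  - by move=> i; rewrite F2 // F1.
  - by move=> i j ri rj; rewrite F2 // F1 // lab.
  - by move=> i; rewrite F2 // F1.
  - by move=> i; rewrite F2 // F1.
move=> st3 [F3 [am3 mk3]].
have F03 : frame [:: vI; vS; vS2; aMk] st0 st3.
  move=> b j nb; rewrite F3; last by move: nb; case: (b).
  by rewrite F2 ?F1 //; move: nb; case: (b).
apply: wp_seq; apply: (wp_mono le_m); last first.
  apply: (@wp_start st3 (merging lb rho co s s2)).
  - by rewrite F03.
  - by move=> i; rewrite F03.
  - move=> i; rewrite (F03 aAl) // al (F03 aCo) // gco mk3 /merging.
    by case: (rho i == i); case: (marked _ _ _ _ _ _).
move=> st4 [F4 [am4 T4]].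
apply: wp_seq; apply: (wp_mono (leqnn _)); last exact: wp_shift.
move=> st5 [F5 [am5 wp5]].
have F05 : frame [:: vI; vS; vS2; aMk; aT; aV; aWP] st0 st5.
  move=> b j nb; rewrite F5; last by move: nb; case: (b).
  by rewrite F4 ?F03 //; move: nb; case: (b).
have gs5 : get st5 vS 0 = s by rewrite F5 // F4 // F3 // F2.
have gs25 : get st5 vS2 0 = s2 by rewrite F5 // F4 // F3 // F2.
have sd : stage_data rho co ge base s s2 st5.
  split=> //; [exact: static_frame F05 sta | by rewrite F05 |].
  split=> [i j ri rj|i|i|i|t t' tN tN'].
  - by rewrite F05 // lab.
  - by rewrite F05.
  - by rewrite F05.
  - by rewrite F5 // F4 // mk3.
  by rewrite wp5 // (F4 vS) // (F3 vS) // (F2 vS) // gs (F4 aPw) // F03 // pw.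
have am05 : amem st5 = amem st0 by rewrite am5 am4 am3 am2 am1.
apply: wp_seq; apply: (wp_mono _); last first.
- apply: (wp_leaves rs rs2 ss2 cok lo sd).
  + by move=> a d *; rewrite am05; apply: tab.
  + by move=> i; rewrite F5 //; have [] := T4 i.
  + by move=> i; rewrite F5 //; have [] := T4 i.
  + by move=> x xb; rewrite am05 hi.
- move=> st6 [F6 lo6 hi6 tab6].
  have F06 : frame [:: vI; vS; vS2; aMk; aT; aV; aWP; vBad; aAcc; vTgt; vCarry; vRun] st0 st6.
    move=> b j nb; rewrite F6 ?F05 //; by move: nb; case: (b).
  (* The raw contents, stale entries included, since the two update loops act on the whole matrix;
     the meaning of the live entries is restored afterwards. *)
  pose L i j := get st6 aL (i * n + j).
  apply: wp_seq; apply: (wp_mono le_m); last first.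
    apply: (@wp_rows st6 L s s2) => //; first by rewrite F06.
    - by move=> i; rewrite F06.
    - by rewrite F6.
    - by rewrite F6.
  move=> st7 [F7 [am7 lab7]].
  apply: wp_seq; apply: (wp_mono le_m); last first.
    apply: (@wp_cols st7 (row_merge s s2 L) s s2) => //.
    - by rewrite F7 // F06.
    - by move=> i; rewrite F7 // F06.
    - by rewrite F7 // F6.
    - by rewrite F7 // F6.
  move=> st8 [F8 [am8 lab8]].
  apply: wp_seq; apply: (wp_mono le_m); last first.
    apply: (@wp_comps st8 co (marked lb rho co s s2) s).
    - by rewrite F8 // F7 // F06.
    - by move=> i; rewrite F8 // F7 // F06.
    - by move=> i; rewrite F8 // F7 // F6 // F5 // F4.
    - by rewrite F8 // F7 // F6.
  move=> st9 [F9 [am9 co9]].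
  have F09 : frame [:: vI; vS; vS2; aMk; aT; aV; aWP; vBad; aAcc; vTgt; vCarry; vRun; aL; aCo] st0 st9.
    move=> b j nb; rewrite F9; last by move: nb; case: (b).
    rewrite F8; last by move: nb; case: (b).
    by rewrite F7 ?F06 //; move: nb; case: (b).
  have gs9 : get st9 vS 0 = s by rewrite F9 // F8 // F7 // F6.
  have gs29 : get st9 vS2 0 = s2 by rewrite F9 // F8 // F7 // F6.
  have am69 : amem st9 = amem st6 by rewrite am9 am8 am7.
  apply: wp_flat => //; rewrite !runE !evE !stE /= gs9 gs29.
  rewrite !(F09 vBase) // !(F09 vBlk) // !(F09 vPtr) // !(F09 vN) // gb blk ptr N0.
  set st10 := setn _ _ _ _.
  have G10 b (x : nat) : ~~ has (eqarr b) [:: aAl; aGe; vBase; vPtr] ->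
      get st10 b x = get st9 b x.
    by case: b => // _; rewrite !stE.
  split; first by rewrite F09.
  (* The joined component is named [s] and owns the block just filled; every other component keeps
     its block. *)
  exists (merge_co lb rho co s s2), (fun i => if i == s then base else ge i), (base + N ^ n).
  have cok' := comp_ok_merge lb_gt0 rs rs2 ss2 cok.
  have old c0 : rho' c0 = c0 -> merge_co lb rho co s s2 c0 = c0 -> c0 != s ->
      rho c0 = c0 /\ co c0 = c0.
    move=> /eqP; rewrite merge_rep_fix // => /andP[/eqP r0 _] c1 ne; split=> //.
    have := merge_co_unmarked (co := co) (i := c0) (s := s) (s2 := s2) (lb := lb) (rho := rho).
    by rewrite c1 => /(_ ne) nm; move: c1; rewrite /merge_co (negbTE nm).
  have n0 : 0 < n by apply: leq_ltn_trans (ltn_ord s).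
  have N1 : 1 < N ^ n by rewrite -{1}(expn0 N) ltn_exp2l.
  have [r1 c1] := co_fix cok rs; have lo1 := lo _ r1 c1.
  split=> //.
  + have F010 : frame [:: vI; vS; vS2; aMk; aT; aV; aWP; vBad; aAcc; vTgt; vCarry;
      vRun; aL; aCo; aAl; aGe; vBase; vPtr] st0 st10.
      move=> b j nb; rewrite G10; last by move: nb; case: (b).
      by rewrite F09 //; move: nb; case: (b).
    exact: static_frame F010 sta.
  + by rewrite !stE /=; lia.
  + move=> i; rewrite !stE /= F09 // al merge_rep_fix // val_eqE.
    by case: (i =P s2) => _; rewrite ?andbF ?andbT.
  + move=> i j ri rj; rewrite G10 // F9 // lab8 hlab_merge //.
    have [/eqP ri1 _] : rho i == i /\ i != s2.
      by move/eqP: ri; rewrite merge_rep_fix // => /andP[].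
    have [/eqP rj1 _] : rho j == j /\ j != s2.
      by move/eqP: rj; rewrite merge_rep_fix // => /andP[].
    have LE a b : rho a = a -> rho b = b -> L a b = hl rho a b.
      by move=> ra rb; rewrite /L F06 // lab.
    by rewrite /col_merge /row_merge !LE.
  + by move=> i; rewrite G10 // co9.
  + by move=> i; rewrite !stE /= F09 // gge val_eqE; case: eqP.
  + move=> c0 r0 e0; case: (eqVneq c0 s) => [_|ne]; first by lia.
    have [h1 h2] := old c0 r0 e0 ne; have := lo _ h1 h2; lia.
  + by rewrite !stE am69 lo6 ?am05 //; lia.
  + by move=> x xb; rewrite !stE am69 hi6.
  move=> c0 d r0 e0 supp cons; rewrite !stE am69.
  case: eqP => [e|/eqP ne]; first by apply: tab6 => // i; rewrite supp e.
  have [h1 h2] := old c0 r0 e0 ne; have lo0 := lo _ h1 h2.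
  have [cons0 d1 d2 supp0] := consistent_old lb_gt0 rs rs2 ss2 cok ne e0 supp cons.
  rewrite lo6 ?am05 ?psum_old //; first exact: tab.
    by have := pc_lt d; lia.
  by lia.
(* The number of profiles is [M] to the number of joined parts, at most [c.+1]. *)
- rewrite leq_mul2l /= ltnS leq_pexp2l // cnt_mbn.
  by apply: leq_trans (card_merging lb_gt0 rs rs2 ss2 cok) _; rewrite ltnS.
Qed.

(** * Initial tables and final output *)

Lemma wp_query m addr b len tgt Q st x t : 0 < m ->
  ev inp st len = 1 -> query [:: nmem st (ev inp st b)] (ev inp st tgt) = Some (x, t) ->
  t <= C -> Q (seta st (ev inp st addr) x) -> wp m (Query addr b len tgt) Q st.
Proof.
move=> m0 l1 qe tC Qs; exists (seta st (ev inp st addr) x).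
eexists; split; last exact: Qs.
  by apply: ExecQuery; rewrite -/(ev inp st len) l1 /= addn0; apply: qe.
rewrite -/(ev inp st len) l1; apply: leq_trans (leq_pmulr _ m0).
by rewrite /= ; lia.
Qed.

Hypothesis n_gt0 : 0 < n.
Hypothesis sgE : sg = [seq (nat_of_ord (enum_rank a), nat_of_ord (enc [set a])) | a <- enum U].
Hypothesis query_ok : forall (i : V) a,
  exists2 t, query [:: nat_of_ord i] (enum_rank a) = Some (q i a, t) & t <= C.

Definition single (i : V) (t : 'I_M.+1) : prof := [ffun j => if j == i then t else ord0].

Lemma pc_single i t : pc (single i t) = t * N ^ i.
Proof.
rewrite /pc /pcode (bigD1 i) //= ffunE eqxx big1 ?addn0 // => j /negbTE ne.
by rewrite ffunE ne.
Qed.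

Lemma singleP i (d : prof) : (forall j, (d j != ord0) = (j == i)) -> d = single i (d i).
Proof.
move=> supp; apply/ffunP => j; rewrite ffunE; case: eqP => [->//|/eqP ne].
by apply/eqP; rewrite -[_ == _]negbK supp.
Qed.

Definition qaddr i a := N ^ n + pc (single i (enc [set a])).

Lemma qaddr_inj i j a b : qaddr i a = qaddr j b -> i = j /\ a = b.
Proof.
move/eqP; rewrite eqn_add2l pc_inj => /eqP /ffunP e.
have e0 c : (enc [set c] == ord0) = false.
  by rewrite (enc_eq0 decK encK dec0) -subset0 sub1set inE.
have := e i; rewrite !ffunE eqxx; case: eqP => [->|_ /eqP]; last by rewrite e0.
by move/(can_inj encK)/set1_inj.
Qed.

Lemma wp_queries i st0 : get st0 vI 0 = i -> get st0 vBlk 0 = N ^ n ->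
  get st0 aPw i = N ^ i ->
  wp 1 c_queries (fun st => [/\ nmem st = nmem st0,
     forall a, amem st (qaddr i a) = q i a &
     forall x, (forall a, x != qaddr i a) -> amem st x = amem st0 x]) st0.
Proof.
move=> gi gb gp; rewrite /c_queries sgE -map_comp.
suff gen l st : nmem st = nmem st0 -> wp 1 (seqs [seq Query
    (NAdd (var vBlk) (nmulC (enc [set a]) (rd aPw vi))) (NConst (code vI)) one
    (NConst (enum_rank a)) | a <- l]) (fun st' => [/\ nmem st' = nmem st0,
     forall a, a \in l -> amem st' (qaddr i a) = q i a &
     forall x, (forall a, a \in l -> x != qaddr i a) -> amem st' x = amem st x]) st.
  apply: (wp_mono (leqnn _)) (gen (enum U) st0 erefl) => st [h1 h2 h3]; split=> // [a|x hx].
    by apply: h2; rewrite mem_enum.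
  by apply: h3.
elim: l st => [|a l IH] st e; first by apply: wp_flat.
have g b (k : nat) : get st b k = get st0 b k by rewrite /get e.
have [t qt tC] := query_ok i a.
apply: wp_seq; apply: (@wp_query _ _ _ _ _ _ _ (q i a) t) => //.
  by rewrite evE -[nmem st _]/(get st vI 0) g gi evE.
rewrite !evE !g gi gp gb -pc_single -/(qaddr i a).
have := IH (seta st (qaddr i a) (q i a)) e.
apply: (wp_mono (leqnn _)) => st' [h1 h2 h3]; split=> //.
- move=> b; rewrite inE => /orP[/eqP->|/h2 //].
  have [al|al] := boolP (a \in l); first exact: h2.
  rewrite h3 ?amem_seta ?eqxx // => c cl; apply/eqP => /qaddr_inj[_ ac].
  by rewrite ac cl in al.
- move=> x hx; rewrite h3; last by move=> b bl; apply: hx; rewrite inE bl orbT.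
  by rewrite amem_seta (negbTE (hx a _)) // mem_head.
Qed.

Lemma wp_single st0 : get st0 vN 0 = n -> get st0 vBlk 0 = N ^ n ->
  (forall i, get st0 aPw i = N ^ i) -> amem st0 = (fun _ => 0%R) ->
  wp n.+1 c_single (fun st => frame [:: vI; aAl; aCo; aGe] st0 st /\
    [/\ forall i, [/\ get st aAl i = 1, get st aCo i = i & get st aGe i = N ^ n],
        forall i a, amem st (qaddr i a) = q i a &
        forall x, (forall i a, x != qaddr i a) -> amem st x = 0%R]) st0.
Proof.
move=> N0 gb pw am0; rewrite -[n.+1]mul1n; apply: (wp_mono (leqnn _)); last first.
  apply: (@wp_for _ _ _ _ n 1 _ _ _ (fun k st => frame [:: vI; aAl; aCo; aGe] st0 st /\
    [/\ forall i, i < k -> [/\ get st aAl i = 1, get st aCo i = i & get st aGe i = N ^ n],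
        forall i a, i < k -> amem st (qaddr i a) = q i a &
        forall x, (forall i a, i < k -> x != qaddr i a) -> amem st x = 0%R])) => //.
  - by split; [apply: frame_setn | split=> // x _; rewrite am0].
  - by move=> k st _ [F _]; rewrite evE F.
  move=> k st kn gk [F [h1 h2 h3]]; pose i := Ordinal kn.
  apply: wp_seq; apply: wp_flat => //; apply: wp_seq; apply: wp_flat => //.
  apply: wp_seq; apply: wp_flat => //; rewrite !runE !evE !stE /= ?gk ?stE /= ?gk (F vBlk) // gb.
  set st1 := setn (setn _ _ _ _) _ _ _.
  have F1 : frame [:: vI; aAl; aCo; aGe] st0 st1 by do 3! [apply: frame_setn => //].
  apply: (wp_mono (leqnn _)); last first.
    apply: (@wp_queries i); [by rewrite !stE /= gk | by rewrite F1 | by rewrite F1].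
  move=> st2 [n2 q2 o2]; have g2 b (x : nat) : get st2 b x = get st1 b x by rewrite /get n2.
  have ltS (j : V) : (j < k.+1)%N = (j == i) || (j < k)%N by rewrite ltnS leq_eqVlt -val_eqE.
  split; first by rewrite g2 !stE /= gk.
  split; first by apply: frame_setn => // b x nb; rewrite g2 F1.
  split=> [j|j a|x hx].
  - rewrite ltS !stE /= !g2 !stE /= => /orP[/eqP->|jk]; first by rewrite eqxx.
    by rewrite (ltn_eqF jk); apply: h1.
  - rewrite ltS => /orP[/eqP->|jk]; first exact: q2.
    rewrite -[LHS]/(amem st2 (qaddr j a)) o2; first exact: h2.
    by move=> b; apply/eqP => /qaddr_inj[e _]; rewrite e /= ltnn in jk.
  rewrite -[LHS]/(amem st2 x) o2; last by move=> a; apply: (hx i); rewrite /= ltnSn.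
  by apply: h3 => j a jk; apply: hx; apply: ltnW.
move=> st [F [h1 h2 h3]]; split=> //; split=> [i|i a|x hx]; [exact: h1 | exact: h2|].
by apply: h3 => i a _.
Qed.

(** The image of a single vertex is a singleton. Consistency of [(i, i)] supplies the condition
    imposed by the loop label [lb i i]. *)
Lemma psum_single i (t : 'I_M.+1) : t != ord0 -> consistent id (single i t) ->
  (forall a, t = enc [set a] -> psum id (single i t) = q i a) /\
  ((forall a, t != enc [set a]) -> psum id (single i t) = 0%R).
Proof.
move=> t0 /consistentP cons.
have supp v : (single i t v != ord0) = (v == i) && (t != ord0).
  by rewrite ffunE; case: (v == i); rewrite ?eqxx.
have imi (f : {ffun V -> U}) v : im id f v = [set f v].
  apply/setP=> b; rewrite inE; apply/imP/eqP => [[w /= -> //]|->].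
  by exists v.
split=> [a ta|nt].
  rewrite /psum (big_pred1 [ffun v => if v == i then a else a0]).
    rewrite /wt (big_pred1 i) ?ffunE ?eqxx // => v.
    by rewrite /= supp t0 andbT.
  move=> f; apply/realizesP/eqP => [[k1 k2 k3]|->].
    apply/ffunP => v; rewrite ffunE; case: eqP => [->|/eqP ne]; last first.
      by apply: k1; apply/eqP; rewrite -[_ == _]negbK supp (negbTE ne).
    have := k3 i; rewrite supp eqxx t0 imi ffunE eqxx ta encK => /(_ isT).
    exact: set1_inj.
  split=> [v|v w|v].
  - by rewrite !ffunE; case: eqP => // _ /eqP; rewrite (negbTE t0).
  - rewrite !supp => /andP[/eqP-> _] /andP[/eqP-> _]; rewrite !ffunE eqxx.
    have := cons i i; rewrite !supp eqxx t0 => /(_ isT isT).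
    rewrite /fits hlab_eq0 // !ffunE eqxx ta encK => /orP[|].
      by case/existsP=> v' /existsP[w' /and3P[/eqP-> /eqP->]]; rewrite eqxx.
    move/compatP/(_ a a); rewrite !inE eqxx => /(_ isT isT).
    rewrite /hlab; case: ifP => //.
    by case/existsP=> v' /existsP[w' /and3P[/eqP-> /eqP->]]; rewrite eqxx.
  - by rewrite supp => /andP[/eqP-> _]; rewrite imi !ffunE eqxx ta encK.
rewrite /psum big_pred0 // => f; apply/negP => /realizesP[_ _ /(_ i)].
rewrite supp eqxx t0 imi ffunE eqxx => /(_ isT) e.
by have := nt (f i); rewrite e decK eqxx.
Qed.

Hypothesis tape_n : inp 0 = n.
Hypothesis tape_lab : forall i j, inp (1 + (i * n + j)) + 1 = lb i j.

Lemma wp_pow st0 : get st0 vN 0 = n ->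
  wp n.+1 c_pow (fun st => frame [:: vI; vW; aPw] st0 st /\
    [/\ amem st = amem st0, get st vW 0 = N ^ n & forall i, get st aPw i = N ^ i]) st0.
Proof.
move=> N0; apply: wp_seq; apply: wp_flat => //; rewrite runE evE.
set st1 := setn _ _ _ _; apply: (wp_mono (leqnn _)); last first.
  apply: (@wp_for_i [:: vI; vW; aPw] _ (fun k st => [/\ amem st = amem st0,
    get st vW 0 = N ^ k & forall i, i < k -> get st aPw i = N ^ i])) => //.
    by move=> k st x [am h1 h2]; split=> // i /h2; rewrite !stE.
  move=> i st [am h1 h2] F gi; rewrite !runE !evE gi h1 !stE /=.
  split=> //; first by do 2! [apply: frame_setn => //].
  split=> //; first by rewrite h1 expnS.
  move=> j; rewrite !stE /= ltnS leq_eqVlt => /orP[/eqP/val_inj->|ji].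
    by rewrite eqxx.
  by rewrite (ltn_eqF ji) h2.
move=> st [F [am h1 h2]]; split; first by apply: frame_comp F; apply: frame_setn.
by split=> // i; apply: h2.
Qed.

Lemma wp_row st0 : get st0 vN 0 = n ->
  wp n.+1 c_row (fun st => frame [:: vI; vW; aRow] st0 st /\
    [/\ amem st = amem st0, get st vW 0 = n * n & rows_ok st]) st0.
Proof.
move=> N0; apply: wp_seq; apply: wp_flat => //; rewrite runE evE.
set st1 := setn _ _ _ _; apply: (wp_mono (leqnn _)); last first.
  apply: (@wp_for_i [:: vI; vW; aRow] _ (fun k st => [/\ amem st = amem st0,
    get st vW 0 = k * n & forall i, i < k -> get st aRow i = i * n])) => //.
    by move=> k st x [am h1 h2]; split=> // i /h2; rewrite !stE.
  move=> i st [am h1 h2] F gi; rewrite !runE !evE gi h1 !stE /=.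
  split=> //; first by do 2! [apply: frame_setn => //].
  split=> //; first by rewrite h1 (F vN) // stE /= N0 mulSnr.
  move=> j; rewrite !stE /= ltnS leq_eqVlt => /orP[/eqP/val_inj->|ji].
    by rewrite eqxx.
  by rewrite (ltn_eqF ji) h2.
move=> st [F [am h1 h2]]; split; first by apply: frame_comp F; apply: frame_setn.
by split=> // i; apply: h2.
Qed.

Lemma wp_lab st0 : get st0 vW 0 = n * n ->
  wp (n * n).+1 c_lab (fun st => frame [:: vI; aL] st0 st /\
    (amem st = amem st0 /\ labels_ok st lb)) st0.
Proof.
move=> gw; apply: (wp_mono (leqnn _)); last first.
  apply: (@wp_for_flat _ _ _ _ (n * n) _ _ _ (fun k st =>
    frame [:: vI; aL] st0 st /\ (amem st = amem st0 /\
    forall x, x < k -> get st aL x = inp (1 + x) + 1))) => //.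
  - by split=> //; apply: frame_setn.
  - by move=> k st _ [F _]; rewrite evE F.
  move=> k st kn gk [F [am h]]; rewrite !runE !evE gk !stE /= gk; split=> //.
  split; first by do 2! [apply: frame_setn => //].
  split=> // x; rewrite !stE /= ltnS leq_eqVlt => /orP[/eqP->|xk].
    by rewrite eqxx.
  by rewrite (ltn_eqF xk) h.
move=> st [F [am h]]; split=> //; split=> // i j; rewrite h ?tape_lab //.
by have := ltn_ord i; have := ltn_ord j; nia.
Qed.

Lemma hlab_id i j : hl id i j = lb i j.
Proof.
rewrite /hlab; case: ifP => // /existsP[v /existsP[w /and3P[/eqP-> /eqP->]]].
by rewrite eqxx.
Qed.

Lemma wp_init : wp (n.+1 * n.+1) c_init
  (stage_inv 0 id id (fun _ => N ^ n) (N ^ n + N ^ n)) (init_state A).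
Proof.
set m := n.+1 * n.+1; have m0 : 0 < m by [].
have mn : n.+1 <= m by rewrite leq_pmulr.
have mnn : (n * n).+1 <= m by rewrite /m mulSn; nia.
apply: wp_seq; apply: wp_flat => //; rewrite runE !evE tape_n.
set st0 := setn _ _ _ _.
apply: wp_seq; apply: wp_flat => //; first exact: flat_seqs.
have [|t1 t2 t3] := @run_stores A inp aCT (fun k : nat =>
  NConst (bad (k %/ N %/ N) (k %/ N %% N) (k %% N))) (LM.+1 * N * N) st0.
  by [].
set st1 := run _ _ in t1 t2 t3 *.
have F1 : frame [:: aCT] st0 st1 by move=> b k /=; rewrite orbF; apply: t2.
have ct1 : ct_ok st1.
  move=> l t t' lL tN tN'; rewrite t1.
    have dv x y : y < N -> (N * x + y) %/ N = x.
      by move=> yN; rewrite mulnC divnMDl // divn_small // addn0.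
    have md x y : y < N -> (N * x + y) %% N = y.
      by move=> yN; rewrite mulnC modnMDl modn_small.
    by rewrite evE dv // dv // !md.
  apply: leq_trans (_ : (N * l + t).+1 * N <= _); first by rewrite mulSn; lia.
  rewrite leq_mul2r -[LM.+1 * N]mulnC /=; apply: leq_trans (_ : N * l.+1 <= _).
    by rewrite mulnS; lia.
  by rewrite leq_mul2l ltnS lL orbT.
have N1 : get st1 vN 0 = n by rewrite F1 // stE.
apply: wp_seq; apply: (wp_mono mn); last exact: wp_pow.
move=> st2 [F2 [am2 w2 pw2]].
apply: wp_seq; apply: wp_flat => //; rewrite runE evE w2.
set st3 := setn _ _ _ _.
have F3 : frame [:: vBlk] st2 st3 by apply: frame_setn.
apply: wp_seq; apply: (wp_mono mn); last by apply: wp_row; rewrite F3 // F2.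
move=> st4 [F4 [am4 w4 row4]].
apply: wp_seq; apply: (wp_mono mnn); last exact: wp_lab.
move=> st5 [F5 [am5 lab5]].
apply: wp_seq; apply: wp_flat => //; rewrite runE !evE !(F5 vW, F5 vN) // w4.
rewrite (F4 vN) // F3 // F2 // N1.
set st6 := setn _ _ _ _.
have F6 : frame [:: vPtr] st5 st6 by apply: frame_setn.
have blk6 : get st6 vBlk 0 = N ^ n by rewrite F6 // F5 // F4 // stE.
have pw6 i : get st6 aPw i = N ^ i by rewrite F6 // F5 // F4 // F3.
have N6 : get st6 vN 0 = n by rewrite F6 // F5 // F4 // F3 // F2.
apply: wp_seq; apply: (wp_mono mn); last first.
  apply: (@wp_single st6) => //.
  by rewrite -[LHS]/(amem st5) am5 am4 -[LHS]/(amem st2) am2 t3.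
move=> st7 [F7 [g7 q7 o7]].
apply: wp_flat => //; rewrite runE evE evE (F7 vBlk) // blk6.
set st8 := setn _ _ _ _.
have F8 : frame [:: vBase] st7 st8 by apply: frame_setn.
have Nn : 0 < N ^ n by rewrite expn_gt0.
have qlt i a : N ^ n <= qaddr i a < N ^ n + N ^ n.
  by rewrite /qaddr leq_addr ltn_add2l pc_lt.
split=> //.
- split.
  + by rewrite F8 // F7.
  + by move=> i; rewrite F8 // F7.
  + by move=> i; rewrite F8 // F7 // F6 // F5.
  + by rewrite F8 // F7.
  + by move=> l t t' *; rewrite F8 // F7 // F6 // F5 // F4 // F3 // F2 // ct1.
- by rewrite F8 // F7 // stE /=; lia.
- by move=> i; rewrite F8 //; have [-> _ _] := g7 i; rewrite eqxx.
- by move=> i j _ _; rewrite F8 // F7 // F6 // lab5 hlab_id.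
- by move=> i; rewrite F8 //; have [_ -> _] := g7 i.
- by move=> i; rewrite F8 //; have [_ _ ->] := g7 i.
- exact: comp_ok_id.
- rewrite -[LHS]/(amem st7 0) o7 // => i a; have := qlt i a; lia.
- move=> x xb; rewrite -[LHS]/(amem st7 x) o7 // => i a; have := qlt i a; lia.
move=> c d _ _ supp cons; rewrite -[LHS]/(amem st7 (N ^ n + pc d)).
have supp' j : (d j != ord0) = (j == c) by rewrite supp eqxx.
have dE := singleP supp'.
have d0 : d c != ord0 by rewrite supp' eqxx.
rewrite dE in cons *; have [p1 p2] := psum_single d0 cons.
(* For a subset that is not a singleton the required sum is 0, and its cell has never been
   written. *)
have [a /eqP ea|ne] := pickP (fun a => d c == enc [set a]).
  by rewrite (p1 a ea) ea -/(qaddr c a) q7.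
rewrite p2 => [|a]; last by rewrite ne.
apply: o7 => i a; rewrite eqn_add2l pc_inj; apply/eqP => /ffunP/(_ c).
rewrite !ffunE eqxx; case: eqP => [_ e|_ e].
  by have := ne a; rewrite e eqxx.
by rewrite e eqxx in d0.
Qed.

(** With a single part, every map has exactly one nonempty image, so summing over images recovers
    all morphisms. *)
Lemma psum_total (i0 : V) (rho : V -> V) : (forall v, rho v = i0) ->
  (\sum_(t : 'I_M.+1 | t != ord0) psum rho (single i0 t) =
   \sum_(f : {ffun V -> U} | [forall v, forall w, cp (lb v w) (f v) (f w)])
      wt q xpredT f)%R.
Proof.
move=> r0; rewrite [RHS](partition_big (fun f => enc (im rho f i0)) (fun t => t != ord0)) /=.
  apply: eq_bigr => t t0; apply: eq_big => f.
    apply/realizesP/andP => [[k1 k2 k3]|[/forallP h /eqP e]].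
      split; last by rewrite k3 ffunE eqxx // decK.
      by apply/forallP => v; apply/forallP => w; apply: k2; rewrite r0 ffunE eqxx.
    split=> [v|v w _ _|i]; rewrite ?r0 ?ffunE ?eqxx.
    - by move=> e0; rewrite e0 eqxx in t0.
    - by have /forallP := h v.
    - by case: (i =P i0) => [-> _|_]; [rewrite -e encK | rewrite eqxx].
  by move=> _; apply: eq_wt => // v; rewrite /= r0 ffunE eqxx t0.
move=> f _; rewrite (enc_eq0 decK encK dec0); apply/set0Pn.
by exists (f i0); apply/imP; exists i0.
Qed.

Lemma run_output (l : seq nat) st : 0 < get st aGe (get st aCo 0) ->
  let st' := run (seqs [seq If (ctab (rdL zero zero) (NConst t) (NConst t)) Skip
   (AStore zero (AAdd (ACell zero) (ACell (NAdd (rd aGe (rd aCo zero)) (NConst t)))))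
    | t <- l]) st in
  amem st' 0 = (amem st 0 + \sum_(t <- l)
     if ev inp st (ctab (rdL zero zero) (NConst t) (NConst t)) != 0%N then 0
     else amem st (get st aGe (get st aCo 0%N) + t)%N)%R.
Proof.
elim: l st => [|t l IH] st g0 /=; first by rewrite run_skip big_nil addr0.
rewrite run_seq run_if big_cons; case: ifP => e; first by rewrite run_skip IH // add0r.
rewrite run_astore ev_const; set x := aeval _ _ _.
have -> : x = (amem st 0 + amem st (get st aGe (get st aCo 0%N) + t)%N)%R.
  by rewrite /x -[LHS]/((amem st 0%N + amem st (ev inp st
     (NAdd (rd aGe (rd aCo zero)) (NConst t))))%R) !evE.
rewrite IH ?get_seta // amem_seta eqxx addrA; congr (_ + _)%R.
apply: eq_bigr => u _; rewrite -[ev _ (seta _ _ _) _]/(ev inp st _).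
(* Cell 0 is overwritten during the sum but lies below the block being read. *)
case: ifP => // _; rewrite amem_seta; case: eqP => //.
by move: g0; case: (get _ _ _).
Qed.

Lemma wp_output m k rho co ge base st0 (i0 : V) : 0 < m -> i0 = 0 :> nat ->
  (forall v, rho v = i0) -> stage_inv k rho co ge base st0 ->
  wp m c_output (fun st => amem st 0 = (\sum_(f : {ffun V -> U} |
     [forall v, forall w, cp (lb v w) (f v) (f w)]) wt q xpredT f)%R) st0.
Proof.
move=> m0 i00 r0 [[N0 pw row blk ct] ptr gb al lab gco gge cok lo am0 hi tab].
apply: wp_flat => //; first exact: flat_seqs.
have ci0 : co i0 = i0.
  by have [h _] := co_fix cok (r0 i0); rewrite r0 in h.
have Nn : 0 < N ^ n by rewrite expn_gt0.
have [lo1 _] := lo i0 (r0 i0) ci0.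
have gco0 : get st0 aCo 0 = 0 by have := gco i0; rewrite ci0 i00.
have gge0 : get st0 aGe 0 = ge i0 by have := gge i0; rewrite i00.
rewrite run_output ?gco0 ?gge0; last by apply: leq_trans lo1.
rewrite am0 add0r -(psum_total r0).
rewrite [RHS]big_mkcond big_ord_recl eqxx /= add0r.
rewrite (_ : iota 1 M = index_iota 1 M.+1); last by rewrite /index_iota subSS subn0.
rewrite big_add1 big_mkord; apply: eq_bigr => t _ /=.
set t1 := lift ord0 t.
have tv : t1 = t.+1 :> nat by [].
have hlE : get st0 aL (get st0 aRow 0 + 0) = hl rho i0 i0.
  have := row i0; rewrite i00 mul0n => ->.
  by have := lab i0 i0 (r0 i0) (r0 i0); rewrite i00.
have t0 : t1 != ord0 by [].
rewrite !evE hlE -tv ct ?hl_le ?ltn_ord // badE eqb0 ?negbK ?t0.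
have supp i : (single i0 t1 i != ord0) = (rho i == i) && (co i == i0).
  rewrite ffunE r0 [i0 == i]eq_sym; case: (i =P i0) => [->|]; rewrite ?eqxx //.
  by rewrite t0 ci0 eqxx.
case: ifP => ft.
  have := @psum_inconsistent A U n M a0 lb cp q dec rho (single i0 t1) i0 i0.
  rewrite !ffunE !eqxx /= => -> //.
    by move: ft; rewrite /fits negb_or => /andP[].
  by move: ft; rewrite /fits negb_or => /andP[].
have cons : consistent rho (single i0 t1).
  apply/consistentP => i j; rewrite !supp !r0 => /andP[/eqP<- _] /andP[/eqP<- _].
  by rewrite !ffunE eqxx; move/negbFE: ft.
have := tab i0 (single i0 t1) (r0 i0) ci0 supp cons.
by rewrite pc_single i00 expn0 muln1 tv.
Qed.

Lemma stage_inv_setK k rho co ge base st x :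
  stage_inv k rho co ge base st -> stage_inv k rho co ge base (setn st vK 0 x).
Proof.
move=> [sta ptr gb al lab gco gge cok lo am0 hi tab].
have F : frame [:: vK] st (setn st vK 0 x) by apply: frame_setn.
split=> //; first exact: static_frame F sta.
- by move=> i; rewrite F.
- by move=> i j ri rj; rewrite F // lab.
- by move=> i; rewrite F.
- by move=> i; rewrite F.
Qed.

(** * The whole run *)

Section Main.

Variables (s1 s2 : nat -> V) (c : nat).

Fixpoint reps k : V -> V :=
  if k is k'.+1 then merge_rep (reps k') (s1 k') (s2 k') else id.

Hypothesis steps : forall k, k < n.-1 ->
  [/\ reps k (s1 k) = s1 k, reps k (s2 k) = s2 k & (s1 k < s2 k)%N].
Hypothesis tape_parts : forall k, k < n.-1 ->
  forall i, inp (1 + n * n + n * k.+1 + i) = reps k.+1 i.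
Hypothesis width : forall k, k < n.-1 ->
  #|[set j | connect (eadj lb (reps k.+1)) (s1 k) j]| <= c.

Lemma s1_neq_s2 k : k < n.-1 -> s1 k != s2 k.
Proof. by case/steps=> _ _; rewrite -val_eqE /= ltn_neqAle => /andP[]. Qed.

(** Vertex 0 is never absorbed, because the smaller representative survives, and each merge removes
    one fixed point; after [n - 1] merges only vertex 0 is left. *)
Lemma reps_total (i0 : V) : i0 = 0 :> nat -> forall v, reps n.-1 v = i0.
Proof.
move=> i00.
have gen k : k <= n.-1 -> [/\ reps k i0 = i0, forall v, reps k (reps k v) = reps k v
    & #|[set i | reps k i == i]| = n - k].
  elim: k => [_|k IH kn].
    split=> //; rewrite (_ : [set _ | _] = setT) ?cardsT ?card_ord ?subn0 //.
    by apply/setP => i; rewrite !inE eqxx.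
  have [h1 h2 h3] := IH (ltnW kn); have [r1 r2 lt] := steps kn.
  have ne := s1_neq_s2 kn; split.
  - rewrite /= /merge_rep h1; case: eqP => // e.
    by move: lt; rewrite -e i00.
  - move=> v /=; have e w : merge_rep (reps k) (s1 k) (s2 k) w =
        merge_rep (reps k) (s1 k) (s2 k) (reps k w) by rewrite /merge_rep h2.
    by rewrite [in RHS]e [X in merge_rep _ _ _ X]e merge_rep_idem.
  - rewrite (_ : [set _ | _] = [set i | reps k i == i] :\ s2 k).
      have := cardsD1 (s2 k) [set i | reps k i == i].
      rewrite inE r2 eqxx h3 /=; have := ltn_ord (s2 k); lia.
    by apply/setP => i; rewrite !inE merge_rep_fix // andbC.
have [h1 h2 h3] := gen _ (leqnn _).
have /cards1P[x ex] : #|[set i | reps n.-1 i == i]| == 1.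
  by rewrite h3; have := ltn_ord i0; lia.
have xE v : reps n.-1 v = v -> v = x.
  by move=> e; apply/set1P; rewrite -ex inE e.
by move=> v; rewrite (xE _ (h2 v)) [RHS]xE.
Qed.

Theorem wp_main :
  wp (n.+1 * (M ^ c.+1).+1 * n.+1) c_main (fun st => amem st 0 =
    (\sum_(f : {ffun V -> U} | [forall v, forall w, cp (lb v w) (f v) (f w)])
       wt q xpredT f)%R) (init_state A).
Proof.
pose i0 := Ordinal n_gt0.
(* The quadratic cost of the initialisation is absorbed by the bound of the stages. *)
apply: wp_seq; apply: wp_mono wp_init; first by rewrite leq_mul2r leq_pmulr ?orbT.
move=> st0 inv0; apply: wp_seq; apply: (wp_mono _); last first.
- apply: (@wp_for _ _ _ _ n.-1 (n.+1 * (M ^ c.+1).+1) _ _ _ (fun k st =>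
    exists co ge base, stage_inv k (reps k) co ge base st)) => //.
  + exists id, (fun _ => N ^ n), (N ^ n + N ^ n).
    exact: stage_inv_setK.
  + move=> k st _ [co [ge [base [[N0 _ _ _ _] _ _ _ _ _ _ _ _ _ _ _]]]].
    by rewrite !evE N0 subn1.
  move=> k st kn gk [co [ge [base inv]]].
  have [r1 r2 lt] := steps kn.
  apply: (wp_mono (leqnn _)); last first.
    exact: (wp_stage inv r1 r2 (s1_neq_s2 kn) (tape_parts kn) (width kn)).
  move=> st' [gk' [co' [ge' [base' inv']]]]; split; first by rewrite gk' gk.
  exists co', ge', base'; exact: stage_inv_setK.
- move=> st [co [ge [base inv]]].
  apply: (@wp_output _ n.-1 (reps n.-1) co ge base st i0) => //.
  exact: reps_total.
- by rewrite leq_mul2l prednK // leqnSn orbT.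
Qed.

End Main.

End Specs.

End Program.

(** * From pre-morphisms to sums of products *)

Section Weights.

Variables (A : pzSemiRingType) (B : Type) (Omega : weighting A B).
Hypothesis hstrong : strong_pre_morphism Omega.
Hypothesis hcor : corestriction_independent Omega.
Variables (X Y : finType) (G : elgraph X) (H : elgraph Y).
Variable (W : {ffun vert G * vert H -> B}).

Notation V := (vert G).
Notation U := (vert H).
Notation Om := (Omega W).

Definition restr (f : V -> U) (S : {set V}) : fn S [set: U] :=
  [ffun x => exist _ (f (val x)) (in_setT _)].

Definition om S f := Om [set restr f S].

Definition qv v a := Om [set const_fn [set v] a].

(** Strongness allows both factors to have the full codomain. The join then has codomain [[set: U]
    :|: [set: U]], a different type from that of [restr]; corestriction independence bridges the
    two. *)
Lemma om_union S S1 S2 f : S = S1 :|: S2 -> [disjoint S1 & S2] ->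
  om S f = (om S1 f * om S2 f)%R.
Proof.
move=> -> dis.
have fT x : f x \in [set: U] :|: [set: U] by rewrite setUid inE.
pose g : fn (S1 :|: S2) ([set: U] :|: [set: U]) :=
  [ffun x => exist _ (f (val x)) (fT _)].
rewrite /om (@hcor X Y G H W _ _ _ (restr f (S1 :|: S2)) g); last 2 first.
- by rewrite subsetT.
- by move=> x; rewrite !ffunE.
rewrite -(proj2 hstrong) //; congr (Om _); apply/setP => h; rewrite !inE.
apply/eqP/existsP => [->|[f1 /andP[/set1P-> /existsP[f2 /andP[/set1P->]]]]].
  exists (restr f S1); rewrite set11; apply/existsP; exists (restr f S2).
  rewrite set11 /=; apply/andP; split; apply/forallP => x; apply/forallP => y;
    by apply/implyP => /eqP e; rewrite !ffunE /= e.
case/andP=> /forallP j1 /forallP j2; apply/ffunP => x; apply: val_inj.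
rewrite ffunE /=; case/setUP: (valP x) => xS.
  have /forallP/(_ (exist _ (val x) xS)) := j1 x.
  by rewrite eqxx => /eqP ->; rewrite ffunE.
have /forallP/(_ (exist _ (val x) xS)) := j2 x.
by rewrite eqxx => /eqP ->; rewrite ffunE.
Qed.

Lemma om1 v f : om [set v] f = qv v (f v).
Proof.
apply: hcor; first exact: subsetT.
by move=> x; rewrite !ffunE /=; have /set1P -> := valP x.
Qed.

(** The set [{v, w}] can be split in either order, which yields both products. *)
Lemma qv_comm v w a b : v != w -> (qv v a * qv w b = qv w b * qv v a)%R.
Proof.
move=> vw; pose f x := if x == v then a else b.
have fv : f v = a by rewrite /f eqxx.
have fw : f w = b by rewrite /f eq_sym (negbTE vw).
rewrite -fv -fw -!om1 -(@om_union [set v; w]) //; last first.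
  by rewrite disjoints1 inE.
by rewrite -(@om_union [set v; w]) // 1?setUC // disjoints1 inE eq_sym.
Qed.

Lemma Om_sum (S : {set V}) (T : {set U}) (F : {set fn S T}) :
  Om F = (\sum_(g in F) Om [set g])%R.
Proof.
have [pm _] := hstrong.
move: {2}#|F| (erefl #|F|) => k; elim: k F => [|k IH] F cF.
  by rewrite (cards0_eq cF) (pre_morphism_empty pm) big_set0.
have /card_gt0P[g gF] : 0 < #|F| by rewrite cF.
have cD : #|F :\ g| = k by move: cF; rewrite (cardsD1 g) gF => -[].
rewrite -(setD1K gF) (pre_morphism_union pm); last by rewrite disjoints1 !inE eqxx.
by rewrite (IH _ cD) big_setU1 // !inE eqxx.
Qed.

Notation n := #|V|.

Definition qi (i : 'I_n) a := qv (enum_val i) a.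

Lemma qi_comm i j a b : i != j -> (qi i a * qi j b = qi j b * qi i a)%R.
Proof. by move=> ij; apply: qv_comm; rewrite (inj_eq enum_val_inj). Qed.

Lemma om_wt (F : {ffun 'I_n -> U}) : 0 < n ->
  om [set: V] (fun v => F (enum_rank v)) = wt qi xpredT F.
Proof.
move=> n0; set f := fun v => _.
pose pre k := [set v : V | enum_rank v < k].
have gen k : k < n -> om (pre k.+1) f = wt qi (fun i => i < k.+1) F.
  elim: k => [|k IH] kn.
    pose i0 := Ordinal kn; rewrite (_ : pre 1 = [set enum_val i0]).
      rewrite om1 /f enum_valK /wt (big_pred1 i0) // => i.
      by rewrite ltnS leqn0.
    apply/setP=> v; rewrite !inE ltnS leqn0 -(inj_eq enum_rank_inj) enum_valK.
    by rewrite -val_eqE.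
  pose i := Ordinal kn.
  rewrite (om_union (S1 := pre k.+1) (S2 := [set enum_val i])).
  - rewrite IH ?(ltnW kn) // om1 /f enum_valK.
    rewrite (wtU qi_comm (D := fun i => i < k.+2) (D1 := fun i => i < k.+1) (D2 := pred1 i)).
    + by congr (_ * _)%R; rewrite /wt (big_pred1 i).
    + by move=> j; rewrite ltnS leq_eqVlt orbC /= -val_eqE.
    + by move=> j; apply/negP => /andP[jk /eqP e]; rewrite e ltnn in jk.
  - apply/setP=> v; rewrite !inE ltnS leq_eqVlt orbC -(inj_eq enum_rank_inj v) enum_valK.
    by rewrite -val_eqE.
  - by rewrite disjoint_sym disjoints1 inE enum_valK ltnn.
have -> : [set: V] = pre n.-1.+1.
  by apply/setP=> v; rewrite !inE prednK // ltn_ord.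
rewrite gen ?prednK //; apply: eq_wt => // i; by rewrite ltn_ord.
Qed.

Variable (R : {set X * Y}).

(** Shifted by one to keep 0 for e. *)
Definition lnum (x : X) : nat := (enum_rank x).+1.
Definition lbG (i j : 'I_n) := lnum (lab (enum_val i) (enum_val j)).
Definition cpH (l : nat) (a b : U) :=
  [exists x : X, (lnum x == l) && ((x, lab a b) \in R)].

Lemma cpHE x a b : cpH (lnum x) a b = ((x, lab a b) \in R).
Proof.
apply/existsP/idP => [[y /andP[/eqP[] /val_inj/enum_rank_inj->//]]|h].
by exists x; rewrite eqxx.
Qed.

Lemma Om_morphisms : 0 < n -> Om (morphisms R G H) =
  (\sum_(F : {ffun 'I_n -> U} | [forall v, forall w, cpH (lbG v w) (F v) (F w)])
     wt qi xpredT F)%R.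
Proof.
move=> n0; rewrite Om_sum.
pose h (F : {ffun 'I_n -> U}) := restr (fun v => F (enum_rank v)) [set: V].
pose h' (g : fn [set: V] [set: U]) : {ffun 'I_n -> U} :=
  [ffun i => val (g (exist _ (enum_val i) (in_setT _)))].
have hK : cancel h h' by move=> F; apply/ffunP => i; rewrite !ffunE /= enum_valK.
have h'K : cancel h' h.
  move=> g; apply/ffunP => x; apply: val_inj; rewrite !ffunE /=; congr (val (g _)).
  by apply: val_inj; rewrite /= enum_rankK.
rewrite (reindex h); last by exists h' => ? _; [apply: hK | apply: h'K].
apply: eq_big => F; last by move=> _; rewrite -om_wt.
rewrite inE; apply/forallP/forallP => hm.
  move=> i; apply/forallP => j; rewrite /lbG cpHE.
  by have /forallP/(_ (enum_val j)) := hm (enum_val i); rewrite !ffunE /= !enum_valK.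
move=> u; apply/forallP => v; rewrite !ffunE /= -cpHE.
have /forallP/(_ (enum_rank v)) := hm (enum_rank u).
by rewrite /lbG !enum_rankK.
Qed.

End Weights.

(** * Contraction sequences *)

Section Partitions.

Variable (V : finType).
Notation n := #|V|.
Implicit Types (P Q : {set {set V}}) (S : {set V}) (v w : V).

Definition min_index S := find [in S] (enum V).

Lemma min_index_lt S v : v \in S -> min_index S < n.
Proof.
move=> vS; rewrite /min_index cardE -has_find; apply/hasP; exists v => //.
by rewrite mem_enum.
Qed.

Lemma min_index_le S v : v \in S -> min_index S <= enum_rank v.
Proof.
move=> vS; rewrite leqNgt; apply/negP => /(before_find v) /=.
by rewrite -enum_val_nth enum_rankK vS.
Qed.

Lemma min_index_in S (i : 'I_n) : i = min_index S :> nat -> enum_val i \in S.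
Proof.
move=> e; have vS : has [in S] (enum V) by rewrite has_find -cardE -[find _ _]e.
by have := nth_find (enum_val i) vS; rewrite -[find _ _]e -enum_val_nth.
Qed.

Lemma min_index_char S (i : 'I_n) : enum_val i \in S ->
  (forall v, v \in S -> i <= enum_rank v) -> min_index S = i.
Proof.
move=> iS h; have lt := min_index_lt iS.
apply/eqP; rewrite eqn_leq; apply/andP; split.
  by have := min_index_le iS; rewrite enum_valK.
have := h _ (min_index_in (i := Ordinal lt) erefl).
by rewrite enum_valK.
Qed.

Definition is_part P := [/\ forall S, S \in P -> S != set0,
  forall S S' v, S \in P -> S' \in P -> v \in S -> v \in S' -> S = S'
  & forall v, exists2 S, S \in P & v \in S].

Lemma pblock_is_part P S v : is_part P -> S \in P -> v \in S -> pblock P v = S.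
Proof.
move=> [_ h _] SP vS; rewrite /pblock; case: pickP => [S' /andP[S'P vS']|/(_ S)] /=.
  exact: (h _ _ v).
by rewrite SP vS.
Qed.

Lemma mem_pblock_is_part P v : is_part P -> (v \in pblock P v) && (pblock P v \in P).
Proof.
by move=> pP; have [_ _ /(_ v)[S SP vS]] := pP; rewrite (pblock_is_part pP SP vS) SP vS.
Qed.

Lemma is_part_singletons : is_part (singletons V).
Proof.
split=> [_ /imsetP[v _ ->]|_ _ v /imsetP[a _ ->] /imsetP[b _ ->]|v].
- by apply/set0Pn; exists v; rewrite set11.
- by move=> /set1P-> /set1P->.
- by exists [set v]; rewrite ?set11 // imset_f.
Qed.

Definition rep P (i : 'I_n) : 'I_n := insubd i (part_number P (enum_val i)).

Lemma repE P i : is_part P -> rep P i = part_number P (enum_val i) :> nat.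
Proof.
move=> pP; rewrite /rep val_insubd ifT //.
by have /andP[h _] := mem_pblock_is_part (enum_val i) pP; apply: min_index_lt h.
Qed.

Lemma rep_block P S i : is_part P -> S \in P -> enum_val i \in S ->
  rep P i = min_index S :> nat.
Proof. by move=> pP SP iS; rewrite repE // /part_number (pblock_is_part pP SP iS). Qed.

Lemma rep_same_block P S i j : is_part P -> S \in P -> enum_val i \in S ->
  rep P j = rep P i -> enum_val j \in S.
Proof.
move=> pP SP iS e; have /andP[jb bP] := mem_pblock_is_part (enum_val j) pP.
have e1 : rep P i = min_index S :> nat by apply: rep_block.
have e2 : rep P j = min_index (pblock P (enum_val j)) :> nat by apply: rep_block.
have r1 := min_index_in e1; have r2 := min_index_in e2; rewrite e in r2.
have [_ h _] := pP; by rewrite (h _ _ _ SP bP r1 r2).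
Qed.

(** Each part is represented by its least vertex, as on the tape. Of two merged parts, the one with
    the smaller minimum gives its representative to the union. *)
Lemma merge_step_rep P Q : is_part P -> merge_step P Q ->
  is_part Q /\ exists s1 s2 : 'I_n, [/\ rep P s1 = s1, rep P s2 = s2,
    s1 < s2 & forall i, rep Q i = merge_rep (rep P) s1 s2 i].
Proof.
move=> pP /existsP[S1 /andP[S1P /existsP[S2 /andP[S2P /andP[ne /eqP QE]]]]].
have [ne0 uni cov] := pP.
have dis v : v \in S1 -> v \in S2 -> False.
  by move=> v1 v2; move/eqP: ne; apply; apply: (uni _ _ v).
have inQ S : S \in Q = (S == S1 :|: S2) || [&& S != S1, S != S2 & S \in P].
  by rewrite QE !inE andbCA.
have pQ : is_part Q.
  split=> [S|S S' v|v].
  - rewrite inQ => /orP[/eqP->|/and3P[_ _ /ne0 //]].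
    have /set0Pn[v vS] := ne0 _ S1P; apply/set0Pn; exists v; by rewrite inE vS.
  - have cross T : T \in P -> T != S1 -> T != S2 -> v \in T -> v \in S1 :|: S2 -> False.
      move=> TP /eqP n1 /eqP n2 vT /setUP[] vS; first by apply: n1; apply: (uni _ _ v).
      by apply: n2; apply: (uni _ _ v).
    rewrite !inQ => /orP[/eqP->|/and3P[n1 n2 SP]] /orP[/eqP->|/and3P[n1' n2' S'P]] //.
    + by move=> h h'; case: (cross S').
    + by move=> h h'; case: (cross S).
    + exact: uni.
  - have [S SP vS] := cov v.
    have [e|n1] := eqVneq S S1.
      by exists (S1 :|: S2); rewrite ?inQ ?eqxx // inE -e vS.
    have [e|n2] := eqVneq S S2.
      by exists (S1 :|: S2); rewrite ?inQ ?eqxx // inE -e vS orbT.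
    by exists S; rewrite // inQ n1 n2 SP orbT.
split=> //.
wlog lt : S1 S2 S1P S2P ne QE dis inQ / min_index S1 < min_index S2.
  move=> hw; case: (ltngtP (min_index S1) (min_index S2)) => [|lt|e].
  - exact: hw.
  - apply: (hw S2 S1) => //; first by rewrite eq_sym.
    + by rewrite QE [S2 :|: S1]setUC; congr (_ |: _); apply/setP => S; rewrite !inE andbCA.
    + by move=> v h1 h2; apply: (dis v).
    + by move=> S; rewrite inQ [S2 :|: S1]setUC; congr (_ || _); rewrite andbCA.
  - have /set0Pn[v vS] := ne0 _ S1P.
    have r1 := min_index_in (i := Ordinal (min_index_lt vS)) erefl.
    have := @min_index_in S2 (Ordinal (min_index_lt vS)) e => r2.
    by case: (dis _ r1 r2).
have /set0Pn[v1 v1S] := ne0 _ S1P; have /set0Pn[v2 v2S] := ne0 _ S2P.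
pose s1 := Ordinal (min_index_lt v1S); pose s2 := Ordinal (min_index_lt v2S).
have in1 : enum_val s1 \in S1 by apply: min_index_in.
have in2 : enum_val s2 \in S2 by apply: min_index_in.
have r1 : rep P s1 = s1 by apply: val_inj; apply: rep_block.
have r2 : rep P s2 = s2 by apply: val_inj; apply: rep_block.
exists s1, s2; split=> // i; apply: val_inj; rewrite /merge_rep /=.
have UQ : S1 :|: S2 \in Q by rewrite inQ eqxx.
have min12 : min_index (S1 :|: S2) = s1.
  apply: min_index_char; first by rewrite inE in1.
  move=> v /setUP[] vS; first exact: min_index_le.
  by apply: leq_trans (min_index_le vS); apply: ltnW.
have [S SP iS] := cov (enum_val i).
have [e|n2] := eqVneq S S2.
  rewrite e in iS; have -> : rep P i == s2 by rewrite -val_eqE /= (rep_block pP S2P iS).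
  by rewrite (rep_block pQ UQ) ?inE ?iS ?orbT.
have -> : (rep P i == s2) = false.
  apply/eqP => e; have := rep_same_block pP S2P in2 (j := i); rewrite r2 e => /(_ erefl) i2.
  by move/eqP: n2; apply; apply: (uni _ _ (enum_val i)).
have [e|n1] := eqVneq S S1.
  by rewrite e in iS; rewrite (rep_block pQ UQ) ?inE ?iS // (rep_block pP S1P iS).
by rewrite (rep_block pP SP iS) (rep_block pQ _ iS) // inQ n1 n2 SP orbT.
Qed.

End Partitions.

(** * Representatives as vertices of the contraction *)

Section Width.

Variables (X : finType) (G : elgraph X) (Q : {set {set vert G}}).
Hypothesis pQ : is_part Q.
Notation V := (vert G).
Notation n := #|V|.
Notation lb := (@lbG _ G).

Definition block (i : 'I_n) : vert (contraction G Q) :=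
  exist _ (pblock Q (enum_val i)) (proj2 (andP (mem_pblock_is_part (enum_val i) pQ))).

Lemma hetero_lab i j : rep Q i = i -> rep Q j = j ->
  hetero lb (rep Q) i j -> lab (block i) (block j) = None.
Proof.
move=> ri rj /existsP[v /existsP[w /and3P[/eqP rv /eqP rw ne]]].
rewrite /=; case: pickP => // x /forallP h.
have inb k l : rep Q k = rep Q l -> enum_val k \in pblock Q (enum_val l).
  have /andP[h1 h2] := mem_pblock_is_part (enum_val l) pQ.
  exact: rep_same_block.
have all u u' : rep Q u = rep Q i -> rep Q u' = rep Q j ->
    lab (enum_val u) (enum_val u') = x.
  move=> eu eu'; have := h (enum_val u); rewrite inb //= => /forallP/(_ (enum_val u')).
  by rewrite inb //= => /eqP.
by move: ne; rewrite /lbG all ?all ?eqxx // ?rv ?rw ?ri ?rj.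
Qed.

Lemma connect_block i j :
  connect (eadj lb (rep Q)) i j -> connect (@e_adj _ (contraction G Q)) (block i) (block j).
Proof.
case/connectP=> p; elim: p i => [|k p IH] i /=; first by move=> _ ->.
move=> /andP[/and3P[/eqP ri /eqP rk h] pk] jl.
apply: connect_trans (IH k pk jl); apply: connect1; rewrite /e_adj.
by case/orP: h => h; apply/orP; [left|right]; apply/eqP; apply: hetero_lab.
Qed.

(** Every index reached along [eadj] is a representative, and distinct representatives lie in
    distinct blocks; so the set injects into an e-component of the contraction. *)
Lemma card_connect_rep s : rep Q s = s ->
  #|[set j | connect (eadj lb (rep Q)) s j]| <= max_component (contraction G Q).
Proof.
move=> rs; have fix_ j : connect (eadj lb (rep Q)) s j -> rep Q j = j.
  case/connectP=> p; elim/last_ind: p j => [|p x _] j; first by move=> _ ->.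
  by rewrite rcons_path last_rcons => /andP[_ /and3P[_ /eqP h _]] ->.
have inj : {in [set j | connect (eadj lb (rep Q)) s j] &, injective block}.
  move=> i j; rewrite !inE => /fix_ ri /fix_ rj e; rewrite -ri -rj; apply: val_inj.
  rewrite /= !repE // /part_number; congr (find _ _).
  by have := congr1 val e => /= ->.
rewrite -(card_in_imset inj).
apply: leq_trans (leq_bigmax (block s)); apply: subset_leq_card.
apply/subsetP => _ /imsetP[j + ->]; rewrite !inE; exact: connect_block.
Qed.

End Width.

Lemma eq_hetero n (lb : 'I_n -> 'I_n -> nat) rho rho' : rho =1 rho' ->
  hetero lb rho =2 hetero lb rho'.
Proof. by move=> e i j; apply: eq_existsb => v; apply: eq_existsb => w; rewrite !e. Qed.

Lemma eq_eadj n (lb : 'I_n -> 'I_n -> nat) rho rho' : rho =1 rho' ->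
  eadj lb rho =2 eadj lb rho'.
Proof. by move=> e i j; rewrite /eadj !e !(eq_hetero lb e). Qed.

Lemma nth_allpairs (S T W : Type) (f : S -> T -> W) x0 y0 z0 s t i j :
  i < size s -> j < size t ->
  nth z0 [seq f x y | x <- s, y <- t] (i * size t + j) = f (nth x0 s i) (nth y0 t j).
Proof.
elim: s i => //= x s IH [|i] isz jt; rewrite nth_cat size_map.
  by rewrite mul0n add0n jt (nth_map y0).
rewrite mulSn -addnA ltnNge leq_addr /= addnC addnK.
by rewrite -IH // addnC.
Qed.

(** * Reading the contraction sequence off the tape *)

Section Sequence.

Variables (X : finType) (G : elgraph X) (P : partition_seq G).
Hypothesis n_gt0 : 0 < #|vert G|.
Hypothesis optP : optimal_contraction_seq P.
Notation V := (vert G).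
Notation n := #|V|.
Notation lb := (@lbG _ G).

Definition Pk k := nth set0 P k.

Lemma Pk_step k : k < n.-1 -> merge_step (Pk k) (Pk k.+1).
Proof.
move=> kn; have [/andP[_ so] _] := optP; move/(sortedP set0): so; apply.
by rewrite size_tuple; lia.
Qed.

Lemma Pk_part k : k < n -> is_part (Pk k).
Proof.
elim: k => [_|k IH kn].
  have [/andP[/eqP h _] _] := optP; rewrite /Pk nth0 h; exact: is_part_singletons.
by case: (merge_step_rep (IH (ltnW kn)) (Pk_step (k := k) _)) => //; lia.
Qed.

Definition good_step k (x : 'I_n * 'I_n) :=
  [&& rep (Pk k) x.1 == x.1, rep (Pk k) x.2 == x.2, x.1 < x.2 &
      [forall i, rep (Pk k.+1) i == merge_rep (rep (Pk k)) x.1 x.2 i]].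

Definition step_of k : 'I_n * 'I_n :=
  odflt (Ordinal n_gt0, Ordinal n_gt0) [pick x | good_step k x].

Lemma step_ofP k : k < n.-1 -> good_step k (step_of k).
Proof.
move=> kn; rewrite /step_of; case: pickP => //= none.
have [|_ [s1 [s2 [h1 h2 h3 h4]]]] := merge_step_rep (Pk_part (k := k) _) (Pk_step kn).
  by lia.
have := none (s1, s2); rewrite /good_step /= h1 h2 !eqxx h3 => /forallP[] i.
by rewrite h4.
Qed.

Let s1 k := (step_of k).1.
Let s2 k := (step_of k).2.

Lemma rep_singletons i : rep (Pk 0) i = i.
Proof.
have pP := Pk_part n_gt0; apply: val_inj; rewrite /= (@rep_block _ _ [set enum_val i]) ?set11 //.
  by apply: min_index_char; rewrite ?set11 // => v /set1P ->; rewrite enum_valK.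
by have [/andP[/eqP h _] _] := optP; rewrite /Pk nth0 h imset_f.
Qed.

Lemma reps_rep k : k <= n.-1 -> reps s1 s2 k =1 rep (Pk k).
Proof.
elim: k => [_|k IH kn] i /=; first by rewrite rep_singletons.
have /and4P[_ _ _ /forallP/(_ i)/eqP ->] := step_ofP kn.
by rewrite /merge_rep IH // ltnW.
Qed.

Lemma reps_steps k : k < n.-1 ->
  [/\ reps s1 s2 k (s1 k) = s1 k, reps s1 s2 k (s2 k) = s2 k & s1 k < s2 k].
Proof.
move=> kn; have /and4P[/eqP h1 /eqP h2 h3 _] := step_ofP kn.
by rewrite !reps_rep ?(ltnW kn).
Qed.

(** After merge [k] the partition is an entry of the sequence past the first, so its contraction
    counts in the component-width, which optimality equates with [ctww G]. *)
Lemma reps_width k : k < n.-1 ->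
  #|[set j | connect (eadj lb (reps s1 s2 k.+1)) (s1 k) j]| <= ctww G.
Proof.
move=> kn; have e := reps_rep kn.
have pQ : is_part (Pk k.+1) by apply: Pk_part; lia.
have -> : [set j | connect (eadj lb (reps s1 s2 k.+1)) (s1 k) j] =
          [set j | connect (eadj lb (rep (Pk k.+1))) (s1 k) j].
  by apply/setP => j; rewrite !inE (eq_connect (eq_eadj lb e)).
apply: leq_trans (card_connect_rep pQ _) _.
  rewrite -e /=; have [h1 h2 h3] := reps_steps kn; rewrite /merge_rep h1 ifN //.
  by rewrite -val_eqE /= ltn_eqF.
have [_ <-] := optP; apply: (@leq_bigmax_seq _ _ xpredT) => //.
rewrite /Pk -nth_behead; apply: mem_nth; rewrite size_behead size_tuple; lia.
Qed.

Lemma tape0 : nth 0 (input_tape P) 0 = n. Proof. by []. Qed.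

Lemma tape_labels (i j : 'I_n) : nth 0 (input_tape P) (1 + (i * n + j)) + 1 = lb i j.
Proof.
have v0 := enum_val i; have se : size (enum V) = n by rewrite cardE.
rewrite /input_tape add1n /= nth_cat size_allpairs se.
rewrite ifT; last first.
  apply: leq_trans (_ : i.+1 * n <= _); first by rewrite mulSnr ltn_add2l.
  by rewrite leq_mul2r ltn_ord orbT.
have := @nth_allpairs _ _ _ (fun u v : V => nat_of_ord (enum_rank (lab u v)))
  v0 v0 0 (enum V) (enum V) i j.
rewrite !se => -> //.
by rewrite -!enum_val_nth addn1.
Qed.

Lemma tape_reps k : k < n.-1 ->
  forall i : 'I_n, nth 0 (input_tape P) (1 + n * n + n * k.+1 + i) = reps s1 s2 k.+1 i.
Proof.
move=> kn i; have v0 := enum_val i; have se : size (enum V) = n by rewrite cardE.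
have pQ : is_part (Pk k.+1) by apply: Pk_part; lia.
rewrite reps_rep // repE //.
rewrite /input_tape -!addnA add1n /= nth_cat size_allpairs se ltnNge leq_addr /= addKn.
have := @nth_allpairs _ _ _ (fun Q v => part_number Q v) set0 v0 0 P (enum V) k.+1 i.
rewrite !se size_tuple mulnC => -> //; last by lia.
by rewrite -enum_val_nth.
Qed.

End Sequence.

(** * Numbering of the subsets of the target *)

Section SubsetNumbering.

Variables (U : finType) (M : nat).
Hypothesis cardU : M.+1 = 2 ^ #|U|.

(** The empty set is put in front so that its code is 0, the mark of a part outside the support. *)
Definition subsets : seq {set U} := set0 :: rem set0 (enum {set U}).

Lemma subsets_uniq : uniq subsets.
Proof. by rewrite /= mem_rem_uniq ?rem_uniq ?enum_uniq // !inE eqxx. Qed.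

Lemma mem_subsets T : T \in subsets.
Proof. by rewrite inE mem_rem_uniq ?enum_uniq // !inE mem_enum andbT; case: eqP. Qed.

Lemma size_subsets : size subsets = M.+1.
Proof.
rewrite /= size_rem ?mem_enum // -cardE cardU prednK.
  by rewrite -[LHS]cardsT -powersetT card_powerset cardsT.
by apply/card_gt0P; exists set0.
Qed.

Definition decS (t : 'I_M.+1) : {set U} := nth set0 subsets t.
Definition encS (T : {set U}) : 'I_M.+1 := inord (index T subsets).

Lemma encSK : cancel encS decS.
Proof.
move=> T; rewrite /decS /encS inordK ?nth_index ?mem_subsets //.
by rewrite -size_subsets index_mem mem_subsets.
Qed.

Lemma decSK : cancel decS encS.
Proof.
move=> t; rewrite /decS /encS index_uniq ?subsets_uniq ?size_subsets //.
by rewrite inord_val.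
Qed.

End SubsetNumbering.

Lemma time_bound M c n : 0 < M -> 0 < n ->
  n.+1 * (M ^ c.+1).+1 * n.+1 <= 8 * M * (M ^ c * n ^ 2).
Proof.
move=> M0 n0; have Mc : 0 < M ^ c.+1 by rewrite expn_gt0 M0.
(* Each of the three successors at most doubles its argument, which gives 8; [M] comes from the
   exponent [c.+1]. *)
have -> : 8 * M * (M ^ c * n ^ 2) = (2 * n) * (2 * M ^ c.+1) * (2 * n).
  by rewrite -mulnn expnS; move: (M ^ c) => z; lia.
by apply: leq_mul; [apply: leq_mul|]; lia.
Qed.

Theorem theorem3 (A : pzSemiRingType) (B : Type)
    (Omega : weighting A B) (tau : evaluation_time B)
    (hpoly : poly_time tau)
    (hstrong : strong_pre_morphism Omega)
    (hcor : corestriction_independent Omega)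
    (X Y : finType) (H : elgraph Y) (R : {set X * Y}) :
  exists (algo : cmd) (K : nat),
    forall (G : elgraph X) (W : {ffun vert G * vert H -> B})
      (P : partition_seq G),
    0 < #|vert G| ->
    optimal_contraction_seq P ->
    computes_within (input_tape P) (evaluation_oracle Omega tau W) algo
      (Omega X Y G H W [set: vert G] [set: vert H] (morphisms R G H))
      (K * ((2 ^ #|vert H| - 1) ^ ctww G * #|vert G| ^ 2)).
Proof.
(* If H has no vertex there is no morphism, and cell 0 already holds the answer 0. *)
have [a0 _|noH] := pickP (fun _ : vert H => true); last first.
  exists Skip, 0 => G W P n0 _; exists (init_state A), 0; split=> //.
    exact: ExecSkip.
  have [pm _] := hstrong; rewrite (_ : morphisms R G H = set0).
    by rewrite (pre_morphism_empty pm).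
  apply/setP => f; have /card_gt0P[v _] := n0.
  by have := noH (val (f (exist _ v (in_setT v)))).
have [ct [d htau]] := hpoly.
pose h := #|vert H|; pose M := 2 ^ h - 1.
have h0 : 0 < h by apply/card_gt0P; exists a0.
have cardU : M.+1 = 2 ^ h by rewrite /M subn1 prednK // expn_gt0.
have M0 : 0 < M by rewrite /M subn_gt0 -{1}(expn0 2) ltn_exp2l.
pose dec := @decS (vert H) M; pose enc := @encS (vert H) M.
pose cp := @cpH X Y H R.
(* Every oracle call concerns a single vertex, so the polynomial bound is a constant that depends
   only on H, X and the labels of H. *)
pose C := ct * (1 + 1 + #|vert H| + #|X| + #|Y|) ^ d.
pose bad l t t' := ~~ @fits (vert H) M cp dec l (inord t) (inord t').
pose un t t' := nat_of_ord (enc (dec (inord t) :|: dec (inord t'))).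
pose sg := [seq (nat_of_ord (enum_rank a), nat_of_ord (enc [set a])) | a <- enum (vert H)].
pose algo := c_main M #|X| bad un sg.
exists algo, (scost C algo * (8 * M)) => G W P n0 optP.
have lb_le v w : @lbG _ G v w <= #|X| by apply: ltn_ord.
have dec0 : dec ord0 = set0 by [].
have badE l (t t' : 'I_M.+1) : bad l t t' = ~~ fits cp dec l t t'.
  by rewrite /bad !inord_val.
have unE (t t' : 'I_M.+1) : un t t' = enc (dec t :|: dec t').
  by rewrite /un !inord_val.
have qok (i : 'I_#|vert G|) a : exists2 t, evaluation_oracle Omega tau W
    [:: nat_of_ord i] (enum_rank a) = Some (qi Omega W i a, t) & t <= C.
  have sE : [set v : vert G | nat_of_ord (enum_rank v) \in [:: nat_of_ord i]] =
      [set enum_val i].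
    by apply/setP => v; rewrite !inE -(inj_eq enum_rank_inj v) enum_valK.
  exists (tau X Y G H W [set enum_val i] a).
    rewrite /evaluation_oracle; case: pickP => [b /= /eqP/val_inj/enum_rank_inj ->|/(_ a)].
      by rewrite sE.
    by rewrite /= eqxx.
  by apply: leq_trans (htau _ _ _ _ _ _ _) _; rewrite cards1.
have [st [t [ex tl res]]] := @wp_main M #|X| bad un sg A
  (nth 0 (input_tape P)) (evaluation_oracle Omega tau W) C #|vert G| (@lbG _ G)
  (fun _ _ => isT) (vert H) a0 cp (qi Omega W) dec enc (@qi_comm _ _ _ hstrong hcor _ _ G H W)
  (decSK cardU) (encSK cardU) dec0 lb_le badE unE M0 n0 erefl qok (tape0 P)
  (@tape_labels _ _ P) _ _ (ctww G) (reps_steps n0 optP) (tape_reps n0 optP)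
  (reps_width n0 optP).
exists st, t; split=> //; first by rewrite res (Om_morphisms hstrong hcor).
apply: leq_trans tl _; rewrite -[leqRHS]mulnA; apply: leq_mul (leqnn _) _.
exact: time_bound.
Qed.
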